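(* Let $u\in[-1,1]$ and let $(u_N)_{N\ge1}$ be a sequence such that for each $N$ we have $u_N=k/N$ for some integer $-N\le k\le N$, and such that $\lim_{N\to\infty}u_N=u$. Then the limit $$\lim_{N\to\infty}F_N(u_N)=\mathcal{P}(u)$$ exists and depends on $u$ but not on the sequence $(u_N)$.
   Context: For $N\ge 1$ let $\Sigma_N=\{-1,+1\}^N$. For $\ell=1,2$ let $(a_p^\ell)_{p\ge 1}$ be real sequences with $\sum_{p\ge1}(a_p^\ell)^2<\infty$, and define Gaussian Hamiltonians on $\Sigma_N$ by $$H_N^\ell(\sigma)=N^{1/2}\sum_{p\ge1}\frac{a_p^\ell}{N^{p/2}}\sum_{1\le i_1,\dots,i_p\le N}g_{i_1,\dots,i_p}\,\sigma_{i_1}\cdots\sigma_{i_p},$$ where $(g_{i_1,\dots,i_p})$ are standard Gaussian random variables, independent for all $p\ge 1$ and all $(i_1,\dots,i_p)$ (the same $g$'s are used for $\ell=1$ and $\ell=2$). For $\ell,\ell'\in\{1,2\}$ define $\xi_{\ell,\ell'}:[-1,1]\to\mathbb{R}$ by $\xi_{\ell,\ell'}(x)=\sum_{p\ge1}a_p^\ell a_p^{\ell'}x^p$, so that $\frac1N\mathbb{E}H_N^\ell(\sigma^1)H_N^{\ell'}(\sigma^2)=\xi_{\ell,\ell'}(R_{1,2})$, where $R_{1,2}=R(\sigma^1,\sigma^2)=\frac1N\sum_{i\le N}\sigma_i^1\sigma_i^2$ is the overlap. It is assumed that the sequences $(a_p^\ell)$ are such that the functions $\xi_{\ell,\ell'}$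 are convex on $[-1,1]$. External fields $h_1,h_2\in\mathbb{R}$ are given. Define $F_N(u_N)=\frac1N\mathbb{E}\log Z_N(u_N)$, where $$Z_N(u_N)=\sum_{R_{1,2}=u_N}\exp\Big(\sum_{\ell\le2}H_N^\ell(\sigma^\ell)+\sum_{\ell\le2}h_\ell\sum_{i\le N}\sigma_i^\ell\Big),$$ the sum being over $(\sigma^1,\sigma^2)\in\Sigma_N^2$ with $R_{1,2}=u_N$. (The form $u_N=k/N$ is chosen so that the set $\{R_{1,2}=u_N\}$ is not empty.)
   Formalization: For each N the set {R_{1,2} = u_N} is assumed nonempty (i.e. u_N = k/N with k of the same parity as N); for k of the wrong parity Z_N(u_N) = 0 and log Z_N is undefined, so the claim as literally stated fails. *)

(* Defs.v *)
From mathcomp Require Export all_boot all_order all_algebra.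
From mathcomp Require Export all_classical all_reals all_analysis.
Import Order.TTheory GRing.Theory Num.Theory.
Import numFieldNormedType.Exports.

Set Implicit Arguments.
Unset Strict Implicit.
Unset Printing Implicit Defensive.

Local Open Scope classical_set_scope.
Local Open Scope ring_scope.

(** The spin [+1] is encoded by [false] and [-1] by [true]; sites are numbered
    [0, ..., N-1] and the two systems are numbered [0, 1 : 'I_2]. *)
Definition config (N : nat) : finType := {ffun 'I_N -> bool}.

Definition spin (R : realType) (N : nat) (s : config N) (i : 'I_N) : R :=
  (-1) ^+ s i.

Definition overlap (R : realType) (N : nat) (s t : config N) : R :=
  N%:R^-1 * \sum_(i < N) spin R s i * spin R t i.

Definition independent_on d (T : measurableType d) (R : realType)
    (P : probability T R) (I : choiceType) (D : set I)
    (X : I -> {RV P >-> R}) : Prop :=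
  forall (J : seq I) (B : I -> set R),
    uniq J -> [set` J] `<=` D -> (forall i, measurable (B i)) ->
    P (\bigcap_(i in [set` J]) (X i @^-1` B i)) =
      (\big[*%E/1%E]_(i <- J) P (X i @^-1` B i))%E.

(** The disorder [g_{i_1,...,i_p}] is [g [:: i_1; ...; i_p]], so that only
    nonempty index sequences ([p >= 1]) are constrained. *)
Definition gaussian_disorder d (T : measurableType d) (R : realType)
    (P : probability T R) (g : seq nat -> {RV P >-> R}) : Prop :=
  (forall s, s != [::] -> forall B : set R, measurable B ->
     distribution P (g s) B = normal_prob 0 1 B) /\
  independent_on [set s | s != [::]] g.

Definition xi (R : realType) (a : 'I_2 -> nat -> R) (l l' : 'I_2) (x : R) : R :=
  limn (fun n => \sum_(1 <= p < n) a l p * a l' p * x ^+ p).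

(** The series over [p] is the pointwise limit of its partial sums. For
    square-summable [a] it converges almost surely (its terms are independent
    and centered, with variances [N * a l p ^+ 2]); on the exceptional null set
    [lim] takes a default value. *)
Definition hamiltonian d (T : measurableType d) (R : realType)
    (P : probability T R) (g : seq nat -> {RV P >-> R})
    (a : 'I_2 -> nat -> R) (N : nat) (l : 'I_2) (s : config N) (w : T) : R :=
  Num.sqrt N%:R *
  limn (fun n => \sum_(1 <= p < n) a l p / (N%:R `^ (p%:R / 2)) *
    \sum_(i : p.-tuple 'I_N)
      g [seq nat_of_ord j | j <- i] w * \prod_(j <- i) spin R s j).

Definition partition_function d (T : measurableType d) (R : realType)
    (P : probability T R) (g : seq nat -> {RV P >-> R})
    (a : 'I_2 -> nat -> R) (h : 'I_2 -> R) (N : nat) (v : R) (w : T) : R :=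
  \sum_(s : {ffun 'I_2 -> config N} | overlap R (s 0) (s 1) == v)
    expR (\sum_(l < 2) hamiltonian g a l (s l) w +
          \sum_(l < 2) h l * \sum_(i < N) spin R (s l) i).

(** Meaningful only when some pair of configurations has overlap [v]: otherwise
    the partition function vanishes and [ln 0] is the junk value [0]. *)
Definition free_energy d (T : measurableType d) (R : realType)
    (P : probability T R) (g : seq nat -> {RV P >-> R})
    (a : 'I_2 -> nat -> R) (h : 'I_2 -> R) (N : nat) (v : R) : \bar R :=
  ((N%:R^-1)%:E * 'E_P[fun w => ln (partition_function g a h N v w)])%E.

(* Main.v *)
(** Grouping the spins by blocks, the constraint [overlap = u] on a system of
    size [N1 + N2] is implied by the constraints [overlap = u1] and
    [overlap = u2] on the two blocks when [N u = N1 u1 + N2 u2], and the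
    covariance of the large system differs from that of two independent blocks
    by convexity defects of the [xi a l l']. A Gaussian comparison then bounds
    the sum of the two free energies by that of the large system, up to the
    defect of the diagonal term [xi a 0 1], which does not have a favourable
    sign but is constant on the constraint set and hence can be subtracted:
    [E log Z_N(u) - N xi a 0 1 u] is superadditive in [(N, N u)]. It is also
    equicontinuous at scale [N], because changing [u] by [2 j / N] amounts to
    flipping [j] spins of the second configuration, a map with fibres of size
    at most ['C(N, j)]. Fekete's argument gives the limit.

    The comparison [gmeans_lse_le] replaces interpolation and Gaussian
    integration by parts: each Gaussian coefficient is split into [2 ^ k]
    independent copies scaled by [2 ^ (- k / 2)], and the second order Taylor
    expansion of log-sum-exp compares the two systems one small step at a time.
    For the infinite series over [p], Ottaviani's maximal inequality gives the
    almost sure convergence, and truncated series converge in mean. *)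
From HB Require Import structures.
Require Import Defs.
From mathcomp Require Import all_boot all_order all_algebra.
From mathcomp Require Import all_classical all_reals all_analysis.
From mathcomp Require Import measurable_realfun ring lra.
Import Order.TTheory GRing.Theory Num.Theory.
Import numFieldNormedType.Exports.

Set Implicit Arguments.
Unset Strict Implicit.
Unset Printing Implicit Defensive.

Local Open Scope classical_set_scope.
Local Open Scope ring_scope.

(** For a centered Gaussian vector, the mean of log-sum-exp depends only on the law of the
    increments: the averaged second order term is a quarter of the Gibbs average of [sqdist], up to
    the variance. Hence the comparison asks only for an inequality between squared distances, with
    an allowance [4 * e], and it serves three times: independent blocks against the large system, a
    system against its image under flips, and a system against no disorder at all. The overlap is
    replaced by the number [q] of disagreeing sites, [u = 1 - 2 q / N], so that a constraint is a
    pair [(N, q)] of natural numbers, additive under concatenation. On the constraint set [xi a 0 0]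
    and [xi a 1 1] enter the variances at overlap 1 and cancel between blocks and large system; only
    [xi a 0 1] leaves a defect. Expectations over finitely many Gaussians are iterated
    one-dimensional integrals [gmeans], for which splitting and commutation are elementary;
    [lincomb_gmeans] carries them to the probability space. *)

(** * One-dimensional Gaussian integrals *)

Section normal_density_integral.
Context {R : realType}.
Local Notation mu := (@lebesgue_measure R).
Local Notation gam := (normal_prob (0:R) 1).

(** The Radon-Nikodym derivative and the density have equal integrals over every measurable set,
    hence agree almost everywhere. *)
Lemma ge0_integral_normal_prob (f : R -> \bar R) :
  measurable_fun [set: R] f -> (forall x, 0 <= f x)%E ->
  (\int[gam]_x f x = \int[mu]_x (f x * (normal_pdf (0:R) 1 x)%:E))%E.
Proof.
move=> mf f0.
have dom := @normal_prob_dominates R 0 1.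
rewrite -(Radon_Nikodym_SigmaFinite.change_of_variables dom)//=.
apply: ae_eq_integral => //.
- apply: emeasurable_funM => //; apply: (measurable_int mu).
  exact: Radon_Nikodym_SigmaFinite.f_integrable.
- apply: emeasurable_funM => //=; apply/measurable_EFinP.
  exact: measurable_normal_pdf.
apply: ae_eqe_mul2l => /=.
apply: integral_ae_eq => //=.
- exact: Radon_Nikodym_SigmaFinite.f_integrable.
- by apply/measurable_EFinP; exact: measurable_normal_pdf.
- by move=> E _ mE; rewrite -Radon_Nikodym_SigmaFinite.f_integral.
Qed.

(** [k] times the image of Lebesgue measure under the affine map gives every half-open interval its
    length, hence is Lebesgue measure by uniqueness. *)
Lemma ge0_integral_affine (k b : R) (f : R -> \bar R) : 0 < k ->
  measurable_fun [set: R] f -> (forall x, 0 <= f x)%E ->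
  (\int[mu]_x f (k * x + b)%R = k^-1%:E * \int[mu]_x f x)%E.
Proof.
move=> k0 mf f0.
have k0' : 0 <= k by exact: ltW.
pose phi (x : R) : measurableTypeR R := k * x + b.
have mphi : measurable_fun setT phi.
  by apply: measurable_funD => //; exact: measurable_funM.
pose kn : {nonneg R} := NngNum k0'.
have E A : measurable A -> mu A = mscale kn (pushforward mu phi) A.
  move=> mA.
  apply: (@lebesgue_measure_unique R (mscale kn (pushforward mu phi))) => //.
  move=> _ [[x y]] _ <-.
  transitivity (k%:E * mu (`]((x - b) / k)%R, ((y - b) / k)%R]%classic : set R))%E; last first.
    congr (_ * mu _)%E; apply/seteqP; split => z /=; rewrite !in_itv /=.
      by rewrite /phi ltr_pdivrMr// ler_pdivlMr// ltrBlDr lerBrDr [z * k]mulrC.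
    by rewrite /phi ltr_pdivrMr// ler_pdivlMr// ltrBlDr lerBrDr [z * k]mulrC.
  rewrite !lebesgue_measure_itv /= !lte_fin.
  rewrite ltr_pM2r ?invr_gt0// ltrD2r; case: ifPn => _; last by rewrite mule0.
  by rewrite -!EFinD -EFinM; congr EFin; field; rewrite gt_eqF.
rewrite [in RHS](eq_measure_integral (mscale kn (pushforward mu phi))); last first.
  by move=> A mA _; exact: E.
rewrite ge0_integral_mscale//= muleA -EFinM mulVf ?gt_eqF// mul1e.
by rewrite ge0_integral_pushforward.
Qed.

End normal_density_integral.

Section normal_stability.
Context {R : realType}.
Local Notation mu := (@lebesgue_measure R).
Local Notation gam := (normal_prob (0:R) 1).
Local Notation s := ((Num.sqrt 2)^-1 : R).
Local Notation phi := (normal_pdf (0:R) 1).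

Let s_neq0 : s != 0. Proof. by rewrite gt_eqF. Qed.
Let s2 : s ^+ 2 = 2^-1. Proof. by rewrite exprVn sqr_sqrtr. Qed.

(** Completing the square: for [u = s * (x + y)] the joint density of [(x, u)] factors into the law
    of [u] and the conditional law of [x] given [u], normal with mean [s * u] and standard deviation
    [s]. The factor [s^-1] is the Jacobian. *)
Let pdf_rotation (u x : R) :
  s^-1 * (phi (s^-1 * u - x) * phi x) = phi u * normal_pdf (s * u) s x.
Proof.
have peak : s^-1 * normal_peak 1 = normal_peak s :> R.
  rewrite /normal_peak expr1n s2 mul1r; move: (@pi_ge0 R); set p := pi => p0.
  have -> : 2^-1 * p *+ 2 = p by rewrite -mulr_natr; field.
  have -> : p *+ 2 = 2 * p by rewrite mulr_natl.
  have r0 : Num.sqrt 2 != 0 :> R by rewrite gt_eqF// sqrtr_gt0.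
  by rewrite sqrtrM// invfM invrK mulrA mulfV// mul1r.
rewrite !normal_pdfE ?oner_neq0// -peak /normal_fun.
move: (normal_peak 1) => p.
set e1 := expR _; set e2 := expR _; set e3 := expR _; set e4 := expR _.
suff e12 : e1 * e2 = e3 * e4.
  by rewrite mulrACA e12 [RHS]mulrACA !mulrA; congr (_ * _ * _); rewrite mulrC mulrA.
rewrite -!expRD; congr expR.
have -> : 1 ^+ 2 *+ 2 = 2 :> R by rewrite expr1n.
have -> : s ^+ 2 *+ 2 = 1 by rewrite s2 -mulr_natr mulVf// pnatr_eq0.
rewrite !subr0 divr1.
have -> : (s^-1 * u - x) ^+ 2 = 2 * u ^+ 2 - 2 * s^-1 * u * x + x ^+ 2.
  by rewrite sqrrB exprMn invrK sqr_sqrtr//; ring.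
have -> : (x - s * u) ^+ 2 = x ^+ 2 - 2 * s * u * x + 2^-1 * u ^+ 2.
  by rewrite sqrrB exprMn s2; ring.
have -> : s^-1 = 2 * s.
  by apply: (mulfI s_neq0); rewrite mulfV// mulrCA -expr2 s2 mulfV// pnatr_eq0.
by field.
Qed.

(** Substitute [u = s * (x + y)] in the inner integral, exchange the integrals, and integrate out
    the conditional density of [x] given [u]. *)
Lemma ge0_integral_normal_rotation (f : R -> \bar R) :
  measurable_fun [set: R] f -> (forall x, 0 <= f x)%E ->
  (\int[gam]_x \int[gam]_y f (s * (x + y))%R = \int[gam]_x f x)%E.
Proof.
move=> mf f0.
have mphi : measurable_fun [set: R] phi by exact: measurable_normal_pdf.
have phi0 x : 0 <= phi x by exact: normal_pdf_ge0.
have maff (k b : R) : measurable_fun [set: R] (fun x => k * x + b).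
  by apply: measurable_funD => //; exact: measurable_funM.
have mpair : measurable_fun [set: R * R]
    (fun z : R * R => (f z.2 * (s^-1 * (phi (s^-1 * z.2 - z.1) * phi z.1))%:E))%E.
  apply: emeasurable_funM; first exact: measurableT_comp.
  apply/measurable_EFinP; apply: measurable_funM => //.
  apply: measurable_funM; last exact: measurableT_comp.
  apply: measurableT_comp => //; apply: measurable_funB => //.
  by apply: measurable_funM.
transitivity (\int[mu]_x \int[mu]_u
    (f u * (s^-1 * (phi (s^-1 * u - x) * phi x))%:E))%E.
  rewrite ge0_integral_normal_prob; first last.
  - by move=> x; exact: integral_ge0.
  - have mf2 : measurable_fun [set: R * R] (fun z => f (s * (z.1 + z.2))).
      apply: measurableT_comp => //; apply: measurable_funM => //.
      exact: measurable_funD.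
    have f20 (z : R * R) : (0 <= f (s * (z.1 + z.2))%R)%E by [].
    exact: (@measurable_fun_fubini_tonelli_F _ _ _ _ _ gam _ mf2 f20).
  apply: eq_integral => x _.
  rewrite ge0_integral_normal_prob//; last first.
    apply: measurableT_comp => //.
    by apply: measurable_funM => //; exact: measurable_funD.
  pose h u := (f u * (phi (s^-1 * u - x))%:E)%E.
  have mh : measurable_fun [set: R] h.
    apply: emeasurable_funM => //; apply/measurable_EFinP.
    exact: measurableT_comp.
  have h0 u : (0 <= h u)%E by rewrite mule_ge0// lee_fin.
  have hE y : (f (s * (x + y))%R * (phi y)%:E = h (s * y + s * x)%R)%E.
    have -> : (s * y + s * x = s * (x + y))%R by ring.
    rewrite /h; congr (_ * (phi _)%:E)%E.
    by rewrite mulKf// addrC addKr.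
  under eq_integral do rewrite hE.
  rewrite ge0_integral_affine// muleC muleA -ge0_integralZl//; last first.
    by rewrite mule_ge0// lee_fin// invr_ge0 ltW.
  apply: eq_integral => u _; rewrite /h -EFinM muleCA; congr (_ * _)%E.
  by rewrite -EFinM; congr EFin; ring.
have pair0 (z : R * R) :
    (0 <= f z.2 * (s^-1 * (phi (s^-1 * z.2 - z.1) * phi z.1))%:E)%E.
  by rewrite mule_ge0// lee_fin !mulr_ge0// invr_ge0 ltW.
rewrite (@fubini_tonelli _ _ _ _ R mu mu _ mpair pair0).
rewrite [RHS]ge0_integral_normal_prob//; apply: eq_integral => u _ /=.
under eq_integral do rewrite pdf_rotation EFinM muleA.
rewrite ge0_integralZl//.
- by rewrite integral_normal_pdf mule1.
- by apply/measurable_EFinP; exact: measurable_normal_pdf.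
- by move=> x _; rewrite lee_fin normal_pdf_ge0.
- by rewrite mule_ge0// lee_fin.
Qed.

End normal_stability.

Lemma le_integrable_EFin d (T : measurableType d) (R : realType)
    (mu : {measure set T -> \bar R}) (f g : T -> R) :
  measurable_fun [set: T] f -> (forall x, `|f x| <= g x) ->
  mu.-integrable [set: T] (EFin \o g) -> mu.-integrable [set: T] (EFin \o f).
Proof.
move=> mf fg ig; apply: (le_integrable measurableT _ _ ig).
  exact/measurable_EFinP.
by move=> x _ /=; rewrite lee_fin (le_trans (fg x))// ler_norm.
Qed.

Section normal_exponential_moments.
Context {R : realType}.
Local Notation mu := (@lebesgue_measure R).
Local Notation gam := (normal_prob (0:R) 1).

(** The exponential tilt of the standard density is, up to the constant, the normal density with
    mean [l]. *)
Lemma integral_expR_normal_prob (l : R) :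
  (\int[gam]_z (expR (l * z))%:E = (expR (l ^+ 2 / 2))%:E)%E.
Proof.
rewrite ge0_integral_normal_prob//; last first.
  by apply/measurable_EFinP; exact: measurableT_comp.
transitivity (\int[mu]_z ((expR (l ^+ 2 / 2))%:E * (normal_pdf l 1 z)%:E))%E.
  apply: eq_integral => z _; rewrite -!EFinM; congr EFin.
  rewrite !normal_pdfE ?oner_neq0// /normal_fun mulrCA [RHS]mulrCA -!expRD.
  by congr (_ * expR _); rewrite expr1n -mulr_natr; field.
rewrite ge0_integralZl//; first by rewrite integral_normal_pdf mule1.
  by apply/measurable_EFinP; exact: measurable_normal_pdf.
by move=> x _; rewrite lee_fin normal_pdf_ge0.
Qed.

Lemma integrable_expR_normal_prob (l : R) :
  gam.-integrable setT (fun z => (expR (l * z))%:E).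
Proof.
apply/integrableP; split.
  by apply/measurable_EFinP; exact: measurableT_comp.
under eq_integral do rewrite gee0_abs ?lee_fin ?expR_ge0//.
by rewrite integral_expR_normal_prob ltry.
Qed.

Lemma integrable_expR_abs_normal_prob (l : R) :
  gam.-integrable setT (fun z => (expR (l * `|z|))%:E).
Proof.
refine (@le_integrable_EFin _ _ R gam (fun z => expR (l * `|z|))
    (fun z => expR (l * z) + expR ((- l) * z)) _ _ _).
- apply: measurableT_comp => //.
  by apply: measurable_funM => //; exact: measurableT_comp.
- move=> z /=; rewrite ger0_norm ?expR_ge0//.
  have [z0|z0] := ger0P z; first by rewrite lerDl expR_ge0.
  by rewrite mulrN -mulNr lerDr expR_ge0.
- exact: (integrableD measurableT (integrable_expR_normal_prob l)
    (integrable_expR_normal_prob (- l))).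
Qed.

End normal_exponential_moments.

(* [comp_measurable F] says that [F], a function of finitely many reals, is
   Borel without putting a sigma-algebra on [S -> R]. *)
Definition comp_measurable (R : realType) (S : Type) (F : (S -> R) -> R) :=
  forall d (U : measurableType d) (X : U -> S -> R),
    (forall s, measurable_fun [set: U] (X ^~ s)) ->
    measurable_fun [set: U] (F \o X).

(** Exponential growth is integrable against Gaussians and stable under products and Gaussian
    averages, and it covers both log-sum-exp and its Taylor polynomials. *)
Definition exp_growth (R : realType) (S : finType) (F : (S -> R) -> R) :=
  exists K L : R, [/\ 0 <= K, 0 <= L &
    forall x, `|F x| <= K * expR (L * \sum_s `|x s|)].

Definition admissible (R : realType) (S : finType) (F : (S -> R) -> R) :=
  comp_measurable F /\ exp_growth F.

Definition gmean (R : realType) (S : Type) (c : S -> R) (F : (S -> R) -> R)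
    (x : S -> R) : R :=
  \int[normal_prob 0 1]_z F (fun s => x s + z * c s).

(** * Averages over one Gaussian direction *)

Section admissible.
Context {R : realType} {S : finType}.
Implicit Types (F H : (S -> R) -> R) (c x : S -> R).
Local Notation gam := (normal_prob (0:R) 1).

Lemma admissible_cst (k : R) : admissible (fun _ : S -> R => k).
Proof.
split; first by move=> d U X mX; exact: measurable_cst.
exists `|k|, 0; split => // x.
by rewrite mul0r expR0 mulr1.
Qed.

Lemma admissible_coord (s : S) : admissible (fun x : S -> R => x s).
Proof.
split; first by move=> d U X mX; exact: mX.
exists 1, 1; split => // x; rewrite !mul1r.
apply: (@le_trans _ _ (\sum_s `|x s|)).
  by rewrite (bigD1 s)//= lerDl sumr_ge0.
by apply: le_trans (expR_ge1Dx _); rewrite lerDr.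
Qed.

Lemma admissibleD F H : admissible F -> admissible H ->
  admissible (fun x => F x + H x).
Proof.
move=> [mF [K1 [L1 [K10 L10 F1]]]] [mH [K2 [L2 [K20 L20 H2]]]]; split.
  by move=> d U X mX; apply: measurable_funD; [exact: mF|exact: mH].
exists (K1 + K2), (L1 + L2); split; rewrite ?addr_ge0// => x.
have n0 : 0 <= \sum_s `|x s| by rewrite sumr_ge0.
rewrite (le_trans (ler_normD _ _))// mulrDl lerD//.
  rewrite (le_trans (F1 x))// ler_wpM2l// ler_expR ler_wpM2r// lerDl//.
by rewrite (le_trans (H2 x))// ler_wpM2l// ler_expR ler_wpM2r// lerDr.
Qed.

Lemma admissibleM F H : admissible F -> admissible H ->
  admissible (fun x => F x * H x).
Proof.
move=> [mF [K1 [L1 [K10 L10 F1]]]] [mH [K2 [L2 [K20 L20 H2]]]]; split.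
  by move=> d U X mX; apply: measurable_funM; [exact: mF|exact: mH].
exists (K1 * K2), (L1 + L2); split; rewrite ?addr_ge0 ?mulr_ge0// => x.
by rewrite normrM mulrDl expRD mulrACA ler_pM.
Qed.

Lemma admissibleZ (k : R) F : admissible F -> admissible (fun x => k * F x).
Proof. by move=> aF; apply: admissibleM => //; exact: admissible_cst. Qed.

Lemma admissibleB F H : admissible F -> admissible H ->
  admissible (fun x => F x - H x).
Proof.
move=> aF aH; have := admissibleD aF (admissibleZ (-1) aH).
by congr (admissible _); apply/funext => x; rewrite mulN1r.
Qed.

Lemma admissible_norm F : admissible F -> admissible (fun x => `|F x|).
Proof.
move=> [mF [K1 [L1 [K10 L10 F1]]]]; split.
  by move=> d U X mX; apply: measurableT_comp => //; exact: mF.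
by exists K1, L1; split=> // x; rewrite normr_id.
Qed.

Lemma admissible_sum (I : Type) (r : seq I) (P : pred I) (F : I -> (S -> R) -> R) :
  (forall i, admissible (F i)) -> admissible (fun x => \sum_(i <- r | P i) F i x).
Proof.
move=> aF; elim: r => [|i r IH].
  have := admissible_cst 0; congr (admissible _); apply/funext => x.
  by rewrite big_nil.
have [Pi|Pi] := boolP (P i).
  have := admissibleD (aF i) IH; congr (admissible _); apply/funext => x.
  by rewrite big_cons Pi.
by move: IH; congr (admissible _); apply/funext => x; rewrite big_cons (negbTE Pi).
Qed.

Lemma admissible_le F H : comp_measurable F -> admissible H ->
  (forall x, `|F x| <= `|H x|) -> admissible F.
Proof.
move=> mF [_ [K [L [K0 L0 Hle]]]] FH; split=> //; exists K, L; split=> // x.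
exact: le_trans (FH x) (Hle x).
Qed.

Lemma admissible_pullback (S' : finType) (A : (S -> R) -> S' -> R) (H : (S' -> R) -> R) :
  (forall s, comp_measurable (fun x => A x s)) ->
  (exists a b : R, 0 <= a /\ 0 <= b /\ forall x, \sum_s `|A x s| <= a * (\sum_s `|x s|) + b) ->
  admissible H -> admissible (fun x => H (A x)).
Proof.
move=> mA [a [b [a0 [b0 Aab]]]] [mH [K [L [K0 L0 Hle]]]]; split.
  by move=> d U X mX; apply: (mH _ _ (A \o X)) => s; exact: mA.
exists (K * expR (L * b)), (L * a); split.
- by rewrite mulr_ge0// expR_ge0.
- by rewrite mulr_ge0.
- move=> x; rewrite (le_trans (Hle _))// -mulrA ler_wpM2l// -expRD ler_expR.
  by rewrite addrC -mulrA -mulrDr ler_wpM2l.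
Qed.

Lemma admissible_affine (k : R) (y : S -> R) F : admissible F ->
  admissible (fun x => F (fun s => y s + k * x s)).
Proof.
apply: (admissible_pullback (A := fun x s => y s + k * x s)).
  by move=> s d U X mX; apply: measurable_funD => //; exact: measurable_funM.
exists `|k|, (\sum_s `|y s|); split => //; split; first by rewrite sumr_ge0.
move=> x; rewrite addrC mulr_sumr -big_split/= ler_sum// => s _.
by rewrite (le_trans (ler_normD _ _))// normrM.
Qed.

Lemma gmean_integrable F c x : admissible F ->
  gam.-integrable setT (fun z => (F (fun s => x s + z * c s))%:E).
Proof.
move=> [mF [K [L [K0 L0 Fle]]]].
pose E (z : R) := expR ((L * \sum_s `|c s|) * `|z|).
refine (@le_integrable_EFin _ _ R gam (fun z => F (fun s => x s + z * c s))
    (fun z => K * expR (L * \sum_s `|x s|) * E z) _ _ _).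
- apply: (mF _ _ (fun (z : R) s => x s + z * c s)) => s.
  by apply: measurable_funD => //; exact: measurable_funM.
- move=> z; rewrite /E (le_trans (Fle _))//.
  rewrite -mulrA -expRD ler_wpM2l// ler_expR.
  rewrite -!mulrA -mulrDr ler_wpM2l// mulr_suml -big_split ler_sum//= => s _.
  by rewrite (le_trans (ler_normD _ _))// normrM [`|z| * _]mulrC.
- exact: (integrableZl measurableT (K * expR (L * \sum_s `|x s|))
    (integrable_expR_abs_normal_prob (L * \sum_s `|c s|))).
Qed.

Lemma gmean_EFin F c x : admissible F ->
  (gmean c F x)%:E = (\int[gam]_z (F (fun s => x s + z * c s))%:E)%E.
Proof.
move=> aF; rewrite fineK//; apply: integrable_fin_num => //.
exact: gmean_integrable.
Qed.

(** Tonelli is applied to the positive and negative parts separately, so that measurability in the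
    base point requires no integrability. *)
Lemma comp_measurable_gmean F c : comp_measurable F -> comp_measurable (gmean c F).
Proof.
move=> mF d U X mX.
pose f (p : U * R) := (F (fun s => X p.1 s + p.2 * c s))%:E.
have mf : measurable_fun setT f.
  apply/measurable_EFinP.
  apply: (mF _ _ (fun (p : U * R) s => X p.1 s + p.2 * c s)) => s.
  by apply: measurable_funD; [exact: (measurableT_comp (mX s))|exact: measurable_funM].
have -> : gmean c F \o X = fun u =>
    fine ((\int[gam]_z f^\+ (u, z)) - (\int[gam]_z f^\- (u, z)))%E.
  apply/funext => u /=; rewrite /gmean /Rintegral integralE.
  congr (fine (_ - _)%E); apply: eq_integral => z _.
    by rewrite !funeposE.
  by rewrite !funenegE.
apply: measurableT_comp => //; apply: emeasurable_funB.
  exact: (@measurable_fun_fubini_tonelli_F _ _ _ _ _ gam _ (measurable_funepos mf)).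
exact: (@measurable_fun_fubini_tonelli_F _ _ _ _ _ gam _ (measurable_funeneg mf)).
Qed.

Lemma le_gmean F H c x : admissible F -> admissible H ->
  (forall y, F y <= H y) -> gmean c F x <= gmean c H x.
Proof.
by move=> aF aH FH; apply: le_Rintegral => //; exact: gmean_integrable.
Qed.

Lemma gmeanD F H c x : admissible F -> admissible H ->
  gmean c (fun y => F y + H y) x = gmean c F x + gmean c H x.
Proof. by move=> aF aH; apply: RintegralD => //; exact: gmean_integrable. Qed.

Lemma gmeanZ (k : R) F c x : admissible F ->
  gmean c (fun y => k * F y) x = k * gmean c F x.
Proof. by move=> aF; apply: RintegralZl => //; exact: gmean_integrable. Qed.

Lemma gmean_cst (k : R) c x : gmean c (fun _ : S -> R => k) x = k.
Proof.
rewrite /gmean Rintegral_cst//.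
by rewrite [X in fine X](_ : _ = 1%E) ?mulr1//; exact: probability_setT.
Qed.

Lemma admissible_gmean F c : admissible F -> admissible (gmean c F).
Proof.
move=> aF; have [mF [K [L [K0 L0 Fle]]]] := aF; split.
  exact: comp_measurable_gmean.
pose E (z : R) := expR ((L * \sum_s `|c s|) * `|z|).
exists (K * \int[gam]_z E z), L.
have E0 : 0 <= \int[gam]_z E z by apply: Rintegral_ge0 => z _; exact: expR_ge0.
have iE : gam.-integrable setT (EFin \o E) by exact: integrable_expR_abs_normal_prob.
split => //; first by rewrite mulr_ge0.
move=> x; rewrite (le_trans (le_normr_Rintegral _ _))//.
  exact: gmean_integrable.
rewrite mulrAC -RintegralZl//; apply: le_Rintegral => //.
- exact: (gmean_integrable c x (admissible_norm aF)).
- exact: (integrableZl measurableT (K * expR (L * \sum_s `|x s|)) iE).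
- move=> z _; rewrite (le_trans (Fle _))//.
  rewrite -mulrA -expRD ler_wpM2l// ler_expR.
  rewrite -!mulrA -mulrDr ler_wpM2l// mulr_suml -big_split ler_sum//= => s _.
  by rewrite (le_trans (ler_normD _ _))// normrM [`|z| * _]mulrC.
Qed.

Lemma gmean2_integrable F c b x : admissible F ->
  (gam \x gam)%E.-integrable setT
    (fun p => (F (fun s => x s + p.1 * c s + p.2 * b s))%:E).
Proof.
move=> aF; have [mF _] := aF.
have mf : measurable_fun setT
    (fun p : R * R => (F (fun s => x s + p.1 * c s + p.2 * b s))%:E).
  apply/measurable_EFinP.
  apply: (mF _ _ (fun (p : R * R) s => x s + p.1 * c s + p.2 * b s)) => s.
  apply: measurable_funD; last exact: measurable_funM.
  by apply: measurable_funD => //; exact: measurable_funM.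
apply/(integrable12ltyP gam gam mf).
pose H (z : R) := gmean b (fun y => `|F y|) (fun s => x s + z * c s).
have H0 z : 0 <= H z by exact: Rintegral_ge0.
have := gmean_integrable c x (admissible_gmean b (admissible_norm aF)).
move=> /integrableP[_]; congr (_ < _)%E.
apply: eq_integral => z _; rewrite gee0_abs; last by rewrite lee_fin; exact: H0.
by rewrite gmean_EFin//; exact: admissible_norm.
Qed.

Lemma gmeanC F c b x : admissible F ->
  gmean c (gmean b F) x = gmean b (gmean c F) x.
Proof.
move=> aF.
have h (k : R) (l : R) : forall e a : S -> R,
  (fun s => x s + k * e s + l * a s) = (fun s => x s + l * a s + k * e s).
  by move=> e a; apply/funext => s; rewrite addrAC.
apply: EFin_inj; rewrite (gmean_EFin c x (admissible_gmean b aF)).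
rewrite (gmean_EFin b x (admissible_gmean c aF)).
transitivity (\int[gam]_z \int[gam]_y (F (fun s => x s + z * c s + y * b s))%:E)%E.
  by apply: eq_integral => z _; rewrite gmean_EFin.
rewrite (Fubini (gmean2_integrable c b x aF)).
by apply: eq_integral => y _; rewrite gmean_EFin//; apply: eq_integral => z _; rewrite h.
Qed.

(** Stability of the Gaussian law: [r * (z1 + z2)] is standard for independent standard [z1], [z2].
    The two laws are identified by [ge0_integral_normal_rotation] on indicators, and Fubini
    separates [z1] from [z2]. *)
Lemma gmean_split F c x : admissible F ->
  gmean c F x = gmean (fun s => c s / Num.sqrt 2) (gmean (fun s => c s / Num.sqrt 2) F) x.
Proof.
move=> aF; pose r : R := (Num.sqrt 2)^-1; pose b s := c s * r.
rewrite -/r -/b; have [mF _] := aF.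
pose f z := (F (fun s => x s + z * c s))%:E.
have mf : measurable_fun [set: R] f.
  apply/measurable_EFinP.
  apply: (mF _ _ (fun (z : R) s => x s + z * c s)) => s.
  by apply: measurable_funD => //; exact: measurable_funM.
pose rot (p : R * R) : measurableTypeR R := r * (p.1 + p.2).
have mrot : measurable_fun setT rot.
  by apply: measurable_funM => //; exact: measurable_funD.
have E p : F (fun s => x s + p.1 * b s + p.2 * b s) = F (fun s => x s + rot p * c s).
  by congr F; apply/funext => s; rewrite /b /rot; ring.
have ifr : (gam \x gam)%E.-integrable setT (f \o rot).
  have := gmean2_integrable b b x aF; congr (_.-integrable _ _).
  by apply/funext => p /=; rewrite E.
apply: EFin_inj; rewrite (gmean_EFin c x aF).
rewrite (gmean_EFin b x (admissible_gmean b aF)).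
have law A : measurable A -> gam A = pushforward (gam \x gam)%E rot A.
  move=> mA.
  have mI : measurable_fun [set: R] (fun z => (\1_A z : R)%:E).
    exact/measurable_EFinP/measurable_indic.
  have := @ge0_integral_normal_rotation R (fun z => (\1_A z)%:E) mI.
  rewrite integral_indic// setIT => <-; last by move=> z; rewrite lee_fin.
  have mfr : measurable_fun [set: R * R] (fun p => (\1_A (rot p) : R)%:E).
    apply/measurable_EFinP; apply: (measurableT_comp _ mrot).
    exact: measurable_indic.
  rewrite -(@fubini_tonelli1 _ _ _ _ R gam gam _ mfr); last first.
    by move=> p; rewrite lee_fin.
  rewrite (_ : (fun p => _) = EFin \o \1_(rot @^-1` A)).
    by rewrite integral_indic ?setIT// -[X in measurable X]setTI; exact: mrot.
  by apply/funext => p /=; rewrite !indicE.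
transitivity (\int[pushforward (gam \x gam)%E rot]_z f z)%E.
  by apply: eq_measure_integral => A mA _; exact: law.
rewrite integral_pushforward// preimage_setT -(fubini1 ifr).
apply: eq_integral => z _; rewrite gmean_EFin//.
by apply: eq_integral => y _; rewrite /f /= -[in LHS](E (z, y)).
Qed.

End admissible.

(* Equal to 1, but no step needs its value. *)
Definition normal_moment2 (R : realType) : R := \int[normal_prob 0 1]_z (z ^+ 2).

Section gmean_polynomials.
Context {R : realType} {S : finType}.
Implicit Types (F H : (S -> R) -> R) (c x : S -> R).
Local Notation gam := (normal_prob (0:R) 1).

(** With a single coordinate and base point 0, the first two Gaussian moments become instances of
    [gmean], so integrability comes from [gmean_integrable]. *)
Let unit_point : unit -> R := fun=> 0.

Let integrable_id : gam.-integrable setT (fun z => z%:E).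
Proof.
have := gmean_integrable (fun=> 1) unit_point (admissible_coord tt).
by congr (_.-integrable _ _); apply/funext => z; rewrite mulr1 add0r.
Qed.

Let integrable_sqr : gam.-integrable setT (fun z => (z ^+ 2)%:E).
Proof.
have := gmean_integrable (fun=> 1) unit_point
  (admissibleM (admissible_coord tt) (admissible_coord tt)).
by congr (_.-integrable _ _); apply/funext => z; rewrite mulr1 add0r expr2.
Qed.

Lemma normal_moment2_ge0 : 0 <= normal_moment2 R.
Proof. by apply: Rintegral_ge0 => z _; exact: sqr_ge0. Qed.

Let gmean_coordE (T : finType) (c x : T -> R) s :
  gmean c (fun y => y s) x = x s + c s * \int[gam]_z z.
Proof.
have i1 : gam.-integrable setT (EFin \o (fun=> x s)).
  exact: finite_measure_integrable_cst.
have i2 : gam.-integrable setT (EFin \o (fun z : R => c s * z)).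
  exact: (integrableZl measurableT (c s) integrable_id).
rewrite /gmean (_ : (fun z => _) = (fun z => (fun=> x s) z + (fun z => c s * z) z)).
  rewrite RintegralD//; congr (_ + _); last exact: RintegralZl.
  rewrite Rintegral_cst// [X in fine X](_ : _ = 1%E) ?mulr1//.
  exact: probability_setT.
by apply/funext => z; rewrite [c s * z]mulrC.
Qed.

(* The rotation invariance forces the mean [m] to satisfy [m = sqrt 2 * m]. *)
Lemma normal_mean0 : \int[gam]_z z = 0.
Proof.
set m := \int[gam]_z z.
have := gmean_split (fun=> 1) unit_point (admissible_coord tt).
rewrite gmean_coordE -/m.
have -> : gmean (fun=> 1 / Num.sqrt 2) (fun x : unit -> R => x tt) =
   fun x : unit -> R => x tt + (fun=> m / Num.sqrt 2) x.
  by apply/funext => x; rewrite gmean_coordE -/m mulrAC mul1r.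
rewrite gmeanD; [|exact: admissible_coord|exact: admissible_cst].
rewrite gmean_coordE gmean_cst /unit_point !add0r mul1r -/m mulrAC mul1r => E.
have r0 : 0 < Num.sqrt 2 :> R by rewrite sqrtr_gt0.
have : m * Num.sqrt 2 = m * 2.
  by rewrite {1}E mulrDl divfK ?gt_eqF//; ring.
move/eqP; rewrite -subr_eq0 -mulrBr mulf_eq0 => /orP[/eqP//|].
rewrite subr_eq0 => /eqP r2.
have := @sqr_sqrtr R 2 (ler0n _ _); rewrite r2; lra.
Qed.

Lemma gmean_coord c x s : gmean c (fun y => y s) x = x s.
Proof. by rewrite gmean_coordE normal_mean0 mulr0 addr0. Qed.

Lemma gmean_quad c x s t : gmean c (fun y => y s * y t) x =
  x s * x t + normal_moment2 R * (c s * c t).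
Proof.
have i1 : gam.-integrable setT (EFin \o (fun=> x s * x t)).
  exact: finite_measure_integrable_cst.
have i2 : gam.-integrable setT
    (EFin \o (fun z : R => (x s * c t + c s * x t) * z)).
  exact: (integrableZl measurableT (x s * c t + c s * x t) integrable_id).
have i3 : gam.-integrable setT (EFin \o (fun z : R => (c s * c t) * z ^+ 2)).
  exact: (integrableZl measurableT (c s * c t) integrable_sqr).
rewrite /gmean (_ : (fun z => _) = (fun z => (fun=> x s * x t) z +
   ((fun z => (x s * c t + c s * x t) * z) z + (fun z => (c s * c t) * z ^+ 2) z))).
  rewrite RintegralD//; last exact: (integrableD measurableT i2 i3).
  rewrite RintegralD// (RintegralZl _ measurableT integrable_id)// normal_mean0 mulr0 add0r.
  rewrite (RintegralZl _ measurableT integrable_sqr)// [X in _ = _ + X]mulrC; congr (_ + _).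
  rewrite Rintegral_cst// [X in fine X](_ : _ = 1%E) ?mulr1//.
  exact: probability_setT.
by apply/funext => z; ring.
Qed.

End gmean_polynomials.

(* Expectation of [F (x + \sum_(c <- cs) z_c c)] for independent standard
   Gaussian [z_c], as an iterated integral. *)
Fixpoint gmeans (R : realType) (S : Type) (cs : seq (S -> R))
    (F : (S -> R) -> R) : (S -> R) -> R :=
  if cs is c :: cs' then gmeans cs' (gmean c F) else F.

Definition scale_vecs (R : realType) (S : Type) (k : R) (cs : seq (S -> R)) :=
  [seq (fun s => k * c s) | c <- cs].

(** * Iterated Gaussian averages *)

Section gmeans.
Context {R : realType} {S : finType}.
Implicit Types (F H : (S -> R) -> R) (c x : S -> R) (cs bs : seq (S -> R)).

Lemma admissible_gmeans cs F : admissible F -> admissible (gmeans cs F).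
Proof. by elim: cs F => //= c cs IH F aF; apply/IH/admissible_gmean. Qed.

Lemma gmeans_cat bs cs F : gmeans (bs ++ cs) F = gmeans cs (gmeans bs F).
Proof. by elim: bs F => //= b bs IH F; rewrite IH. Qed.

Lemma le_gmeans cs F H x : admissible F -> admissible H ->
  (forall y, F y <= H y) -> gmeans cs F x <= gmeans cs H x.
Proof.
elim: cs F H => //= c cs IH F H aF aH FH.
apply: IH; try exact: admissible_gmean.
by move=> y; exact: le_gmean.
Qed.

Lemma gmeansD cs F H x : admissible F -> admissible H ->
  gmeans cs (fun y => F y + H y) x = gmeans cs F x + gmeans cs H x.
Proof.
elim: cs F H => //= c cs IH F H aF aH.
rewrite -IH; try exact: admissible_gmean.
by congr gmeans; apply/funext => y; exact: gmeanD.
Qed.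

Lemma gmeansZ (k : R) cs F x : admissible F ->
  gmeans cs (fun y => k * F y) x = k * gmeans cs F x.
Proof.
elim: cs F => //= c cs IH F aF; rewrite -IH; last exact: admissible_gmean.
by congr gmeans; apply/funext => y; exact: gmeanZ.
Qed.

Lemma gmeans_cst cs (k : R) x : gmeans cs (fun _ : S -> R => k) x = k.
Proof.
elim: cs x => //= c cs IH x.
by rewrite [gmean c _](_ : _ = fun=> k)//; apply/funext => y; exact: gmean_cst.
Qed.

Lemma gmeansB cs F H x : admissible F -> admissible H ->
  gmeans cs (fun y => F y - H y) x = gmeans cs F x - gmeans cs H x.
Proof.
move=> aF aH; rewrite -[- gmeans cs H x]mulN1r -gmeansZ// -gmeansD//.
  by congr gmeans; apply/funext => y; rewrite mulN1r.
exact: admissibleZ.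
Qed.

Lemma gmeans_sum (I : Type) (r : seq I) cs (F : I -> (S -> R) -> R) x :
  (forall i, admissible (F i)) ->
  gmeans cs (fun y => \sum_(i <- r) F i y) x = \sum_(i <- r) gmeans cs (F i) x.
Proof.
move=> aF; elim: r => [|i r IH].
  rewrite big_nil [X in gmeans _ X](_ : _ = fun=> 0) ?gmeans_cst//.
  by apply/funext => y; rewrite big_nil.
rewrite big_cons -IH -gmeansD//; last exact: admissible_sum.
by congr gmeans; apply/funext => y; rewrite big_cons.
Qed.

Lemma gmean_gmeans c cs F : admissible F ->
  gmean c (gmeans cs F) = gmeans cs (gmean c F).
Proof.
elim: cs F => //= b cs IH F aF; rewrite IH; last exact: admissible_gmean.
by congr gmeans; apply/funext => x; exact: gmeanC.
Qed.

Lemma gmeansC bs cs F : admissible F ->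
  gmeans bs (gmeans cs F) = gmeans cs (gmeans bs F).
Proof.
elim: bs F => //= b bs IH F aF; rewrite -IH; last exact: admissible_gmean.
by rewrite gmean_gmeans.
Qed.

Lemma gmeans_coord cs x s : gmeans cs (fun y => y s) x = x s.
Proof.
elim: cs => //= c cs IH; rewrite -[RHS]IH; congr gmeans.
by apply/funext => y; exact: gmean_coord.
Qed.

Lemma gmeans_quad cs x s t : gmeans cs (fun y => y s * y t) x =
  x s * x t + normal_moment2 R * \sum_(c <- cs) c s * c t.
Proof.
elim: cs => [|c cs IH] /=; first by rewrite big_nil mulr0 addr0.
rewrite big_cons mulrDr [normal_moment2 R * _ + _]addrC addrA -IH.
rewrite -[in RHS](gmeans_cst cs (normal_moment2 R * (c s * c t)) x) -gmeansD.
- by congr gmeans; apply/funext => y; exact: gmean_quad.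
- by apply: admissibleM; exact: admissible_coord.
- exact: admissible_cst.
Qed.

Lemma gmeans_shift cs F x z :
  gmeans cs (fun y => F (fun s => y s + z s)) x = gmeans cs F (fun s => x s + z s).
Proof.
elim: cs F => //= c cs IH F; rewrite -IH; congr gmeans; apply/funext => y.
by congr Rintegral; apply/funext => w; congr F; apply/funext => s; rewrite addrAC.
Qed.

Lemma gmeans_scale (k : R) cs F x :
  gmeans (scale_vecs k cs) F (fun s => k * x s) =
  gmeans cs (fun y => F (fun s => k * y s)) x.
Proof.
elim: cs F => //= c cs IH F; rewrite IH; congr gmeans; apply/funext => y.
congr Rintegral; apply/funext => w; congr F; apply/funext => s.
by rewrite mulrDr mulrCA.
Qed.

Lemma scale_vecs1 cs : scale_vecs 1 cs = cs.
Proof.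
rewrite /scale_vecs -[RHS]map_id; apply: eq_map => c.
by apply/funext => s; rewrite mul1r.
Qed.

Lemma scale_vecsM (k l : R) cs :
  scale_vecs k (scale_vecs l cs) = scale_vecs (k * l) cs.
Proof.
rewrite /scale_vecs -map_comp; apply: eq_map => c /=.
by apply/funext => s; rewrite mulrA.
Qed.

Lemma gmeans_split cs F : admissible F ->
  gmeans cs F = gmeans (scale_vecs (Num.sqrt 2)^-1 cs)
                  (gmeans (scale_vecs (Num.sqrt 2)^-1 cs) F).
Proof.
elim: cs F => //= c cs IH F aF; rewrite IH; last exact: admissible_gmean.
rewrite gmean_gmeans; last exact: admissible_gmean.
have -> : gmean c F = gmean (fun s => (Num.sqrt 2)^-1 * c s)
    (gmean (fun s => (Num.sqrt 2)^-1 * c s) F); last by [].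
have -> : (fun s => (Num.sqrt 2)^-1 * c s) = (fun s => c s / Num.sqrt 2).
  by apply/funext => s; rewrite mulrC.
by apply/funext => x; exact: gmean_split.
Qed.

(** One average at scale [r ^+ k] is two averages at scale [r ^+ k.+1], by [gmeans_split];
    admissibility is carried along the iteration because each splitting needs it. *)
Lemma gmeans_iter cs F k : admissible F ->
  gmeans cs F = iter (2 ^ k) (gmeans (scale_vecs ((Num.sqrt 2)^-1 ^+ k) cs)) F.
Proof.
elim: k F => [|k IH] F aF; first by rewrite expr0 scale_vecs1.
rewrite IH// expnS mul2n exprS -scale_vecsM.
move: (2 ^ k)%N => n; set A := gmeans (scale_vecs _ (scale_vecs _ _)).
suff : iter n (gmeans (scale_vecs ((Num.sqrt 2)^-1 ^+ k) cs)) F = iter n.*2 A F /\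
   admissible (iter n.*2 A F) by case.
elim: n => //= n [-> aI]; rewrite gmeans_split//; split => //.
by do 2 apply: admissible_gmeans.
Qed.

(* Telescoping [A^n - B^n = \sum A^j (A - B) B^(n-1-j)]: since [A] and [B]
   commute, a one-step bound that is uniform in the base point is enough. *)
Lemma iter_gmeans_le bs cs F (e : R) n x : admissible F ->
  (forall y, gmeans bs F y <= gmeans cs F y + e) ->
  iter n (gmeans bs) F x <= iter n (gmeans cs) F x + n%:R * e.
Proof.
move=> aF Fe.
have aI ds m : admissible (iter m (gmeans ds) F).
  by elim: m => //= m IH; exact: admissible_gmeans.
elim: n x => [|n IH] x; first by rewrite mul0r addr0.
have step m y : gmeans bs (iter m (gmeans cs) F) y <=
    gmeans cs (iter m (gmeans cs) F) y + e.
  elim: m y => [|m IHm] y; first exact: Fe.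
  rewrite [iter m.+1 _ _]/= gmeansC//.
  apply: (@le_trans _ _ (gmeans cs (fun z => gmeans cs (iter m (gmeans cs) F) z +
      (fun=> e) z) y)).
    apply: le_gmeans; first exact/admissible_gmeans/aI.
      by apply: admissibleD; [exact: admissible_gmeans|exact: admissible_cst].
    exact: IHm.
  by rewrite gmeansD ?gmeans_cst//; [exact: admissible_gmeans|exact: admissible_cst].
rewrite /= -[n.+1]addn1 natrD mulrDl mul1r addrA [leRHS]addrAC.
apply: (@le_trans _ _ (gmeans bs (fun z => iter n (gmeans cs) F z +
    (fun=> n%:R * e) z) x)).
  by apply: le_gmeans => //; apply: admissibleD => //; exact: admissible_cst.
rewrite gmeansD ?gmeans_cst ?lerD2r//; last exact: admissible_cst.
Qed.

End gmeans.

(** Directions composed with [f] generate the Gaussian field read through [f]. It is used with [f] a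
    projection to a block and with [f] a flip. *)
Lemma gmeans_pull (R : realType) (S S' : finType) (f : S' -> S)
    (cs : seq (S -> R)) (F : (S' -> R) -> R) x y :
  gmeans [seq c \o f | c <- cs] F (fun s => x (f s) + y s) =
  gmeans cs (fun x => F (fun s => x (f s) + y s)) x.
Proof.
elim: cs F => //= c cs IH F; rewrite IH; congr gmeans; apply/funext => z.
by congr Rintegral; apply/funext => w; congr F; apply/funext => s /=; rewrite addrAC.
Qed.

(** * Second order expansion of log-sum-exp *)

Section scalar_bounds.
Context {R : realType}.
Implicit Types x t : R.

(** The remainder is [x ^+ 3] times a series with coefficients [1 / (k + 3)!], and
    [(k + 3)! >= 2 ^ (k + 1)] bounds its partial sums by [1 - 2 ^ (- n)]. *)
Lemma expR_taylor2 x : `|x| <= 1 -> `|expR x - (1 + x + x ^+ 2 / 2)| <= `|x| ^+ 3.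
Proof.
move=> x1.
have fact_ge k : 2 ^+ k.+1 <= ((k.+3)`!%:R : R).
  elim: k => [|k IH]; first by rewrite expr1 ler_nat.
  rewrite factS natrM exprS ler_pM// ?exprn_ge0//; by rewrite ler_nat.
have part n : `|series (exp_coeff x) (n + 3)%N - (1 + x + x ^+ 2 / 2)| <= `|x| ^+ 3.
  have -> : series (exp_coeff x) (n + 3)%N - (1 + x + x ^+ 2 / 2) =
      x ^+ 3 * \sum_(0 <= k < n) x ^+ k / (k.+3)`!%:R.
    rewrite /series /= addn3 !big_nat_recl// /exp_coeff /=.
    rewrite (_ : 0`! = 1)%N// (_ : 1`! = 1)%N// (_ : 2`! = 2)%N//.
    rewrite (eq_bigr (fun k => x ^+ 3 * (x ^+ k / (k.+3)`!%:R))); last first.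
      by move=> k _; rewrite mulrA -exprD add3n.
    by rewrite -mulr_sumr expr0 expr1 !divr1; ring.
  rewrite normrM normrX ler_piMr ?exprn_ge0//.
  apply: (@le_trans _ _ (1 - 2^-1 ^+ n)); last by rewrite gerBl exprn_ge0.
  elim: n => [|n IH]; first by rewrite big_geq// normr0 expr0 subrr.
  rewrite big_nat_recr//=; apply: le_trans (ler_normD _ _) _.
  have -> : 1 - 2^-1 ^+ n.+1 = (1 - 2^-1 ^+ n) + 2^-1 ^+ n.+1 :> R.
    by rewrite exprS; field.
  rewrite lerD// normrM normfV normr_nat exprVn -[leRHS]mul1r ler_pM ?invr_ge0//.
    by rewrite normrX exprn_ile1.
  by rewrite lef_pV2 ?posrE ?exprn_gt0// ltr0n fact_gt0.
have cv : (fun n => `|series (exp_coeff x) (n + 3)%N - (1 + x + x ^+ 2 / 2)|) @ \oo -->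
    `|expR x - (1 + x + x ^+ 2 / 2)|.
  apply: cvg_norm; apply: cvgB; last exact: cvg_cst.
  rewrite (cvg_shiftn 3 (series (exp_coeff x))).
  exact: is_cvg_series_exp_coeff.
rewrite -(cvg_lim _ cv)//; apply: limr_le; first by apply/cvg_ex; eexists; exact: cv.
by apply: nearW => n; exact: part.
Qed.

(** The lower bound is the upper bound applied to the inverse of [1 + t], followed by
    [t / (1 + t) >= t - t ^+ 2]. *)
Lemma ln1D_bounds t : 0 <= t -> t - t ^+ 2 <= ln (1 + t) <= t.
Proof.
move=> t0; have t1 : 0 < 1 + t by rewrite ltr_pwDl.
rewrite le_ln1Dx ?andbT; last by rewrite (lt_le_trans _ t0)// ltrN10.
have h : ln (1 + t)^-1 <= (1 + t)^-1 - 1.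
  have := @le_ln1Dx R ((1 + t)^-1 - 1); rewrite (addrC 1 (_ - 1)) subrK; apply.
  by rewrite ltrBrDr addNr invr_gt0.
rewrite lnV ?posrE// in h.
suff : t - t ^+ 2 <= 1 - (1 + t)^-1 by lra.
have -> : 1 - (1 + t)^-1 = t / (1 + t) by field; rewrite gt_eqF.
rewrite ler_pdivlMr//.
have : 0 <= t ^+ 3 by rewrite exprn_ge0.
lra.
Qed.

End scalar_bounds.

Section log_sum_exp_taylor.
Context {R : realType} {S : finType}.
Implicit Types (p v : S -> R).

(** After centering [v] at its mean [m], the average of [expR (v s)] is [expR m * (1 + t)] with [t]
    close to half the variance. The constant 26 is 8, from the cubic remainder of the exponential at
    arguments up to [2 * a], plus 18, from [t ^+ 2] in [ln1D_bounds]. *)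
Lemma ln_average_expR_taylor p v :
  (forall s, 0 <= p s) -> \sum_s p s = 1 ->
  `|ln (\sum_s p s * expR (v s)) - \sum_s p s * v s -
    (\sum_s p s * v s ^+ 2 - (\sum_s p s * v s) ^+ 2) / 2|
  <= 26 * \sum_s `|v s| ^+ 3.
Proof.
move=> p0 p1.
have [s0 _] : exists s : S, true.
  apply/existsP; apply: contraPT p1; rewrite negb_exists => /forallP h.
  by rewrite big1 => [/eqP|s _]; [rewrite eq_sym oner_eq0|have := h s].
pose sm := [arg max_(s > s0) `|v s|]%O; pose a := `|v sm|.
have va s : `|v s| <= a.
  by rewrite /a /sm; case: arg_maxP => // i _; apply.
have a0 : 0 <= a by rewrite /a.
have N3 : a ^+ 3 <= \sum_s `|v s| ^+ 3.
  by rewrite (bigD1 sm)//= lerDl sumr_ge0// => s _; rewrite exprn_ge0.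
apply: (@le_trans _ _ (26 * a ^+ 3)); last by rewrite ler_wpM2l.
have avg f b : (forall s, f s <= b) -> \sum_s p s * f s <= b.
  move=> fb; rewrite -[leRHS]mul1r -p1 mulr_suml ler_sum// => s _.
  by rewrite ler_wpM2l.
have avg_ge f b : (forall s, b <= f s) -> b <= \sum_s p s * f s.
  move=> fb; rewrite -[leLHS]mul1r -p1 mulr_suml ler_sum// => s _.
  by rewrite ler_wpM2l.
set m := \sum_s p s * v s; set q := \sum_s p s * v s ^+ 2.
have mle : m <= a by apply: avg => s; rewrite (le_trans (ler_norm _)).
have mge : - a <= m.
  by apply: avg_ge => s; rewrite lerNl (le_trans (ler_norm _))// normrN.
have vle s : v s <= a by rewrite (le_trans (ler_norm _)).
have vge s : - a <= v s by rewrite lerNl (le_trans (ler_norm _))// normrN.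
have qle : q <= a ^+ 2.
  by apply: avg => s; rewrite -real_normK ?num_real// lerXn2r ?nnegrE.
have varE : q - m ^+ 2 = \sum_s p s * (v s - m) ^+ 2.
  rewrite (eq_bigr (fun s => p s * v s ^+ 2 - 2 * m * (p s * v s) + p s * m ^+ 2)).
    by rewrite big_split sumrB/= -mulr_sumr -mulr_suml p1 -/m -/q; ring.
  by move=> s _; ring.
have var0 : 0 <= q - m ^+ 2.
  by rewrite varE sumr_ge0// => s _; rewrite mulr_ge0// sqr_ge0.
have msq : 0 <= m ^+ 2 by exact: sqr_ge0.
have [a2|a2] := leP a 2^-1; last first.
  have l1 : ln (\sum_s p s * expR (v s)) <= a.
    rewrite -ler_expR lnK; first by apply: avg => s; rewrite ler_expR.
    rewrite posrE (lt_le_trans (expR_gt0 (- a)))//.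
    by apply: avg_ge => s; rewrite ler_expR.
  have l2 : - a <= ln (\sum_s p s * expR (v s)).
    rewrite -ler_expR lnK; first by apply: avg_ge => s; rewrite ler_expR.
    rewrite posrE (lt_le_trans (expR_gt0 (- a)))//.
    by apply: avg_ge => s; rewrite ler_expR.
  have a3 : a / 4 <= a ^+ 3.
    rewrite exprS ler_wpM2l// expr2.
    by rewrite (_ : 4^-1 = 2^-1 * 2^-1); [rewrite ler_pM// ltW|rewrite -invfM -natrM].
  have a3' : a ^+ 2 / 2 <= a ^+ 3 by rewrite [leRHS]exprSr ler_wpM2l ?exprn_ge0// ltW.
  rewrite ler_norml; apply/andP; split; lra.
pose y s := v s - m.
have y2a s : `|y s| <= 2 * a.
  by rewrite (le_trans (ler_normB _ _))// mulr2n mulrDl !mul1r lerD// ler_norml mge.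
have y1 s : `|y s| <= 1 by rewrite (le_trans (y2a s))//; lra.
pose t := \sum_s p s * (expR (y s) - 1).
have tE : \sum_s p s * expR (v s) = expR m * (1 + t).
  rewrite -{1}p1 /t -big_split mulr_sumr; apply: eq_bigr => s _ /=.
  by rewrite -{1}(subrK m (v s)) expRD -/(y s); ring.
have sy : \sum_s p s * y s = 0.
  rewrite /y; under eq_bigr do rewrite mulrBr.
  by rewrite sumrB -mulr_suml p1 mul1r subrr.
(* The centered variables [y] have mean zero, so this is the average of [expR y >= 1 + y]. *)
have t0 : 0 <= t.
  rewrite -sy ler_sum// => s _; rewrite ler_wpM2l// lerBrDl.
  exact: expR_ge1Dx.
have tV : `|t - (q - m ^+ 2) / 2| <= 8 * a ^+ 3.
  have -> : t - (q - m ^+ 2) / 2 =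
      \sum_s p s * (expR (y s) - (1 + y s + y s ^+ 2 / 2)).
    rewrite varE -[t]subr0 -{1}sy /t mulr_suml -!sumrB; apply: eq_bigr => s _.
    by rewrite /y; ring.
  apply: le_trans (ler_norm_sum _ _ _) _.
  apply: (@le_trans _ _ (\sum_s p s * (8 * a ^+ 3))).
    apply: ler_sum => s _; rewrite normrM ger0_norm// ler_wpM2l//.
    apply: (le_trans (expR_taylor2 (y1 s))).
    have -> : 8 * a ^+ 3 = (2 * a) ^+ 3 by rewrite exprMn -natrX.
    by rewrite lerXn2r ?nnegrE// mulr_ge0.
  by rewrite -mulr_suml p1 mul1r.
have /andP[L1 L2] := ln1D_bounds t0.
rewrite tE lnM ?posrE ?expR_gt0//; last by rewrite ltr_pwDl.
rewrite expRK.
have a3a : a ^+ 3 <= a ^+ 2 / 2 by rewrite [leLHS]exprSr ler_wpM2l ?exprn_ge0.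
(* Since [a <= 1/2], the estimate [tV] makes [t] both at most [3 * a] and at most [6 * a ^+ 2]; the
   product of the two bounds is the [18 * a ^+ 3] below. *)
have t6 : t <= 3 * a.
  have : a ^+ 2 <= a / 2 by rewrite expr2 ler_wpM2l.
  move: tV; rewrite ler_norml => /andP[_ tV]; lra.
have t2 : t ^+ 2 <= 18 * a ^+ 3.
  have t5 : t <= 6 * a ^+ 2.
    move: tV; rewrite ler_norml => /andP[_ tV].
    have : 0 <= a ^+ 2 by exact: sqr_ge0.
    lra.
  rewrite expr2 (le_trans (ler_pM t0 t0 t6 t5))//.
  by rewrite le_eqVlt; apply/orP; left; apply/eqP; ring.
move: tV; rewrite !ler_norml => /andP[V1 V2].
apply/andP; split; lra.
Qed.

End log_sum_exp_taylor.

(** * Gaussian comparison *)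

Definition lse (R : realType) (S : finType) (Q : pred S) (b x : S -> R) : R :=
  ln (\sum_(s | Q s) expR (b s + x s)).

Definition sqdist (R : realType) (S : Type) (cs : seq (S -> R)) (s t : S) : R :=
  \sum_(c <- cs) (c s - c t) ^+ 2.

Section lse.
Context {R : realType} {S : finType}.
Implicit Types (Q : pred S) (b x v : S -> R).

Lemma sum_expR_gt0 Q (f : S -> R) s0 : Q s0 -> 0 < \sum_(s | Q s) expR (f s).
Proof.
move=> Qs0; rewrite (bigD1 s0)//= ltr_pwDl ?expR_gt0//.
by apply: sumr_ge0 => s _; exact: expR_ge0.
Qed.

Lemma lse_leD Q b s0 x y (e : R) : Q s0 -> (forall s, Q s -> x s <= y s + e) ->
  lse Q b x <= lse Q b y + e.
Proof.
move=> Qs0 xy; rewrite /lse -[e in leRHS]expRK -lnM ?posrE ?expR_gt0//; last first.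
  exact: sum_expR_gt0 Qs0.
rewrite ler_ln ?posrE ?mulr_gt0 ?expR_gt0//; try exact: sum_expR_gt0 Qs0.
rewrite mulr_suml ler_sum// => s Qs.
by rewrite -expRD ler_expR -addrA lerD2l xy.
Qed.

Lemma admissible_lse Q b s0 : Q s0 -> admissible (lse Q b).
Proof.
move=> Qs0; pose C := ln #|S|%:R + \sum_s `|b s|.
apply: (@admissible_le _ _ _ (fun x => C + \sum_s `|x s|)).
- move=> d U X mX.
  have -> : lse Q b \o X =
      @ln R \o (fun u => \sum_s (if Q s then expR (b s + X u s) else 0)).
    by apply/funext => u; rewrite /lse /= -big_mkcond.
  apply: (measurableT_comp (@measurable_ln R)).
  apply: measurable_sum => s; case: (Q s) => //; apply: measurableT_comp => //.
  by apply: measurable_funD.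
- apply: admissibleD; first exact: admissible_cst.
  by apply: admissible_sum => s; apply/admissible_norm/admissible_coord.
move=> x.
have card0 : (0 < #|S|)%N by apply/card_gt0P; exists s0.
have C0 : 0 <= C + \sum_s `|x s|.
  by rewrite !addr_ge0 ?sumr_ge0 ?ln_ge0// ler1n.
have le1 (f : S -> R) s : `|f s| <= \sum_s `|f s|.
  by rewrite (bigD1 s)//= lerDl sumr_ge0.
rewrite [leRHS]ger0_norm// ler_norml; apply/andP; split.
  apply: (@le_trans _ _ (b s0 + x s0)).
    have lnS : 0 <= ln #|S|%:R :> R by rewrite ln_ge0 ?ler1n.
    have := le1 b s0; have := le1 x s0; rewrite /C !ler_norml => /andP[? _] /andP[? _].
    lra.
  rewrite -ler_expR /lse lnK ?posrE; last exact: sum_expR_gt0 Qs0.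
  rewrite (bigD1 s0)//= lerDl; apply: sumr_ge0 => s _; exact: expR_ge0.
rewrite -ler_expR /lse lnK ?posrE; last exact: sum_expR_gt0 Qs0.
rewrite /C -addrA expRD lnK ?posrE ?ltr0n//.
apply: (@le_trans _ _ (\sum_(s | Q s) expR (\sum_s `|b s| + \sum_s `|x s|))).
  apply: ler_sum => s _; rewrite ler_expR lerD//.
    by rewrite (le_trans (ler_norm _))// le1.
  by rewrite (le_trans (ler_norm _))// le1.
rewrite sumr_const -[X in X *+ _]mul1r -mulrnAl ler_wpM2r ?expR_ge0// ler_nat.
exact: max_card.
Qed.

Definition gibbs Q b x (s : S) : R :=
  if Q s then expR (b s + x s) / \sum_(t | Q t) expR (b t + x t) else 0.

Lemma gibbs_ge0 Q b x s : 0 <= gibbs Q b x s.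
Proof.
rewrite /gibbs; case: ifP => // _; rewrite divr_ge0 ?expR_ge0//.
by apply: sumr_ge0 => t _; exact: expR_ge0.
Qed.

Lemma sum_gibbs Q b x s0 : Q s0 -> \sum_s gibbs Q b x s = 1.
Proof.
move=> Qs0; rewrite -big_mkcond /= -mulr_suml mulfV// gt_eqF//.
exact: sum_expR_gt0 Qs0.
Qed.

Lemma lse_gibbs Q b x v s0 : Q s0 ->
  lse Q b (fun s => x s + v s) = lse Q b x + ln (\sum_s gibbs Q b x s * expR (v s)).
Proof.
move=> Qs0.
have Z0 : 0 < \sum_(s | Q s) expR (b s + x s) by exact: sum_expR_gt0 Qs0.
have E : \sum_(s | Q s) expR (b s + (x s + v s)) =
   (\sum_(s | Q s) expR (b s + x s)) * \sum_s gibbs Q b x s * expR (v s).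
  rewrite mulr_sumr big_mkcond; apply: eq_bigr => s _; rewrite /gibbs.
  case: ifP => _; last by rewrite mul0r mulr0.
  have Zn : \sum_(s | Q s) expR (b s + x s) != 0 by rewrite gt_eqF.
  by rewrite addrA [LHS]expRD [RHS]mulrA (mulrC _ (_ / _)) divfK.
rewrite /lse E lnM ?posrE//.
have := sum_expR_gt0 (fun s => b s + (x s + v s)) Qs0.
by rewrite E pmulr_rgt0.
Qed.

(** The squared Gibbs mean is expanded into a double sum so that its Gaussian average can be taken
    term by term with [gmeans_quad]. *)
Lemma lse_taylor Q b x v s0 (p := gibbs Q b x) : Q s0 ->
  `|lse Q b (fun s => x s + v s) - (lse Q b x + \sum_s p s * v s +
    (\sum_s p s * (v s * v s) - \sum_s \sum_t p s * p t * (v s * v t)) / 2)|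
  <= 26 * \sum_s `|v s| ^+ 3.
Proof.
move=> Qs0; rewrite (lse_gibbs _ _ _ Qs0) -/p.
have := ln_average_expR_taylor v (gibbs_ge0 Q b x) (sum_gibbs b x Qs0).
congr (`|_| <= _).
rewrite -/p (_ : \sum_s \sum_t _ = (\sum_s p s * v s) ^+ 2); last first.
  rewrite expr2 mulr_suml; apply: eq_bigr => s _; rewrite mulr_sumr.
  by apply: eq_bigr => t _; ring.
rewrite (_ : \sum_s p s * (v s * v s) = \sum_s p s * v s ^+ 2).
  by ring.
by apply: eq_bigr => s _; rewrite expr2.
Qed.

(** The linear Taylor term has mean zero. The averaged quadratic terms form a Gibbs variance, which
    is half the average squared distance of two independent Gibbs samples; with the 1/2 of the
    expansion this gives the factor 1/4. *)
Lemma gmeans_lse_step cs Q b x s0 (r : R) (p := gibbs Q b x) : Q s0 -> 0 <= r ->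
  `|gmeans (scale_vecs r cs) (lse Q b) x - lse Q b x -
    normal_moment2 R * r ^+ 2 / 4 * \sum_s \sum_t p s * p t * sqdist cs s t|
  <= 26 * r ^+ 3 * gmeans cs (fun v => \sum_s `|v s| ^+ 3) (fun=> 0).
Proof.
move=> Qs0 r0; set f := lse Q b.
have af : admissible f by exact: admissible_lse Qs0.
pose N3 (v : S -> R) : R := \sum_s `|v s| ^+ 3.
have ac := @admissible_coord R S.
have aN3 : admissible N3.
  apply: admissible_sum => s.
  have an := admissible_norm (ac s).
  by have := admissibleM an (admissibleM an an); congr admissible; apply/funext => v; ring.
pose lin (v : S -> R) : R := \sum_s p s * v s.
pose q1 (v : S -> R) : R := \sum_s p s * (v s * v s).
pose q2 (v : S -> R) : R := \sum_s \sum_t p s * p t * (v s * v t).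
have alin : admissible lin by apply: admissible_sum => s; exact: admissibleZ.
have aq1 : admissible q1.
  by apply: admissible_sum => s; apply/admissibleZ/admissibleM.
have aq2 : admissible q2.
  by apply: admissible_sum => s; apply: admissible_sum => t; apply/admissibleZ/admissibleM.
pose P v := (f x + r * lin v) + r ^+ 2 / 2 * (q1 v - q2 v).
have aP0 : admissible (fun v => f x + r * lin v).
  by apply: admissibleD; [exact: admissible_cst|exact: admissibleZ].
have aP1 : admissible (fun v => r ^+ 2 / 2 * (q1 v - q2 v)).
  by apply: admissibleZ; exact: admissibleB.
have aP : admissible P by exact: admissibleD.
pose F v := f (fun s => x s + r * v s).
have aF : admissible F by exact: admissible_affine.
have FP v : `|F v - P v| <= 26 * r ^+ 3 * N3 v.
  have := lse_taylor b x (fun s => r * v s) Qs0; rewrite -/p -/f -/(F v).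
  have -> : \sum_s `|r * v s| ^+ 3 = r ^+ 3 * N3 v.
    rewrite /N3 mulr_sumr; apply: eq_bigr => s _.
    by rewrite normrM exprMn ger0_norm.
  rewrite mulrA; congr (`|F v - _| <= _); rewrite /P; congr (_ + _ + _).
    by rewrite /lin mulr_sumr; apply: eq_bigr => s _; ring.
  rewrite mulrAC; congr (_ / 2); rewrite mulrBr; congr (_ - _).
    by rewrite /q1 mulr_sumr; apply: eq_bigr => s _; ring.
  rewrite /q2 mulr_sumr; apply: eq_bigr => s _; rewrite mulr_sumr.
  by apply: eq_bigr => t _; ring.
(* The base point is moved to 0 and the scale [r] is moved from the directions to the argument, so
   that the polynomial [P] can be averaged with the unscaled [cs]. *)
have FE : gmeans (scale_vecs r cs) f x = gmeans cs F (fun=> 0).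
  have := gmeans_scale r cs (fun y => f (fun s => y s + x s)) (fun=> 0).
  rewrite gmeans_shift (_ : (fun s => r * 0 + x s) = x); last first.
    by apply/funext => s; rewrite mulr0 add0r.
  move=> ->; congr gmeans; apply/funext => v; congr f; apply/funext => s.
  by rewrite addrC.
pose qq s t : R := \sum_(c <- cs) c s * c t.
have PE : gmeans cs P (fun=> 0) = f x + normal_moment2 R * r ^+ 2 / 4 *
    \sum_s \sum_t p s * p t * sqdist cs s t.
  rewrite /P gmeansD// gmeansD//; [|exact: admissible_cst|exact: admissibleZ].
  rewrite gmeans_cst gmeansZ// gmeansZ//; last exact: admissibleB.
  rewrite gmeansB// gmeans_sum; last by move=> s; exact: admissibleZ.
  rewrite [X in r * X]big1 ?mulr0 ?addr0; last first.
    by move=> s _; rewrite gmeansZ// gmeans_coord mulr0.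
  congr (_ + _).
  have -> : gmeans cs q1 (fun=> 0) = normal_moment2 R * \sum_s p s * qq s s.
    rewrite gmeans_sum; last by move=> s; apply/admissibleZ/admissibleM.
    rewrite mulr_sumr; apply: eq_bigr => s _.
    rewrite gmeansZ; last exact: admissibleM.
    by rewrite gmeans_quad mulr0 add0r mulrCA.
  have -> : gmeans cs q2 (fun=> 0) =
      normal_moment2 R * \sum_s \sum_t p s * p t * qq s t.
    rewrite gmeans_sum; last first.
      by move=> s; apply: admissible_sum => t; apply/admissibleZ/admissibleM.
    rewrite mulr_sumr; apply: eq_bigr => s _.
    rewrite gmeans_sum; last by move=> t; apply/admissibleZ/admissibleM.
    rewrite mulr_sumr; apply: eq_bigr => t _.
    rewrite gmeansZ; last exact: admissibleM.
    by rewrite gmeans_quad mulr0 add0r mulrCA.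
  have -> : \sum_s \sum_t p s * p t * sqdist cs s t =
     2 * (\sum_s p s * qq s s) - 2 * \sum_s \sum_t p s * p t * qq s t.
    have sd s t : sqdist cs s t = qq s s + qq t t - 2 * qq s t.
      rewrite /sqdist /qq mulr_sumr -big_split -sumrB; apply: eq_bigr => c _ /=.
      by ring.
    have p1 : \sum_s p s = 1 by exact: sum_gibbs Qs0.
    rewrite (eq_bigr (fun s => p s * qq s s + \sum_t p t * qq t t * p s -
       2 * \sum_t p s * p t * qq s t)).
      rewrite sumrB big_split -mulr_sumr /=; congr (_ - _).
      rewrite exchange_big /= mulr2n mulrDl mul1r; congr (_ + _).
      by apply: eq_bigr => t _; rewrite -mulr_sumr p1 mulr1.
    move=> s _; have -> : p s * qq s s = \sum_t p t * (p s * qq s s).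
      by rewrite -mulr_suml p1 mul1r.
    rewrite mulr_sumr.
    by rewrite -big_split -sumrB; apply: eq_bigr => t _ /=; rewrite sd; ring.
  by field.
have aN : admissible (fun v => 26 * r ^+ 3 * N3 v) by exact: admissibleZ.
rewrite FE -addrA -opprD -PE -gmeansZ// ler_norml; apply/andP; split.
  rewrite lerBrDr addrC -lerBrDr opprK -gmeansD//.
  apply: le_gmeans => // [|v]; first exact: admissibleD.
  by have := FP v; rewrite -/(N3 v) ler_norml => /andP[]; lra.
rewrite lerBlDr -gmeansD//; apply: le_gmeans => // [|v]; first exact: admissibleD.
by have := FP v; rewrite -/(N3 v) ler_norml => /andP[]; lra.
Qed.

(* The third order Taylor errors of the [2 ^ k] steps add up to
   [O(2 ^ (- k / 2))]; the second order terms are Gibbs averages of [sqdist]. *)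
Theorem gmeans_lse_le bs cs Q b x s0 (e : R) : Q s0 ->
  (forall s t, Q s -> Q t -> sqdist bs s t <= sqdist cs s t + 4 * e) ->
  gmeans bs (lse Q b) x <= gmeans cs (lse Q b) x + normal_moment2 R * e.
Proof.
move=> Qs0 dist; set f := lse Q b; set kap := normal_moment2 R.
have kap0 : 0 <= kap by exact: normal_moment2_ge0.
have af : admissible f by exact: admissible_lse Qs0.
pose N3 ds : R := gmeans ds (fun v => \sum_s `|v s| ^+ 3) (fun=> 0).
pose C := 26 * (N3 bs + N3 cs).
pose r : R := (Num.sqrt 2)^-1.
have r0 : 0 <= r by rewrite invr_ge0 sqrtr_ge0.
have r2 : r ^+ 2 = 2^-1 by rewrite exprVn sqr_sqrtr.
have key k : gmeans bs f x <= gmeans cs f x + kap * e + C * r ^+ k.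
  pose rk := r ^+ k; have rk0 : 0 <= rk by rewrite exprn_ge0.
  have rk2 : rk ^+ 2 = 2^-1 ^+ k by rewrite /rk -exprM mulnC exprM r2.
  (* The one-step defect carries the factor [rk ^+ 2 = 2 ^ (- k)], which cancels the number [2 ^ k]
     of steps. *)
  have one y : gmeans (scale_vecs rk bs) f y <=
      gmeans (scale_vecs rk cs) f y + (kap * e + C * rk) * rk ^+ 2.
    have := gmeans_lse_step bs b y Qs0 rk0.
    have := gmeans_lse_step cs b y Qs0 rk0.
    rewrite /= -/f -/kap -/(N3 bs) -/(N3 cs) !ler_norml.
    set p := gibbs Q b y; set Dc := \sum_s _; set Db := \sum_s _.
    have p1 : \sum_s p s = 1 by exact: sum_gibbs Qs0.
    have DD : Db <= Dc + 4 * e.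
      have -> : Dc + 4 * e = \sum_s \sum_t p s * p t * (sqdist cs s t + 4 * e).
        rewrite [RHS](eq_bigr (fun s => \sum_t p s * p t * sqdist cs s t +
            \sum_t p t * (p s * (4 * e)))).
          rewrite big_split /=; congr (_ + _).
          transitivity (\sum_s p s * (4 * e)); first by rewrite -mulr_suml p1 mul1r.
          by apply: eq_bigr => s _; rewrite -mulr_suml p1 mul1r.
        move=> s _; rewrite -big_split; apply: eq_bigr => t _ /=; ring.
      apply: ler_sum => s _; apply: ler_sum => t _.
      (* Gibbs weights vanish outside [Q], hence distances need to be compared on the constraint set
         only. *)
      have [Qs|Qs] := boolP (Q s); last by rewrite /p /gibbs (negbTE Qs) !mul0r.
      have [Qt|Qt] := boolP (Q t); last by rewrite /p /gibbs (negbTE Qt) mulr0 !mul0r.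
      by rewrite ler_wpM2l ?dist// mulr_ge0 ?gibbs_ge0.
    move=> /andP[h1 _] /andP[_ h2].
    have h3 : kap * rk ^+ 2 / 4 * Db <= kap * rk ^+ 2 / 4 * (Dc + 4 * e).
      by rewrite ler_wpM2l// divr_ge0// mulr_ge0// sqr_ge0.
    have -> : (kap * e + C * rk) * rk ^+ 2 = kap * rk ^+ 2 / 4 * (4 * e) +
       26 * rk ^+ 3 * N3 bs + 26 * rk ^+ 3 * N3 cs by rewrite /C; field.
    rewrite mulrDr in h3.
    by move: h1 h2 h3; lra.
  rewrite (gmeans_iter bs k af) (gmeans_iter cs k af) -/r -/rk.
  apply: (le_trans (iter_gmeans_le (2 ^ k) x af one)).
  by rewrite rk2 natrX mulrCA -exprMn mulfV ?pnatr_eq0// expr1n mulr1 addrA.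
have cv : (fun k => gmeans cs f x + kap * e + C * r ^+ k) @ \oo -->
    gmeans cs f x + kap * e + C * 0.
  apply: cvgD; first exact: cvg_cst.
  apply: cvgMr; apply: cvg_expr; rewrite ger0_norm//.
  by rewrite -(@expr_lt1 _ 2)// r2 invf_lt1// ltr1n.
rewrite mulr0 addr0 in cv.
rewrite -(cvg_lim _ cv)//; apply: limr_ge; first by apply/cvg_ex; eexists; exact: cv.
by apply: nearW => k; exact: key.
Qed.

End lse.

(** * Independence and Gaussian combinations *)

Section independent_blocks.
Context d (T : measurableType d) (R : realType) (P : probability T R).
Variables (I : choiceType) (D : set I) (X : I -> {RV P >-> R}).

(** A pi-system generating the sigma-algebra of the [X i] with [i] in [E]. *)
Definition cylinders (E : set I) : set (set T) :=
  [set A | exists (J : seq I) (B : I -> set R),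
    [/\ uniq J, [set` J] `<=` E, (forall i, measurable (B i)) &
        A = \bigcap_(i in [set` J]) (X i @^-1` B i)]].

Lemma cylinders_setT E : cylinders E setT.
Proof.
by exists [::], (fun=> setT); split => //; apply/seteqP; split.
Qed.

Lemma measurable_preimage_RV i (B : set R) : measurable B -> measurable (X i @^-1` B).
Proof. by move=> mB; rewrite -[X in measurable X]setTI; exact: measurable_funP. Qed.

Lemma cylinders_measurable E : cylinders E `<=` measurable.
Proof.
move=> _ [J [B [_ _ mB ->]]]; apply: fin_bigcap_measurable.
  exact: finite_seq.
by move=> i _; exact: measurable_preimage_RV.
Qed.

Lemma cylinders_setI E : setI_closed (cylinders E).
Proof.
move=> _ _ [J1 [B1 [u1 J1E m1 ->]]] [J2 [B2 [u2 J2E m2 ->]]].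
pose ext (J : seq I) (B : I -> set R) i := if i \in J then B i else setT.
exists (undup (J1 ++ J2)), (fun i => ext J1 B1 i `&` ext J2 B2 i); split.
- exact: undup_uniq.
- by move=> i /=; rewrite mem_undup mem_cat => /orP[/J1E|/J2E].
- by move=> i; apply: measurableI; rewrite /ext; case: ifP.
apply/seteqP; split => w /=.
  move=> [h1 h2] i /= _; split; rewrite /ext; case: ifP => // iJ.
    exact: (h1 i iJ).
  exact: (h2 i iJ).
move=> h; split => i /= iJ.
  by have := h i; rewrite /= mem_undup mem_cat iJ /ext /= => /(_ isT); rewrite iJ => -[].
have := h i; rewrite /= mem_undup mem_cat iJ orbT /ext /= => /(_ isT).
by rewrite iJ => -[].
Qed.

Lemma sigma_cylinders_measurable E : <<s cylinders E >> `<=` measurable.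
Proof.
apply: smallest_sub; first exact: sigma_algebra_measurable.
exact: cylinders_measurable.
Qed.

(** In [A], both sides are finite measures, [P] restricted to [B] and [P B] times [P]; they agree on
    a pi-system, hence on the sigma-algebra that it generates. *)
Let indep_extend (G : set (set T)) (B : set T) : measurable B ->
  setI_closed G -> G setT -> G `<=` measurable ->
  (forall A, G A -> P (A `&` B) = P A * P B)%E ->
  forall A, <<s G >> A -> P (A `&` B) = (P A * P B)%E.
Proof.
move=> mB GI GT Gm GB A sA.
have PBfin : P B \is a fin_num by exact: fin_num_measure.
have PB0 : 0 <= fine (P B) by exact: fine_ge0.
pose m1 : {measure set T -> \bar R} := mrestr P mB.
pose m2 : {measure set T -> \bar R} := mscale (NngNum PB0) P.
have m2E C : m2 C = (P C * P B)%E by rewrite /m2 /= /mscale /= fineK// muleC.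
rewrite -m2E -[LHS]/(m1 A).
apply: (g_sigma_algebra_measure_unique G Gm (fun=> setT)) => //.
- by rewrite bigcup_const.
- by move=> C GC; rewrite m2E; exact: GB.
- by move=> _; rewrite /m1 /= /mrestr setTI ltey_eq PBfin.
Qed.

Hypothesis indep : independent_on D X.

(** On cylinders this is the product formula for the concatenated index lists; [indep_extend] then
    passes to the generated sigma-algebras, one side at a time. *)
Lemma independent_sigma_cylinders (E1 E2 : set I) (A B : set T) :
  E1 `<=` D -> E2 `<=` D -> (forall i, E1 i -> ~ E2 i) ->
  <<s cylinders E1 >> A -> <<s cylinders E2 >> B -> P (A `&` B) = (P A * P B)%E.
Proof.
move=> E1D E2D E12.
have step0 C1 C2 : cylinders E1 C1 -> cylinders E2 C2 -> P (C1 `&` C2) = (P C1 * P C2)%E.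
  move=> [J1 [B1 [u1 J1E m1 ->]]] [J2 [B2 [u2 J2E m2 ->]]].
  pose B0 i := if i \in J1 then B1 i else B2 i.
  have notJ1 i : i \in J2 -> i \notin J1.
    by move=> /J2E iE2; apply/negP => /J1E /E12.
  have uJ : uniq (J1 ++ J2).
    by rewrite cat_uniq u1 u2 /= andbT; apply/hasPn => i; exact: notJ1.
  have mB0 i : measurable (B0 i) by rewrite /B0; case: ifP.
  have JD : [set` J1 ++ J2] `<=` D.
    by move=> i /=; rewrite mem_cat => /orP[/J1E/E1D|/J2E/E2D].
  have := indep uJ JD mB0; rewrite big_cat /=.
  have -> : \bigcap_(i in [set` J1 ++ J2]) (X i @^-1` B0 i) =
     \bigcap_(i in [set` J1]) (X i @^-1` B1 i) `&` \bigcap_(i in [set` J2]) (X i @^-1` B2 i).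
    apply/seteqP; split => w /=.
      move=> h; split => i /= iJ.
        by have := h i; rewrite /= mem_cat iJ /B0 => /(_ isT); rewrite /= iJ.
      have := h i; rewrite /= mem_cat iJ orbT /B0 => /(_ isT).
      by rewrite /= (negbTE (notJ1 _ iJ)).
    move=> [h1 h2] i /=; rewrite mem_cat /B0; have [iJ _|iJ /= iJ2] := boolP (i \in J1).
      exact: h1.
    exact: h2.
  move=> ->; congr (_ * _)%E.
    rewrite (indep u1 (subset_trans J1E E1D) m1).
    by apply: eq_big_seq => i iJ; rewrite /B0 iJ.
  rewrite (indep u2 (subset_trans J2E E2D) m2).
  by apply: eq_big_seq => i iJ; rewrite /B0 (negbTE (notJ1 _ iJ)).
have step1 C2 : cylinders E2 C2 ->
    forall C1, <<s cylinders E1 >> C1 -> P (C1 `&` C2) = (P C1 * P C2)%E.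
  move=> cC2; apply: indep_extend.
  - exact: cylinders_measurable cC2.
  - exact: cylinders_setI.
  - exact: cylinders_setT.
  - exact: cylinders_measurable.
  - by move=> C1 cC1; exact: step0.
move=> sA sB; rewrite setIC muleC; move: B sB; apply: indep_extend.
- exact: sigma_cylinders_measurable sA.
- exact: cylinders_setI.
- exact: cylinders_setT.
- exact: cylinders_measurable.
- by move=> C2 cC2; rewrite setIC muleC step1.
Qed.

(* [T] with the smaller sigma-algebra generated by the [X i], [i] in [E], so that
   independence can be stated as a product law. *)
Definition cyl_type (E : set I) := g_sigma_algebraType (cylinders E).

Lemma cylinders_preimage (E : set I) i (B : set R) : E i -> measurable B ->
  cylinders E (X i @^-1` B).
Proof.
move=> Ei mB; exists [:: i], (fun=> B); split => //.
  by move=> j /=; rewrite inE => /eqP ->.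
by rewrite set_cons1 bigcap_set1.
Qed.

Lemma measurable_cyl_RV (E : set I) i : E i ->
  measurable_fun [set: cyl_type E] (X i : cyl_type E -> R).
Proof.
move=> Ei _ B mB; rewrite setTI; apply: sub_sigma_algebra.
exact: cylinders_preimage.
Qed.

(** The identity of the underlying set, seen as a random variable with values in the coarser
    measurable space. *)
Definition to_cyl (E : set I) : T -> cyl_type E := id.

Lemma measurable_to_cyl (E : set I) : measurable_fun [set: T] (to_cyl E).
Proof. by move=> _ A mA; rewrite setTI; exact: sigma_cylinders_measurable mA. Qed.

HB.instance Definition _ (E : set I) := isMeasurableFun.Build _ _ _ _
  (to_cyl E) (@measurable_to_cyl E).

Definition cyl_pair (E : set I) (i : I) (w : T) : cyl_type E * measurableTypeR R := (to_cyl E w, X i w).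

Lemma measurable_cyl_pair (E : set I) i : measurable_fun [set: T] (cyl_pair E i).
Proof.
apply: (measurable_fun_pair (@measurable_to_cyl E)).
exact: (measurable_funPT (X i)).
Qed.

HB.instance Definition _ (E : set I) i := isMeasurableFun.Build _ _ _ _
  (cyl_pair E i) (@measurable_cyl_pair E i).

Hypothesis normal_X : forall i, D i -> forall B : set R, measurable B ->
  distribution P (X i) B = normal_prob 0 1 B.

Local Notation gam := (normal_prob (0:R) 1).

(** Rectangles determine a product measure, and on rectangles the claim is independence of [X i]
    from the sigma-algebra of [E]. *)
Lemma cyl_pair_law (E : set I) i (A : set (cyl_type E * measurableTypeR R)) :
  E `<=` D -> D i -> ~ E i -> measurable A ->
  (distribution P (to_cyl E) \x gam)%E A = distribution P (cyl_pair E i) A.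
Proof.
move=> ED Di Ei mA.
refine (@product_measure_unique _ _ _ _ _ (distribution P (to_cyl E)) gam
  (distribution P (cyl_pair E i)) _ A mA) => B C mB mC.
rewrite /= /distribution /pushforward.
have -> : cyl_pair E i @^-1` (B `*` C) = B `&` X i @^-1` C.
  by apply/seteqP; split.
rewrite (@independent_sigma_cylinders E [set i]).
- by rewrite -[P (X i @^-1` C)]/(distribution P (X i) C) normal_X.
- exact: ED.
- by move=> _ ->.
- by move=> j Ej ji; apply: Ei; rewrite -ji.
- exact: mB.
- by apply: sub_sigma_algebra; exact: cylinders_preimage.
Qed.

Lemma integral_indep (E : set I) i (f : cyl_type E * measurableTypeR R -> R) :
  E `<=` D -> D i -> ~ E i -> measurable_fun setT f ->
  (\int[P]_w \int[gam]_z `|(f (to_cyl E w, z))%:E| < +oo)%E ->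
  P.-integrable setT (fun w => (f (cyl_pair E i w))%:E) /\
  (\int[P]_w (f (cyl_pair E i w))%:E = \int[P]_w \int[gam]_z (f (to_cyl E w, z))%:E)%E.
Proof.
move=> ED Di Ei mf foo.
have mEf : measurable_fun setT (EFin \o f) by exact/measurable_EFinP.
have mEnf : measurable_fun setT (abse \o (EFin \o f)) by exact: measurableT_comp.
have nf0 p : (0 <= (abse \o (EFin \o f)) p)%E by exact: abse_ge0.
have ge0E (h : cyl_type E -> \bar R) : measurable_fun setT h -> (forall x, 0 <= h x)%E ->
    (\int[distribution P (to_cyl E)]_x h x = \int[P]_w h (to_cyl E w))%E.
  by move=> mh h0; rewrite ge0_integral_distribution.
have lawE (h : cyl_type E * measurableTypeR R -> \bar R) :
    (\int[distribution P (to_cyl E) \x gam]_p h p = \int[distribution P (cyl_pair E i)]_p h p)%E.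
  by apply: eq_measure_integral => A mA _; exact: cyl_pair_law.
have iprod : (distribution P (to_cyl E) \x gam)%E.-integrable setT (EFin \o f).
  apply/integrableP; split => //.
  rewrite (@fubini_tonelli1 _ _ _ _ _ (distribution P (to_cyl E)) gam _ mEnf nf0).
  rewrite ge0E; first exact: foo.
    exact: (@measurable_fun_fubini_tonelli_F _ _ _ _ _ gam _ mEnf nf0).
  by move=> x; exact: integral_ge0.
have iP : P.-integrable setT (fun w => (f (cyl_pair E i w))%:E).
  apply/integrableP; split; first refine (measurableT_comp mEf (@measurable_cyl_pair E i)).
  have := ge0_integral_distribution (P := P) (cyl_pair E i) mEnf nf0.
  rewrite -lawE => <-; by case/integrableP: iprod.
split=> //.
have := integral_distribution (X := cyl_pair E i) mEf iP => <-.
rewrite -lawE -(integral12_prod_meas1 iprod).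
have iF := integrable_fubini_F iprod.
have mF : measurable_fun setT (fubini_F gam (EFin \o f)) by case/integrableP: iF.
have iFP : P.-integrable setT (fubini_F gam (EFin \o f) \o to_cyl E).
  apply/integrableP; split; first refine (measurableT_comp mF (@measurable_to_cyl E)).
  rewrite -(ge0E (fun x => `|fubini_F gam (EFin \o f) x|%E)).
  - by case/integrableP: iF.
  - exact: measurableT_comp.
  - by move=> x; exact: abse_ge0.
exact: (integral_distribution (X := to_cyl E) mF iFP).
Qed.

End independent_blocks.

Section gaussian_combinations.
Context d (T : measurableType d) (R : realType) (P : probability T R).
Variables (I : choiceType) (D : set I) (X : I -> {RV P >-> R}).
Hypothesis indep : independent_on D X.
Hypothesis normal_X : forall i, D i -> forall B : set R, measurable B ->
  distribution P (X i) B = normal_prob 0 1 B.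

Definition lincomb (S : Type) (L : seq (I * (S -> R))) (w : T) (s : S) : R :=
  \sum_(q <- L) q.2 s * X q.1 w.

Lemma measurable_cyl_lincomb (S : Type) (L : seq (I * (S -> R))) (E : set I) s :
  (forall q, List.In q L -> E q.1) ->
  measurable_fun [set: cyl_type X E] (fun w : cyl_type X E => lincomb L w s).
Proof.
elim: L => [|q L IH] LE.
  rewrite (_ : (fun w => _) = fun=> 0); first exact: measurable_cst.
  by apply/funext => w; rewrite /lincomb big_nil.
rewrite (_ : (fun w => _) = (fun w => q.2 s * X q.1 w + lincomb L w s)); last first.
  by apply/funext => w; rewrite /lincomb big_cons.
apply: measurable_funD; last by apply: IH => q' Lq'; apply: LE; right.
apply: measurable_funM; first exact: measurable_cst.
by apply: measurable_cyl_RV; apply: LE; left.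
Qed.

(** The first Gaussian is independent of the sigma-algebra of the remaining keys, so Fubini
    integrates it out as one [gmean], and the induction applies to the averaged function. Distinct
    keys are what makes the variables independent. *)
Lemma lincomb_gmeans (S : finType) (L : seq (I * (S -> R))) (F : (S -> R) -> R) :
  uniq [seq q.1 | q <- L] -> (forall i, i \in [seq q.1 | q <- L] -> D i) ->
  admissible F ->
  P.-integrable setT (fun w => (F (lincomb L w))%:E) /\
  (\int[P]_w (F (lincomb L w))%:E = (gmeans [seq q.2 | q <- L] F (fun=> 0))%:E)%E.
Proof.
elim: L F => [|q L IH] F /=.
  move=> _ _ aF.
  have -> : (fun w => (F (lincomb [::] w))%:E) = (fun=> (F (fun=> 0))%:E).
    apply/funext => w; congr (F _)%:E; apply/funext => s.
    by rewrite /lincomb big_nil.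
  split; first exact: finite_measure_integrable_cst.
  by rewrite integral_cst// [X in (_ * X)%E](_ : _ = 1%E) ?mule1//; exact: probability_setT.
move=> /andP[qL uL] LD aF; have [mF _] := aF.
pose E := [set` [seq q.1 | q <- L]].
have ED : E `<=` D by move=> i iL; apply: LD; rewrite inE iL orbT.
have Dq : D q.1 by apply: LD; rewrite inE eqxx.
have Eq : ~ E q.1 by apply/negP.
have {}LD i : i \in [seq q.1 | q <- L] -> D i by move=> iL; apply: LD; rewrite inE iL orbT.
pose f (p : cyl_type X E * measurableTypeR R) : R :=
  F (fun s => lincomb L p.1 s + p.2 * q.2 s).
have mf : measurable_fun setT f.
  apply: (mF _ _ (fun (p : cyl_type X E * measurableTypeR R) s =>
    lincomb L p.1 s + p.2 * q.2 s)) => s.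
  apply: measurable_funD; last by apply: measurable_funM.
  have LE q' : List.In q' L -> E q'.1.
    elim: L {IH qL uL LD ED Eq f} @E => //= a L IH' [->|/IH' h]; rewrite /= inE ?eqxx//.
    by rewrite h orbT.
  exact: (measurableT_comp (measurable_cyl_lincomb s LE) measurable_fst).
have inner (H : (S -> R) -> R) (w : T) : admissible H ->
   (\int[normal_prob 0 1]_z (H (fun s => lincomb L w s + z * q.2 s))%:E =
   (gmean q.2 H (lincomb L w))%:E)%E.
  by move=> aH; rewrite gmean_EFin.
(* The induction hypothesis for the average of the absolute value of [F] supplies the integrability
   that Fubini requires. *)
have [iN _] := IH _ uL LD (admissible_gmean q.2 (admissible_norm aF)).
have foo : (\int[P]_w \int[normal_prob 0 1]_z `|(f (to_cyl X E w, z))%:E| < +oo)%E.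
  move/integrableP : iN => [_]; congr (_ < _)%E.
  apply: eq_integral => w _; rewrite gee0_abs.
    by rewrite -inner//; exact: admissible_norm.
  by rewrite lee_fin; apply: Rintegral_ge0 => z _.
have [iF EF] := integral_indep indep normal_X ED Dq Eq mf foo.
have E1 : (fun w => (F (lincomb (q :: L) w))%:E) = (fun w => (f (cyl_pair X E q.1 w))%:E).
  apply/funext => w; congr (F _)%:E; apply/funext => s.
  by rewrite /lincomb big_cons addrC [q.2 s * _]mulrC.
rewrite E1; split => //; rewrite EF.
have [_ <-] := IH _ uL LD (admissible_gmean q.2 aF).
by apply: eq_integral => w _; rewrite -inner.
Qed.

Lemma measurable_lincomb (S : Type) (L : seq (I * (S -> R))) s :
  measurable_fun [set: T] (fun w => lincomb L w s).
Proof.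
elim: L => [|q L IH].
  rewrite (_ : (fun w => _) = fun=> 0); first exact: measurable_cst.
  by apply/funext => w; rewrite /lincomb big_nil.
rewrite (_ : (fun w => _) = (fun w => q.2 s * X q.1 w + lincomb L w s)); last first.
  by apply/funext => w; rewrite /lincomb big_cons.
by apply: measurable_funD => //; exact: measurable_funM.
Qed.

Lemma lincomb_moment2 (S : finType) (L : seq (I * (S -> R))) s :
  uniq [seq q.1 | q <- L] -> (forall i, i \in [seq q.1 | q <- L] -> D i) ->
  (\int[P]_w ((lincomb L w s) ^+ 2)%:E =
   (normal_moment2 R * \sum_(q <- L) q.2 s ^+ 2)%:E)%E.
Proof.
move=> uL LD.
have aq : admissible (fun x : S -> R => x s * x s).
  by apply: admissibleM; exact: admissible_coord.
have [_] := lincomb_gmeans uL LD aq.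
rewrite gmeans_quad mulr0 add0r big_map => <-.
by apply: eq_integral => w _; rewrite expr2.
Qed.

Lemma lincomb_chebyshev (S : finType) (L : seq (I * (S -> R))) s (e : R) : 0 < e ->
  uniq [seq q.1 | q <- L] -> (forall i, i \in [seq q.1 | q <- L] -> D i) ->
  (P [set w | e < `|lincomb L w s|]%R <=
   (normal_moment2 R * (\sum_(q <- L) q.2 s ^+ 2) / e ^+ 2)%:E)%E.
Proof.
move=> e0 uL LD.
have mA : measurable [set w | e < `|lincomb L w s|].
  rewrite -[X in measurable X]setTI.
  apply: (measurable_fun_ltr (measurable_cst e)) => //.
  by apply: measurableT_comp => //; exact: measurable_lincomb.
rewrite EFinM lee_pdivlMr ?exprn_gt0// -lincomb_moment2//.
have -> : (P [set w | e < `|lincomb L w s|]%R * (e ^+ 2)%:E =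
    \int[P]_w ((e ^+ 2) * \1_[set w | e < `|lincomb L w s|] w)%:E)%E.
  under eq_integral do rewrite EFinM.
  rewrite ge0_integralZl//; last 2 first.
  - exact/measurable_EFinP/measurable_indic.
  - by rewrite lee_fin sqr_ge0.
  by rewrite integral_indic// setIT muleC.
apply: ge0_le_integral => //=.
- by move=> w _; rewrite lee_fin mulr_ge0// sqr_ge0.
- by apply/measurable_EFinP; apply: measurable_funM => //; exact: measurable_indic.
- by apply/measurable_EFinP; apply: measurable_funX; exact: measurable_lincomb.
move=> w _; rewrite lee_fin indicE; have [/[!inE]/= we|_] := boolP (w \in _).
  rewrite mulr1 -[leRHS]real_normK ?num_real// lerXn2r ?nnegrE// ltW//.
by rewrite mulr0 sqr_ge0.
Qed.

End gaussian_combinations.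

(** * Maximal inequality and almost sure convergence *)

Section ottaviani.
Context d (T : measurableType d) (R : realType) (P : probability T R).
Variable S : nat -> T -> R.
Hypothesis mS : forall k, measurable_fun [set: T] (S k).

Definition exceed (e : R) (j k : nat) : set T :=
  [set w | exists i, [/\ (j < i)%N, (i <= k)%N & 2 * e < `|S i w - S j w|]].

(** First passage at time [k.+1]. The event involves the process up to [k.+1] only, hence is
    independent of the later increments. *)
Definition first_exceed (e : R) (j k : nat) : set T :=
  ~` exceed e j k `&` [set w | 2 * e < `|S k.+1 w - S j w|].

Definition close_to_end (e : R) (k n : nat) : set T :=
  [set w | `|S n w - S k w| <= e].

Lemma measurable_dist_gt i j (e : R) : measurable [set w | e < `|S i w - S j w|].
Proof.
rewrite -[X in measurable X]setTI; apply: (measurable_fun_ltr (measurable_cst e)) => //.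
by apply: measurableT_comp => //; exact: measurable_funB.
Qed.

Lemma exceed0 e j : exceed e j j = set0.
Proof. by apply/seteqP; split => // w [i [ji]]; rewrite leqNgt ji. Qed.

Lemma exceedS e j k : (j <= k)%N -> exceed e j k.+1 = exceed e j k `|` first_exceed e j k.
Proof.
move=> jk; apply/seteqP; split => w.
  move=> [i [ji + h]]; rewrite leq_eqVlt => /orP[/eqP ik|ik]; last first.
    by left; exists i; split.
  have [wk|wk] := pselect (exceed e j k w); [by left|right; split => //=].
  by rewrite -ik.
move=> [[i [ji ik h]]|[_ h]]; first by exists i; split => //; rewrite (leq_trans ik).
by exists k.+1; split.
Qed.

Lemma measurable_exceed e j k : (j <= k)%N -> measurable (exceed e j k).
Proof.
elim: k => [|k IH]; first by rewrite leqn0 => /eqP ->; rewrite exceed0.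
rewrite leq_eqVlt => /orP[/eqP <-|]; first by rewrite exceed0.
rewrite ltnS => jk; rewrite exceedS//; apply: measurableU; first exact: IH.
apply: measurableI; first by apply: measurableC; exact: IH.
exact: measurable_dist_gt.
Qed.

(** If the process first moves by more than [2 * e] at time [k.+1] and then stays within [e] of that
    position at time [n], its total displacement exceeds [e]. The second event is independent of the
    first and has probability at least 1/2, whence the factor 2. *)
Lemma ottaviani (e : R) (j n : nat) : (j <= n)%N ->
  (forall k, (j <= k < n)%N -> P (first_exceed e j k `&` close_to_end e k.+1 n) =
     P (first_exceed e j k) * P (close_to_end e k.+1 n))%E ->
  (forall k, (j <= k < n)%N -> (2^-1)%:E <= P (close_to_end e k.+1 n))%E ->
  (P (exceed e j n) <= 2%:E * P [set w | e < `|S n w - S j w|]%R)%E.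
Proof.
move=> jn indep half; set C := [set w | _].
have mC : measurable C by exact: measurable_dist_gt.
(* The intersection with [C] is kept during the induction: this makes the bound additive over the
   disjoint first passage events. *)
suff H k : (j <= k)%N -> (k <= n)%N -> (P (exceed e j k) <= 2%:E * P (exceed e j k `&` C))%E.
  apply: (le_trans (H n jn (leqnn n))); rewrite lee_pmul2l//.
  by apply: le_measure; rewrite ?inE//; apply: measurableI => //; exact: measurable_exceed.
elim: k => [|k IH]; first by rewrite leqn0 => /eqP -> _; rewrite exceed0 measure0 set0I measure0 mule0.
rewrite leq_eqVlt => /orP[/eqP <- _|]; first by rewrite exceed0 measure0 set0I measure0 mule0.
rewrite ltnS => jk kn.
have mE : measurable (exceed e j k) by exact: measurable_exceed.
have mF : measurable (first_exceed e j k).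
  by apply: measurableI; [exact: measurableC|exact: measurable_dist_gt].
rewrite exceedS// setIUl.
have dis : exceed e j k `&` first_exceed e j k = set0.
  by apply/seteqP; split => // w [h [nh _]].
rewrite measureU// measureU//; first last.
- apply/seteqP; split => // w [[h _] [h' _]].
  by rewrite -dis.
- exact: measurableI.
- exact: measurableI.
rewrite ge0_muleDr//; apply: leeD; first by apply: IH => //; exact: ltnW.
apply: (@le_trans _ _ (2%:E * P (first_exceed e j k `&` close_to_end e k.+1 n))%E).
  rewrite indep ?jk//.
  apply: (@le_trans _ _ (2%:E * (P (first_exceed e j k) * (2^-1)%:E))%E).
    by rewrite muleC -muleA -EFinM mulVf ?mule1// pnatr_eq0.
  by rewrite lee_pmul2l// lee_wpmul2l// half// jk.
rewrite lee_pmul2l//; apply: le_measure; rewrite ?inE//.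
- apply: measurableI => //.
  rewrite (_ : close_to_end _ _ _ = ~` [set w | e < `|S n w - S k.+1 w|]).
    exact/measurableC/measurable_dist_gt.
  apply/seteqP; split => w /=; first by rewrite /close_to_end /= leNgt => /negP.
  by move=> /negP; rewrite -leNgt.
- exact: measurableI.
move=> w [[w1 h1] h2]; split => //.
rewrite /C /=; rewrite /close_to_end /= in h1 h2.
rewrite ltNge; apply/negP => h3.
have : `|S k.+1 w - S j w| <= e + e.
  have -> : S k.+1 w - S j w = (S n w - S j w) - (S n w - S k.+1 w).
    by ring.
  by rewrite (le_trans (ler_normB _ _))// lerD.
by rewrite leNgt -mulr2n -mulr_natl h1.
Qed.

End ottaviani.

Section cauchy_criterion.
Context {R : realType}.

(** A Cauchy criterion with countably many tolerances and a single reference index, so that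
    convergence is a countable combination of events. *)
Lemma cvgn_incrP (u : nat -> R) : cvgn u <->
  forall r, exists j, forall k, (j <= k)%N -> `|u k - u j| <= r.+1%:R^-1.
Proof.
split=> [/cvg_ex[l /cvgrPdist_lt ul] r|h].
  have e0 : 0 < r.+1%:R^-1 / 2 :> R by rewrite divr_gt0 ?invr_gt0.
  have [j _ jh] := ul _ e0; exists j => k jk.
  have -> : u k - u j = (l - u j) - (l - u k) by ring.
  rewrite (le_trans (ler_normB _ _))// [leRHS]splitr lerD//; apply: ltW.
    by apply: jh => /=.
  exact: jh.
apply: cauchy_cvg; apply: cauchy_exP => e e0.
have [r _ rh] := @near_infty_natSinv_lt R (PosNum e0).
have [j jh] := h r; exists (u j); exists j => // k /= jk.
rewrite -ball_normE /ball_ /= distrC (le_lt_trans (jh k jk))//.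
by have := rh r (leqnn r).
Qed.

End cauchy_criterion.

Section ae_convergence.
Context d (T : measurableType d) (R : realType) (P : probability T R).
Variable S : nat -> T -> R.
Hypothesis mS : forall k, measurable_fun [set: T] (S k).

Lemma measurable_cvgn_set : measurable [set w | cvgn (S ^~ w)].
Proof.
have -> : [set w | cvgn (S ^~ w)] = \bigcap_r \bigcup_j \bigcap_(k in [set k | (j <= k)%N])
    ~` [set w | r.+1%:R^-1 < `|S k w - S j w|].
  apply/seteqP; split => w /=.
    move/cvgn_incrP => h r _; have [j jh] := h r; exists j => // k /= jk.
    by rewrite ltNge jh.
  move=> h; apply/cvgn_incrP => r; have [j _ jh] := h r I; exists j => k jk.
  by have /negP := jh k jk; rewrite -leNgt.
apply: bigcapT_measurable => r; apply: bigcupT_measurable => j.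
apply: bigcap_measurable; first by exists j => /=.
by move=> k _; apply: measurableC; exact: measurable_dist_gt.
Qed.

Lemma measurable_limn : measurable_fun [set: T] (fun w => limn (S ^~ w)).
Proof.
pose C := [set w | cvgn (S ^~ w)].
(* Off the convergence set [limn] takes the default value [point]; with this value imposed there,
   convergence holds everywhere. *)
pose S' n w : R := if w \in C then S n w else point.
apply: (@measurable_fun_cvg _ _ _ _ S').
  move=> n; apply: measurable_fun_ifT => //.
  by apply: (measurable_fun_bool true); rewrite setTI preimage_mem_true; exact: measurable_cvgn_set.
move=> w _; rewrite /S'; have [/[!inE] Cw|/negP Cw] := boolP (w \in C); first exact: Cw.
rewrite dvgP; first exact: cvg_cst.
by move=> cw; apply: Cw; rewrite inE.
Qed.

Variable v : nat -> R.
Hypothesis v0 : v @ \oo --> 0.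
Hypothesis tail : forall (e : R) j k n, 0 < e -> (j <= k)%N -> (k <= n)%N ->
  (P [set w | e < `|S n w - S k w|]%R <= (v j / e ^+ 2)%:E)%E.
Hypothesis indep : forall (e : R) j k n, (j <= k)%N -> (k < n)%N ->
  P (first_exceed S e j k `&` close_to_end S e k.+1 n) =
  (P (first_exceed S e j k) * P (close_to_end S e k.+1 n))%E.

(** Once [v j / e ^+ 2] is at most 1/2, the tail bound gives the probability 1/2 that [ottaviani]
    asks of the events [close_to_end]. *)
Let exceed_le (e : R) j n : 0 < e -> v j / e ^+ 2 <= 2^-1 -> (j <= n)%N ->
  (P (exceed S e j n) <= (2 * (v j / e ^+ 2))%:E)%E.
Proof.
move=> e0 vj jn; apply: le_trans (ottaviani mS jn _ _) _ => [k /andP[jk kn]|k /andP[jk kn]|].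
- exact: indep.
- have -> : close_to_end S e k.+1 n = ~` [set w | e < `|S n w - S k.+1 w|].
    apply/seteqP; split => w /=; first by rewrite /close_to_end /= leNgt => /negP.
    by move=> /negP; rewrite -leNgt.
  rewrite probability_setC; last exact: measurable_dist_gt.
  rewrite leeBrDl; last by rewrite fin_num_measure//; exact: measurable_dist_gt.
  apply: (@le_trans _ _ ((v j / e ^+ 2)%:E + (2^-1)%:E)%E).
    by apply: leeD => //; exact: (tail e0 (leqW jk)).
  by rewrite -EFinD lee_fin; lra.
by rewrite EFinM lee_pmul2l//; exact: tail.
Qed.

(** From every starting index some later displacement exceeds [2 * e], so the Cauchy criterion fails
    at that scale. *)
Let diverge (e : R) : set T := \bigcap_j \bigcup_n exceed S e j (j + n).

Let exceed_mono e j n m : (n <= m)%N -> exceed S e j n `<=` exceed S e j m.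
Proof. by move=> nm w [i [ji ik h]]; exists i; split => //; rewrite (leq_trans ik). Qed.

Let diverge0 (e : R) : 0 < e -> P (diverge e) = 0%E.
Proof.
move=> e0.
have mU j : measurable (\bigcup_n exceed S e j (j + n)).
  by apply: bigcupT_measurable => n; apply: measurable_exceed => //; exact: leq_addr.
have mD : measurable (diverge e) by exact: bigcapT_measurable.
have bound j : v j / e ^+ 2 <= 2^-1 -> (P (diverge e) <= (2 * (v j / e ^+ 2))%:E)%E.
  move=> vj; apply: (@le_trans _ _ (P (\bigcup_n exceed S e j (j + n)))).
    by apply: le_measure; rewrite ?inE//; exact: bigcap_inf.
  have cv := @nondecreasing_cvg_mu _ _ _ P (fun n => exceed S e j (j + n)).
  have {}cv : (P \o (fun n => exceed S e j (j + n))) @ \oo -->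
      P (\bigcup_n exceed S e j (j + n)).
    apply: cv => // [n|n m nm]; first by apply: measurable_exceed => //; exact: leq_addr.
    by apply/subsetPset; apply: exceed_mono; rewrite leq_add2l.
  rewrite -(cvg_lim _ cv)//; apply: lime_le; first by apply/cvg_ex; eexists; exact: cv.
  by apply: nearW => n; apply: exceed_le => //; exact: leq_addr.
have v0e : (fun j => 2 * (v j / e ^+ 2)) @ \oo --> 0.
  have -> : 0 = 2 * (0 / e ^+ 2) :> R by rewrite mul0r mulr0.
  by apply: cvgMr; apply: cvgMl.
have Pf : P (diverge e) \is a fin_num by exact: fin_num_measure.
apply/eqP; rewrite eq_le measure_ge0 andbT -(fineK Pf) lee_fin.
rewrite -(cvg_lim _ v0e)//; apply: limr_ge; first by apply/cvg_ex; eexists; exact: v0e.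
move/cvgrPdist_lt : v0e => /(_ _ ltr01) [j _ jh]; exists j => // k /= jk.
rewrite -lee_fin fineK//; apply: bound.
by have := jh k jk; rewrite sub0r normrN => /(le_lt_trans (ler_norm _)); lra.
Qed.

Lemma ae_cvgn : {ae P, forall w, cvgn (S ^~ w)}.
Proof.
(* The tolerance is halved because [exceed] has threshold [2 * e]. *)
have sub : ~` [set w | cvgn (S ^~ w)] `<=` \bigcup_r diverge (r.+1%:R^-1 / 2).
  move=> w /= ncv; apply: contrapT => nd; apply: ncv; apply/cvgn_incrP => r.
  apply: contrapT => /forallNP h; apply: nd; exists r => // j _.
  have /existsNP[k /not_implyP[jk hk]] := h j.
  exists (k - j)%N => //; rewrite subnKC//.
  exists k; split => //.
    rewrite ltn_neqAle jk andbT; apply/eqP => jk'; apply: hk.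
    by rewrite jk' subrr normr0 invr_ge0.
  by rewrite mulrC divfK ?pnatr_eq0// ltNge; apply/negP.
apply: (negligibleS sub); apply: negligible_bigcup => r.
have r0 : 0 < r.+1%:R^-1 / 2 :> R by rewrite divr_gt0 ?invr_gt0.
apply/negligibleP; last exact: diverge0.
apply: bigcapT_measurable => j; apply: bigcupT_measurable => n.
by apply: measurable_exceed => //; exact: leq_addr.
Qed.

(* Fatou passes the second moment bound on [S m - S n] to the limit in [m]. *)
Lemma limn_moment2_le n (b : R) : {ae P, forall w, cvgn (S ^~ w)} ->
  (forall m, (n <= m)%N -> \int[P]_w ((S m w - S n w) ^+ 2)%:E <= b%:E)%E ->
  (\int[P]_w ((limn (S ^~ w) - S n w) ^+ 2)%:E <= b%:E)%E.
Proof.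
move=> aecv mom.
have mSn m : measurable_fun [set: T] (fun w => ((S m w - S n w) ^+ 2)%:E).
  by apply/measurable_EFinP; apply: measurable_funX; exact: measurable_funB.
(* The shift by [n] keeps every index in the range where the moment bound is assumed. *)
pose f m w := ((S (m + n)%N w - S n w) ^+ 2)%:E.
have mf m : measurable_fun [set: T] (f m) by exact: mSn.
have f0 m (w : T) : setT w -> (0 <= f m w)%E by move=> _; rewrite lee_fin sqr_ge0.
apply: (@le_trans _ _ (\int[P]_w limn_einf (f^~ w))%E).
  rewrite le_eqVlt; apply/orP; left; apply/eqP; apply: ae_eq_integral => //.
  - apply/measurable_EFinP; apply: measurable_funX; apply: measurable_funB => //.
    exact: measurable_limn.
  - apply: measurableT_comp => //; apply: (measurable_fun_limn_esup (f := fun m w => - f m w)%E).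
    by move=> m; exact: measurableT_comp.
  apply: filterS aecv => w cw _.
  have cv : f^~ w @ \oo --> ((limn (S ^~ w) - S n w) ^+ 2)%:E.
    apply: cvg_EFin; first exact: nearW.
    rewrite /comp /f /=; apply: (@cvgM _ _ _ _ (fun m => S (m + n)%N w - S n w)).
      by apply: cvgB; [rewrite (cvg_shiftn n (S ^~ w))|exact: cvg_cst].
    by apply: cvgB; [rewrite (cvg_shiftn n (S ^~ w))|exact: cvg_cst].
  by have [-> _] := cvg_limn_einf_sup cv.
apply: le_trans (fatou P measurableT mf f0) _.
rewrite limn_einf_lim; apply: lime_le; first exact: is_cvg_einfs.
apply: nearW => m; apply: (@le_trans _ _ (\int[P]_w f m w)%E).
  by apply: ereal_inf_lbound; exists m => /=.
by apply: mom; exact: leq_addl.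
Qed.

End ae_convergence.

(** * The Hamiltonians *)

Section tuple_blocks.
Context {R : realType} (N : nat).

Lemma sum_tuple_prod (p : nat) (x : 'I_N -> R) :
  \sum_(i : p.-tuple 'I_N) \prod_(j <- i) x j = (\sum_j x j) ^+ p.
Proof.
elim: p => [|p IH].
  rewrite (big_pred1 [tuple]) ?big_nil// => i.
  by rewrite [i]tuple0; apply/esym/eqP.
rewrite (reindex (fun q : 'I_N * p.-tuple 'I_N => cons_tuple q.1 q.2)) /=; last first.
  exists (fun t => (thead t, behead_tuple t)) => [[j t] _|t _] /=.
    by rewrite theadE; congr pair; apply: val_inj.
  by case/tupleP: t => j t; apply: val_inj; rewrite /= theadE.
rewrite exprS -IH mulr_suml.
rewrite -(pair_big predT predT (fun j (t : p.-tuple 'I_N) =>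
  \prod_(k <- cons_tuple j t) x k)) /=.
by apply: eq_bigr => j _; rewrite mulr_sumr; apply: eq_bigr => t _; rewrite big_cons.
Qed.

(** Each coefficient is keyed by the index sequence of its Gaussian. Keys from blocks [p] have
    length [p], so different blocks never share a Gaussian. *)
Definition tuple_block (S : Type) (c : forall p, p.-tuple 'I_N -> S -> R) (p : nat) :
    seq (seq nat * (S -> R)) :=
  [seq ([seq nat_of_ord j | j <- tval i], c p i) | i <- enum {: p.-tuple 'I_N}].

Definition tuple_blocks (S : Type) (c : forall p, p.-tuple 'I_N -> S -> R) (m n : nat) :
    seq (seq nat * (S -> R)) :=
  flatten [seq tuple_block c p | p <- index_iota m n].

Lemma tuple_block_keys S (c : forall p, p.-tuple 'I_N -> S -> R) p t :
  t \in [seq q.1 | q <- tuple_block c p] -> size t = p.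
Proof. by rewrite -map_comp => /mapP[i _ -> /=]; rewrite size_map size_tuple. Qed.

Lemma tuple_blocks_keys S (c : forall p, p.-tuple 'I_N -> S -> R) m n t :
  t \in [seq q.1 | q <- tuple_blocks c m n] -> (m <= size t < n)%N.
Proof.
rewrite /tuple_blocks map_flatten -map_comp => /flattenP[L /mapP[p pmn ->] /=].
by move=> /tuple_block_keys ->; rewrite mem_index_iota in pmn.
Qed.

Lemma tuple_blocks_uniq S (c : forall p, p.-tuple 'I_N -> S -> R) m n :
  uniq [seq q.1 | q <- tuple_blocks c m n].
Proof.
rewrite /tuple_blocks map_flatten -map_comp.
have : uniq (index_iota m n) by exact: iota_uniq.
elim: (index_iota m n) => //= p r IH /andP[pr ur].
rewrite cat_uniq IH// andbT; apply/andP; split.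
  rewrite /tuple_block -map_comp map_inj_uniq ?enum_uniq// => i j /= ij.
  by apply: val_inj; apply: (inj_map val_inj).
apply/hasPn => t /flattenP[L /mapP[p' p'r ->] /= tL]; apply/negP => tp.
by rewrite -(tuple_block_keys tp) (tuple_block_keys tL) p'r in pr.
Qed.

Lemma sum_tuple_blocks S (c : forall p, p.-tuple 'I_N -> S -> R) m n
    (f : seq nat * (S -> R) -> R) :
  \sum_(q <- tuple_blocks c m n) f q =
  \sum_(m <= p < n) \sum_(i : p.-tuple 'I_N) f ([seq nat_of_ord j | j <- i], c p i).
Proof.
rewrite /tuple_blocks big_flatten big_map; apply: eq_bigr => p _.
by rewrite /tuple_block big_map big_enum.
Qed.

Lemma spin_sqr (s : config N) i : spin R s i * spin R s i = 1.
Proof. by rewrite /spin -expr2 sqrr_sign. Qed.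

Lemma overlap_self (s : config N) : (0 < N)%N -> overlap R s s = 1.
Proof.
move=> N0; rewrite /overlap (eq_bigr (fun=> 1)) => [|i _]; last exact: spin_sqr.
by rewrite sumr_const card_ord mulVf// pnatr_eq0 -lt0n.
Qed.

Lemma overlap_bound (s t : config N) : `|overlap R s t| <= 1.
Proof.
(* For [N = 0] the convention that the inverse of 0 is 0 makes the overlap vanish. *)
have [N0|N0] := posnP N; first by rewrite /overlap [X in X^-1](_ : _ = 0) ?N0// invr0 mul0r normr0.
rewrite /overlap normrM normfV normr_nat mulrC ler_pdivrMr ?ltr0n// mul1r.
apply: le_trans (ler_norm_sum _ _ _) _.
rewrite (eq_bigr (fun=> 1)) ?sumr_const ?card_ord// => i _.
by rewrite /spin normrM !normrX !normrN normr1 !expr1n mulr1.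
Qed.

Definition hcoef (a : 'I_2 -> nat -> R) (l : 'I_2) (s : config N) (p : nat)
    (i : p.-tuple 'I_N) : R :=
  a l p / (N%:R `^ (p%:R / 2)) * \prod_(j <- i) spin R s j.

Lemma sum_hcoefM (a : 'I_2 -> nat -> R) l l' (s s' : config N) p : (0 < N)%N ->
  \sum_(i : p.-tuple 'I_N) hcoef a l s i * hcoef a l' s' i =
  a l p * a l' p * overlap R s s' ^+ p.
Proof.
move=> N0; have NR : 0 <= (N%:R : R) by [].
have N0' : N%:R != 0 :> R by rewrite pnatr_eq0 -lt0n.
have powE : N%:R `^ (p%:R / 2) * N%:R `^ (p%:R / 2) = N%:R ^+ p :> R.
  rewrite -powRD ?N0' ?implybT//.
  by rewrite -splitr powR_mulrn.
rewrite (eq_bigr (fun i : p.-tuple 'I_N => a l p * a l' p * N%:R ^- p *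
    \prod_(j <- i) (spin R s j * spin R s' j))).
  rewrite -mulr_sumr sum_tuple_prod -mulrA /overlap exprMn exprVn.
  by [].
move=> i _; rewrite /hcoef big_split /= -powE invfM; ring.
Qed.

End tuple_blocks.

Lemma In_mem_fst (A : eqType) (B : Type) (L : seq (A * B)) q :
  List.In q L -> q.1 \in [seq q.1 | q <- L].
Proof. by elim: L => //= q' L IH [->|/IH h]; rewrite inE ?eqxx ?h ?orbT. Qed.

Section hamiltonian_series.
Context d (T : measurableType d) (R : realType) (P : probability T R).
Variables (g : seq nat -> {RV P >-> R}) (a : 'I_2 -> nat -> R).
Hypothesis gauss_g : gaussian_disorder g.
Hypothesis summable_a : forall l : 'I_2, cvgn (fun n : nat => \sum_(1 <= p < n) a l p ^+ 2).

Local Notation D := [set s : seq nat | s != [::]].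
Local Notation kap := (normal_moment2 R).

Let indep : independent_on D g. Proof. by case: gauss_g. Qed.

Let normal_g t : D t -> forall B : set R, measurable B ->
  distribution P (g t) B = normal_prob 0 1 B.
Proof. by case: gauss_g => h _ /h. Qed.

Definition hseries N (l : 'I_2) (s : config N) (n : nat) (w : T) : R :=
  \sum_(1 <= p < n) a l p / (N%:R `^ (p%:R / 2)) *
    \sum_(i : p.-tuple 'I_N)
      g [seq nat_of_ord j | j <- i] w * \prod_(j <- i) spin R s j.

(** The index set [unit] treats a single configuration, which is enough for convergence of the
    series; [pair_blocks] indexes by pairs and absorbs the factor [Num.sqrt N%:R]. *)
Definition hblocks N (l : 'I_2) (s : config N) :=
  tuple_blocks (fun p (i : p.-tuple 'I_N) (_ : unit) => hcoef a l s i).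

Definition pair_blocks N :=
  tuple_blocks (fun p (i : p.-tuple 'I_N) (r : {ffun 'I_2 -> config N}) =>
    Num.sqrt N%:R * \sum_(l < 2) hcoef a l (r l) i).

Lemma lincomb_tuple_blocks N (S : Type) (c : forall p, p.-tuple 'I_N -> S -> R) m n w s :
  lincomb g (tuple_blocks c m n) w s = \sum_(m <= p < n) \sum_(i : p.-tuple 'I_N)
    c p i s * g [seq nat_of_ord j | j <- i] w.
Proof. by rewrite /lincomb sum_tuple_blocks. Qed.

Lemma hseries_lincomb N l (s : config N) n w :
  hseries l s n w = lincomb g (hblocks l s 1 n) w tt.
Proof.
rewrite /hblocks lincomb_tuple_blocks; apply: eq_bigr => p _.
by rewrite mulr_sumr; apply: eq_bigr => i _; rewrite /hcoef; ring.
Qed.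

(** The series starts at [p = 1], so stages 0 and 1 are both empty sums; [maxn 1 m] covers the two
    cases and keeps the empty index sequence out. *)
Lemma hseriesB N l (s : config N) m n w : (m <= n)%N ->
  hseries l s n w - hseries l s m w = lincomb g (hblocks l s (maxn 1 m) n) w tt.
Proof.
move=> mn; rewrite !hseries_lincomb /hblocks !lincomb_tuple_blocks.
case: m mn => [_|m mn].
  by rewrite [X in _ - X]big_geq// subr0.
have -> : maxn 1 m.+1 = m.+1 by rewrite (maxn_idPr _).
by rewrite (@big_cat_nat _ _ _ m.+1 1 n)//= addrAC subrr add0r.
Qed.

Lemma pair_blocks_lincomb N n w (r : {ffun 'I_2 -> config N}) :
  lincomb g (pair_blocks N 1 n) w r =
  \sum_(l < 2) Num.sqrt N%:R * hseries l (r l) n w.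
Proof.
rewrite /pair_blocks lincomb_tuple_blocks.
under [RHS]eq_bigr do rewrite hseries_lincomb /hblocks lincomb_tuple_blocks mulr_sumr.
rewrite exchange_big; apply: eq_bigr => p _ /=.
under [RHS]eq_bigr do rewrite mulr_sumr.
rewrite exchange_big; apply: eq_bigr => i _ /=.
by rewrite mulr_sumr mulr_suml; apply: eq_bigr => l _; rewrite [RHS]mulrA.
Qed.

Let tuple_blocks_keysD N (S : Type) (c : forall p, p.-tuple 'I_N -> S -> R) m n :
  (0 < m)%N -> forall t, t \in [seq q.1 | q <- tuple_blocks c m n] -> D t.
Proof.
move=> m0 t /tuple_blocks_keys /andP[mt _] /=; rewrite -size_eq0 -lt0n.
exact: leq_trans mt.
Qed.

Definition sqsum l n : R := \sum_(1 <= p < n) a l p ^+ 2.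

Lemma sqsum_nondecreasing l : nondecreasing_seq (sqsum l).
Proof.
move=> m n mn; case: m mn => [_|m mn].
  by rewrite /sqsum big_geq// sumr_ge0// => p _; exact: sqr_ge0.
rewrite /sqsum (@big_cat_nat _ _ _ m.+1 1 n)//= lerDl sumr_ge0// => p _.
exact: sqr_ge0.
Qed.

Definition sqtail l n : R := limn (sqsum l) - sqsum l n.

Lemma sqtail_ge l m n : (m <= n)%N -> sqsum l n - sqsum l m <= sqtail l m.
Proof.
move=> mn; rewrite /sqtail lerD2r; apply: nondecreasing_cvgn_le.
  exact: sqsum_nondecreasing.
exact: summable_a.
Qed.

Lemma sqtail_cvg l : sqtail l @ \oo --> 0.
Proof.
rewrite -(subrr (limn (sqsum l))); apply: cvgB; first exact: cvg_cst.
exact: summable_a.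
Qed.

Lemma sqtail_le l m n : (m <= n)%N -> sqtail l n <= sqtail l m.
Proof. by move=> mn; rewrite /sqtail lerD2l lerN2; exact: sqsum_nondecreasing. Qed.

Lemma hblocks_sqr N l (s : config N) m n : (0 < N)%N -> (m <= n)%N ->
  \sum_(q <- hblocks l s (maxn 1 m) n) q.2 tt ^+ 2 = sqsum l n - sqsum l m.
Proof.
move=> N0 mn; rewrite /hblocks sum_tuple_blocks /=.
under eq_bigr => p _.
  under eq_bigr do rewrite expr2.
  rewrite sum_hcoefM// overlap_self// expr1n mulr1 -expr2.
  over.
case: m mn => [_|m mn]; first by rewrite /sqsum [X in _ - X]big_geq// subr0.
have -> : maxn 1 m.+1 = m.+1 by rewrite (maxn_idPr _).
by rewrite /sqsum (@big_cat_nat _ _ _ m.+1 1 n)//= addrAC subrr add0r.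
Qed.

Let max1 m : (0 < maxn 1 m)%N. Proof. by rewrite leq_max. Qed.

Lemma measurable_hseries N l (s : config N) n : measurable_fun [set: T] (hseries l s n).
Proof.
have := measurable_lincomb g (hblocks l s 1 n) tt.
by congr measurable_fun; apply/funext => w; rewrite hseries_lincomb.
Qed.

Lemma measurable_cyl_hseries N l (s : config N) n (E : set (seq nat)) :
  (forall t, (0 < size t < n)%N -> E t) ->
  measurable_fun [set: cyl_type g E] (hseries l s n : cyl_type g E -> R).
Proof.
move=> tE.
have LE q : List.In q (hblocks l s 1 n) -> E q.1.
  by move=> /In_mem_fst/tuple_blocks_keys; exact: tE.
have -> : hseries l s n = (fun w => lincomb g (hblocks l s 1 n) w tt).
  by apply/funext => w; rewrite hseries_lincomb.
exact: measurable_cyl_lincomb LE.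
Qed.

Lemma hseries_tail N l (s : config N) (e : R) j k n : (0 < N)%N -> 0 < e ->
  (j <= k)%N -> (k <= n)%N ->
  (P [set w | e < `|hseries l s n w - hseries l s k w|]%R <=
   (kap * sqtail l j / e ^+ 2)%:E)%E.
Proof.
move=> N0 e0 jk kn.
under eq_set do rewrite hseriesB//.
apply: le_trans (lincomb_chebyshev indep normal_g tt e0 _ _) _.
- exact: tuple_blocks_uniq.
- exact: tuple_blocks_keysD.
rewrite lee_fin ler_wpM2r ?invr_ge0 ?sqr_ge0// ler_wpM2l ?normal_moment2_ge0//.
by rewrite hblocks_sqr// (le_trans (sqtail_ge _ kn))// sqtail_le.
Qed.

Lemma hseries_moment2 N l (s : config N) m n : (0 < N)%N -> (m <= n)%N ->
  (\int[P]_w ((hseries l s n w - hseries l s m w) ^+ 2)%:E <= (kap * sqtail l m)%:E)%E.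
Proof.
move=> N0 mn.
under eq_integral do rewrite hseriesB//.
rewrite (lincomb_moment2 indep normal_g).
- by rewrite lee_fin ler_wpM2l ?normal_moment2_ge0// hblocks_sqr// sqtail_ge.
- exact: tuple_blocks_uniq.
- exact: tuple_blocks_keysD.
Qed.

(** Up to stage [k.+1] only index sequences of length at most [k] occur, and afterwards only longer
    ones: the two events live on disjoint sets of keys. *)
Lemma hseries_indep N l (s : config N) (e : R) j k n : (j <= k)%N -> (k < n)%N ->
  P (first_exceed (hseries l s) e j k `&` close_to_end (hseries l s) e k.+1 n) =
  (P (first_exceed (hseries l s) e j k) * P (close_to_end (hseries l s) e k.+1 n))%E.
Proof.
move=> jk kn.
pose E1 := [set t : seq nat | (0 < size t < k.+1)%N].
pose E2 := [set t : seq nat | (k.+1 <= size t)%N].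
have sz t : (0 < size t)%N -> t != [::] by rewrite -size_eq0 -lt0n.
apply: (@independent_sigma_cylinders _ _ _ _ _ D g indep E1 E2).
- by move=> t /= /andP[/sz].
- by move=> t /= kt; apply: sz; exact: leq_ltn_trans kt.
- by move=> t /= /andP[_ t1]; apply/negP; rewrite -ltnNge.
(* Freezing the series at stage [k.+1] makes every [S' i] measurable for the sigma-algebra of [E1],
   so the general measurability of [exceed] applies there. *)
- pose S' i (w : cyl_type g E1) := hseries l s (minn i k.+1) w.
  have mS' i : measurable_fun [set: cyl_type g E1] (S' i).
    apply: measurable_cyl_hseries => t /andP[t0 ti]; rewrite /E1 /= t0 /=.
    by rewrite (leq_trans ti)// geq_minr.
  have -> : first_exceed (hseries l s) e j k = first_exceed S' e j k.
    have mj : minn j k.+1 = j by apply/minn_idPl; exact: leqW.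
    rewrite /first_exceed /S' minnn mj; congr (~` _ `&` _).
    apply/seteqP; split => w [i [ji ik h]]; exists i; split => //; move: h;
      by rewrite /= mj (minn_idPl (leqW ik)).
  suff : measurable (first_exceed S' e j k) by [].
  apply: measurableI; last exact: measurable_dist_gt.
  by apply: measurableC; exact: measurable_exceed.
- have LE q : List.In q (hblocks l s (maxn 1 k.+1) n) -> E2 q.1.
    move=> /In_mem_fst/tuple_blocks_keys /andP[+ _].
    by rewrite (maxn_idPr _).
  have mf := measurable_cyl_lincomb tt LE.
  have -> : close_to_end (hseries l s) e k.+1 n =
      (fun w => lincomb g (hblocks l s (maxn 1 k.+1) n) w tt) @^-1` `[- e, e]%classic.
    apply/seteqP; split => w /=; rewrite /close_to_end /= hseriesB// in_itv /=.
      by rewrite ler_norml.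
    by rewrite ler_norml.
  suff : measurable ((fun w : cyl_type g E2 =>
    lincomb g (hblocks l s (maxn 1 k.+1) n) w tt) @^-1` `[- e, e]%classic) by [].
  by rewrite -[X in measurable X]setTI; exact: mf.
Qed.

Lemma ae_cvgn_hseries N l (s : config N) : (0 < N)%N ->
  {ae P, forall w, cvgn (hseries l s ^~ w)}.
Proof.
move=> N0; apply: (@ae_cvgn _ _ _ P (hseries l s) _ (fun j => kap * sqtail l j)).
- exact: measurable_hseries.
- by rewrite -(mulr0 kap); apply: cvgMr; exact: sqtail_cvg.
- by move=> e j k n; exact: hseries_tail.
- by move=> e j k n; exact: hseries_indep.
Qed.

Definition hgap N (l : 'I_2) (s : config N) (n : nat) (w : T) : R :=
  limn (hseries l s ^~ w) - hseries l s n w.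

Lemma measurable_hgap N l (s : config N) n : measurable_fun [set: T] (hgap l s n).
Proof.
apply: measurable_funB; last exact: measurable_hseries.
by apply: measurable_limn => k; exact: measurable_hseries.
Qed.

Lemma hgap_moment2 N l (s : config N) n : (0 < N)%N ->
  (\int[P]_w ((hgap l s n w) ^+ 2)%:E <= (kap * sqtail l n)%:E)%E.
Proof.
move=> N0; apply: limn_moment2_le.
- by move=> k; exact: measurable_hseries.
- exact: ae_cvgn_hseries.
- by move=> m nm; exact: hseries_moment2.
Qed.

Lemma hgap_moment1 N l (s : config N) (e : R) : (0 < N)%N -> 0 < e ->
  \forall n \near \oo, (\int[P]_w `|hgap l s n w|%:E <= e%:E)%E.
Proof.
move=> N0 e0.
have cv : (fun n => kap * sqtail l n) @ \oo --> 0.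
  by rewrite -(mulr0 kap); apply: cvgMr; exact: sqtail_cvg.
have e2 : 0 < e ^+ 2 by rewrite exprn_gt0.
move/cvgrPdist_lt : cv => /(_ _ e2) [n0 _ nh]; exists n0 => // n /= n0n.
have {nh n0n} small : kap * sqtail l n <= e ^+ 2.
  by have := nh n n0n; rewrite sub0r normrN => /(le_lt_trans (ler_norm _))/ltW.
have mg := measurable_hgap l s n.
(* Young's inequality: an error with second moment at most [e ^+ 2] has first moment at most
   [e / 2 + e / 2]. *)
apply: (@le_trans _ _ (\int[P]_w ((2 * e)^-1 * (hgap l s n w) ^+ 2 + e / 2)%:E)%E).
  apply: ge0_le_integral => //=.
  - by apply/measurable_EFinP; exact: measurableT_comp.
  - apply/measurable_EFinP; apply: measurable_funD => //; apply: measurable_funM => //.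
    exact: measurable_funX.
  move=> w _; rewrite lee_fin -subr_ge0.
  have -> : (2 * e)^-1 * hgap l s n w ^+ 2 + e / 2 - `|hgap l s n w| =
      (2 * e)^-1 * (`|hgap l s n w| - e) ^+ 2.
    by rewrite -(real_normK (num_real (hgap l s n w))); field; rewrite gt_eqF.
  by rewrite mulr_ge0 ?sqr_ge0// invr_ge0 mulr_ge0// ltW.
under eq_integral do rewrite EFinD EFinM.
have e3 : 0 <= (2 * e)^-1 by rewrite invr_ge0 mulr_ge0// ltW.
have mg2 : measurable_fun [set: T] (fun w => (hgap l s n w ^+ 2)%:E).
  by apply/measurable_EFinP; exact: measurable_funX.
rewrite ge0_integralD//; last 3 first.
- by move=> w _; rewrite mule_ge0// lee_fin// sqr_ge0.
- by apply: emeasurable_funM.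
- by move=> w _; rewrite lee_fin divr_ge0// ltW.
rewrite ge0_integralZl//; last by move=> w _; rewrite lee_fin sqr_ge0.
rewrite integral_cst// [X in (_ + _ * X)%E](_ : _ = 1%E); last exact: probability_setT.
rewrite mule1.
apply: (@le_trans _ _ ((2 * e)^-1%:E * (e ^+ 2)%:E + (e / 2)%:E)%E).
  apply: leeD => //; apply: lee_wpmul2l => //.
  by apply: le_trans (hgap_moment2 l s n N0) _; rewrite lee_fin.
rewrite -EFinM -EFinD lee_fin le_eqVlt; apply/orP; left; apply/eqP.
by field; rewrite gt_eqF.
Qed.

Lemma hamiltonianE N l (s : config N) w :
  hamiltonian g a l s w = Num.sqrt N%:R * limn (hseries l s ^~ w).
Proof. by []. Qed.

(** Log-sum-exp is 1-Lipschitz for the supremum norm, and the truncation error tends to 0 in mean;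
    this gives integrability for the full Hamiltonians as well as convergence of the truncated
    means. *)
Theorem mean_lse_hamiltonian N (Q : pred {ffun 'I_2 -> config N})
    (b : {ffun 'I_2 -> config N} -> R) r0 : (0 < N)%N -> Q r0 ->
  exists psi : R,
    (\int[P]_w (lse Q b (fun r => \sum_(l < 2) hamiltonian g a l (r l) w)%R)%:E = psi%:E)%E /\
    (fun n => gmeans [seq q.2 | q <- pair_blocks N 1 n] (lse Q b) (fun=> 0)) @ \oo --> psi.
Proof.
move=> N0 Qr0; set f := lse Q b.
have af : admissible f by exact: admissible_lse Qr0.
pose H w (r : {ffun 'I_2 -> config N}) := \sum_(l < 2) hamiltonian g a l (r l) w.
pose Hn n w := lincomb g (pair_blocks N 1 n) w.
pose J : finType := ('I_2 * config N)%type.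
(* Summing over both systems and all configurations dominates the error of every pair at once; [N]
   is fixed, so the size of the sum does not matter. *)
pose err n w : R := \sum_(x : J) Num.sqrt N%:R * `|hgap x.1 x.2 n w|.
have err0 n w : 0 <= err n w.
  by apply: sumr_ge0 => x _; rewrite mulr_ge0// sqrtr_ge0.
have merrx n (x : J) : measurable_fun [set: T] (fun w => Num.sqrt N%:R * `|hgap x.1 x.2 n w|).
  by apply: measurable_funM => //; apply: measurableT_comp => //; exact: measurable_hgap.
have merr n : measurable_fun [set: T] (err n) by exact: measurable_sum.
have HHn n w r : `|H w r - Hn n w r| <= err n w.
  rewrite /H /Hn pair_blocks_lincomb -sumrB; apply: le_trans (ler_norm_sum _ _ _) _.
  rewrite /err -(pair_big predT predT (fun l s => Num.sqrt N%:R * `|hgap l s n w|)) /=.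
  apply: ler_sum => l _; rewrite hamiltonianE -mulrBr normrM ger0_norm ?sqrtr_ge0//.
  rewrite (bigD1 (r l))//= lerDl; apply: sumr_ge0 => s _.
  by rewrite mulr_ge0// sqrtr_ge0.
have fHn n w : `|f (H w) - f (Hn n w)| <= err n w.
  have h1 : f (H w) <= f (Hn n w) + err n w.
    apply: (lse_leD _ Qr0) => r _.
    by have := HHn n w r; rewrite ler_norml => /andP[]; lra.
  have h2 : f (Hn n w) <= f (H w) + err n w.
    apply: (lse_leD _ Qr0) => r _.
    by have := HHn n w r; rewrite ler_norml => /andP[]; lra.
  by rewrite ler_norml; apply/andP; split; lra.
have mH : measurable_fun [set: T] (fun w => f (H w)).
  apply: (af.1 _ _ H) => r; apply: measurable_sum => l.
  apply: measurable_funM => //; apply: measurable_limn => k.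
  exact: measurable_hseries.
have small (e : R) : 0 < e -> \forall n \near \oo, (\int[P]_w (err n w)%:E <= e%:E)%E.
  move=> e0; pose M : R := Num.sqrt N%:R * #|J|%:R + 1.
  have M0 : 0 < M by rewrite ltr_wpDl// mulr_ge0// sqrtr_ge0.
  have eM : 0 < e / M by rewrite divr_gt0.
  have allx : \forall n \near \oo, forall x : J,
      (\int[P]_w `|hgap x.1 x.2 n w|%:E <= (e / M)%:E)%E.
    by apply: filter_forall => x; exact: hgap_moment1.
  apply: filterS allx => n nh.
  under eq_integral do rewrite /err -sumEFin.
  rewrite ge0_integral_sum//; last by move=> x; exact/measurable_EFinP.
  apply: (@le_trans _ _ (\sum_(x : J) (Num.sqrt N%:R * (e / M))%:E)%E).
    apply: lee_sum => x _; under eq_integral do rewrite EFinM.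
    rewrite ge0_integralZl//.
    - by rewrite EFinM; apply: lee_wpmul2l; [rewrite lee_fin sqrtr_ge0|exact: nh].
    - by apply/measurable_EFinP; apply: measurableT_comp => //; exact: measurable_hgap.
  rewrite sumEFin lee_fin sumr_const.
  have -> : (Num.sqrt N%:R * (e / M)) *+ #|J| = Num.sqrt N%:R * #|J|%:R * e / M.
    by rewrite -[LHS]mulr_natr; field; rewrite gt_eqF.
  rewrite ler_pdivrMr// mulrC ler_wpM2l ?(ltW e0)//.
  by rewrite /M lerDl.
have ierr : \forall n \near \oo, P.-integrable setT (EFin \o err n).
  apply: filterS (small 1 ltr01) => n nh; apply/integrableP; split.
    exact/measurable_EFinP.
  apply: (@le_lt_trans _ _ 1%:E); last by rewrite ltry.
  apply: le_trans nh; rewrite le_eqVlt; apply/orP; left; apply/eqP.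
  by apply: eq_integral => w _ /=; rewrite ger0_norm.
have main n := lincomb_gmeans indep normal_g (L := pair_blocks N 1 n)
  (tuple_blocks_uniq _ _ _) (tuple_blocks_keysD (ltn0Sn 0)) af.
have iH : P.-integrable setT (EFin \o (fun w => f (H w))).
  have [n0 _ nh] := ierr; have ie := nh n0 (leqnn n0).
  have [iHn _] := main n0.
  apply: (@le_integrable_EFin _ _ _ _ _ (fun w => `|f (Hn n0 w)| + err n0 w) mH).
    move=> w; have := fHn n0 w; have := ler_normB (f (H w)) (f (Hn n0 w)).
    have := ler_normD (f (H w) - f (Hn n0 w)) (f (Hn n0 w)); rewrite subrK.
    by move=> h1 _ h2; apply: le_trans h1 _; rewrite addrC lerD2l.
  exact: (integrableD measurableT (integrable_norm iHn) ie).
exists (\int[P]_w f (H w)); split.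
  by rewrite /Rintegral fineK//; exact: integrable_fin_num iH.
apply/cvgrPdist_le => e e0.
near=> n.
have [iHn EHn] := main n.
have -> : gmeans [seq q.2 | q <- pair_blocks N 1 n] f (fun=> 0) = \int[P]_w f (Hn n w).
  by rewrite /Rintegral EHn.
rewrite -RintegralB//.
have iB : P.-integrable setT (EFin \o (fun w => f (H w) - f (Hn n w))).
  exact: (integrableB measurableT iH iHn).
apply: le_trans (le_normr_Rintegral measurableT iB) _.
have ie : P.-integrable setT (EFin \o err n) by near: n.
apply: (@le_trans _ _ (\int[P]_w err n w)).
  by apply: le_Rintegral => //; exact: (integrable_norm iB).
rewrite -lee_fin /Rintegral fineK; last exact: integrable_fin_num ie.
by near: n; exact: small.
Unshelve. all: end_near.
Qed.

End hamiltonian_series.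

(** * The covariance functions *)

Section covariance_function.
Context {R : realType}.
Variable a : 'I_2 -> nat -> R.
Hypothesis summable_a : forall l : 'I_2, cvgn (fun n : nat => \sum_(1 <= p < n) a l p ^+ 2).

Definition xi_part (l l' : 'I_2) (n : nat) (x : R) : R :=
  \sum_(1 <= p < n) a l p * a l' p * x ^+ p.

(* Common majorant: [|a l p * a l' p| <= \sum_l a l p ^ 2] for all [l, l']. *)
Definition majorant (n : nat) : R := \sum_(1 <= p < n) \sum_(l < 2) a l p ^+ 2.

Lemma majorant_cvg : cvgn majorant.
Proof.
have -> : majorant = (fun n => \sum_(l < 2) \sum_(1 <= p < n) a l p ^+ 2).
  by apply/funext => n; rewrite /majorant exchange_big.
apply/cvg_ex; exists (\sum_(l < 2) limn (fun n : nat => \sum_(1 <= p < n) a l p ^+ 2)).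
have -> : (fun n => \sum_(l < 2) \sum_(1 <= p < n) a l p ^+ 2) =
    (fun n => (\sum_(1 <= p < n) a ord0 p ^+ 2) + \sum_(1 <= p < n) a ord_max p ^+ 2).
  apply/funext => n; rewrite big_ord_recl big_ord1; congr (_ + _).
  by apply: eq_bigr => p _; congr (a _ _ ^+ 2); apply: val_inj.
rewrite big_ord_recl big_ord1 (_ : lift _ _ = ord_max); last exact: val_inj.
by apply: cvgD; exact: summable_a.
Qed.

Lemma majorant_nondecreasing : nondecreasing_seq majorant.
Proof.
move=> m n mn; have w0 p : 0 <= \sum_(l < 2) a l p ^+ 2.
  by apply: sumr_ge0 => l _; exact: sqr_ge0.
case: m mn => [_|m mn]; first by rewrite /majorant [leLHS]big_geq// sumr_ge0.
by rewrite /majorant (@big_cat_nat _ _ _ m.+1 1 n)//= lerDl sumr_ge0.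
Qed.

Lemma majorant_le n : majorant n <= limn majorant.
Proof.
apply: nondecreasing_cvgn_le; [exact: majorant_nondecreasing|exact: majorant_cvg].
Qed.

Lemma coef_le l l' p : `|a l p * a l' p| <= \sum_(k < 2) a k p ^+ 2.
Proof.
have h k : a k p ^+ 2 <= \sum_(k < 2) a k p ^+ 2.
  by rewrite (bigD1 k)//= lerDl sumr_ge0// => j _; exact: sqr_ge0.
have := h l; have := h l'; set W := \sum_(k < 2) _ => h1 h2.
have := sqr_ge0 (a l p - a l' p); have := sqr_ge0 (a l p + a l' p).
by rewrite ler_norml => h3 h4; apply/andP; split; lra.
Qed.

Lemma xi_partB l l' m n x : `|x| <= 1 -> (m <= n)%N ->
  `|xi_part l l' n x - xi_part l l' m x| <= majorant n - majorant m.
Proof.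
move=> x1; case: m => [_|m mn].
  rewrite /xi_part /majorant [X in `|_ - X|]big_geq// [X in _ <= _ - X]big_geq// !subr0.
  apply: le_trans (ler_norm_sum _ _ _) _; apply: ler_sum => p _.
  by rewrite normrM -[leRHS]mulr1 ler_pM// ?coef_le// normrX exprn_ile1.
rewrite /xi_part /majorant !(@big_cat_nat _ _ _ m.+1 1 n)//= !(addrAC _ _ (- _)) !subrr !add0r.
apply: le_trans (ler_norm_sum _ _ _) _; apply: ler_sum => p _.
by rewrite normrM -[leRHS]mulr1 ler_pM// ?coef_le// normrX exprn_ile1.
Qed.

Lemma xi_part_cvg l l' x : `|x| <= 1 -> xi_part l l' ^~ x @ \oo --> xi a l l' x.
Proof.
move=> x1; suff : cvgn (xi_part l l' ^~ x) by [].
apply/cvgn_incrP => r.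
have /cvgn_incrP/(_ r)[j jh] := majorant_cvg; exists j => k jk.
by rewrite (le_trans (xi_partB _ _ x1 jk))// (le_trans (ler_norm _))// jh.
Qed.

Lemma xi_tail l l' m x : `|x| <= 1 ->
  `|xi a l l' x - xi_part l l' m x| <= limn majorant - majorant m.
Proof.
move=> x1.
have cv : (fun n => `|xi_part l l' n x - xi_part l l' m x|) @ \oo -->
    `|xi a l l' x - xi_part l l' m x|.
  by apply: cvg_norm; apply: cvgB; [exact: xi_part_cvg|exact: cvg_cst].
rewrite -(cvg_lim _ cv)//; apply: limr_le; first by apply/cvg_ex; eexists; exact: cv.
exists m => // n /= mn; rewrite (le_trans (xi_partB _ _ x1 mn))//.
by rewrite lerD2r majorant_le.
Qed.

Lemma xi_bound l l' x : `|x| <= 1 -> `|xi a l l' x| <= limn majorant.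
Proof.
move=> x1; have := xi_tail l l' 0 x1.
by rewrite /xi_part /majorant !big_geq// !subr0.
Qed.

Lemma xiC l l' x : xi a l l' x = xi a l' l x.
Proof.
rewrite /xi; congr (limn _); apply/funext => n; apply: eq_bigr => p _.
by rewrite [a l p * _]mulrC.
Qed.

Lemma expB_le (x y : R) p : `|x| <= 1 -> `|y| <= 1 ->
  `|x ^+ p - y ^+ p| <= p%:R * `|x - y|.
Proof.
move=> x1 y1; elim: p => [|p IH]; first by rewrite subrr normr0 mul0r.
have -> : x ^+ p.+1 - y ^+ p.+1 = x * (x ^+ p - y ^+ p) + (x - y) * y ^+ p.
  by rewrite !exprS; ring.
rewrite (le_trans (ler_normD _ _))// -natr1 [leRHS]mulrDl mul1r !normrM lerD//.
  by rewrite (le_trans _ IH)// ler_piMl.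
by rewrite ler_piMr// normrX exprn_ile1.
Qed.

(** Weierstrass: two tails and one polynomial increment, each at most [e / 3]. The common majorant
    makes [del] independent of [l] and [l']. *)
Lemma xi_unif_continuous (e : R) : 0 < e -> exists2 del : R, 0 < del &
  forall l l' x y, `|x| <= 1 -> `|y| <= 1 -> `|x - y| <= del ->
    `|xi a l l' x - xi a l l' y| <= e.
Proof.
move=> e0.
have [m mh] : exists m, limn majorant - majorant m <= e / 3.
  have e3 : 0 < e / 3 by rewrite divr_gt0.
  have /cvgrPdist_le/(_ _ e3)[m _ mh] := majorant_cvg.
  by exists m; rewrite (le_trans (ler_norm _))// mh /=.
have M0 : 0 <= majorant m.
  by have := majorant_nondecreasing (leq0n m); rewrite {1}/majorant big_geq.
(* [m%:R * majorant m] is a Lipschitz constant on [[-1, 1]] for all truncations at [m]; the added 1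
   keeps [K] positive. *)
pose K : R := m%:R * majorant m + 1.
have K0 : 0 < K by rewrite ltr_wpDl// mulr_ge0.
exists (e / 3 / K) => [|l l' x y x1 y1 xy]; first by rewrite !divr_gt0.
have mid : `|xi_part l l' m x - xi_part l l' m y| <= e / 3.
  apply: (@le_trans _ _ (m%:R * majorant m * `|x - y|)).
    rewrite /xi_part -sumrB; apply: le_trans (ler_norm_sum _ _ _) _.
    rewrite /majorant mulr_sumr mulr_suml; apply: ler_sum_nat => p /andP[_ pm].
    rewrite -mulrBr normrM [m%:R * _]mulrC -mulrA ler_pM// ?coef_le//.
    by rewrite (le_trans (expB_le p x1 y1))// ler_wpM2r// ler_nat ltnW.
  apply: (@le_trans _ _ (K * `|x - y|)).
    by rewrite ler_wpM2r// lerDl.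
  by rewrite mulrC -ler_pdivlMr.
have t1 := xi_tail l l' m x1; have t2 := xi_tail l l' m y1.
have -> : xi a l l' x - xi a l l' y = (xi a l l' x - xi_part l l' m x) +
   (xi_part l l' m x - xi_part l l' m y) - (xi a l l' y - xi_part l l' m y) by ring.
rewrite (le_trans (ler_normB _ _))//.
have := ler_normD (xi a l l' x - xi_part l l' m x) (xi_part l l' m x - xi_part l l' m y).
lra.
Qed.

End covariance_function.

Lemma convex_functionP (R : realType) (f : R -> R) (t x y : R) :
  convex_function (`[-1, 1]%classic : set R) f -> 0 <= t <= 1 ->
  `|x| <= 1 -> `|y| <= 1 -> f (t * x + (1 - t) * y) <= t * f x + (1 - t) * f y.
Proof.
move=> cf t01 x1 y1.
have inI z : `|z| <= 1 -> z \in (`[-1, 1]%classic : set R).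
  by rewrite inE /= in_itv /= -ler_norml.
have := cf (Itv01 (proj1 (andP t01)) (proj2 (andP t01))) x y (inI _ x1) (inI _ y1).
by rewrite /= !convRE.
Qed.

Lemma cvgn_sum (R : realType) (I : Type) (r : seq I) (u : I -> nat -> R) (l : I -> R) :
  (forall i, u i @ \oo --> l i) ->
  (fun n => \sum_(i <- r) u i n) @ \oo --> \sum_(i <- r) l i.
Proof.
move=> ul; elim: r => [|i r IH].
  by under eq_fun do rewrite big_nil; rewrite big_nil; exact: cvg_cst.
by under eq_fun do rewrite big_cons; rewrite big_cons; exact: cvgD.
Qed.

(** * Comparison of systems with infinitely many Gaussians *)

Section comparison_limits.
Context {R : realType} {S : finType}.
Local Notation kap := (normal_moment2 R).

(** Only the limits of the squared distances are compared. Since [S] is finite, one rank serves all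
    pairs of points, at the price of [eps]. *)
Lemma compare_near (bs cs : nat -> seq (S -> R)) (Del : S -> S -> R) (Q : pred S)
    (b : S -> R) s0 (e eps : R) x : Q s0 -> 0 < eps ->
  (forall s t, (fun n => sqdist (bs n) s t - sqdist (cs n) s t) @ \oo --> Del s t) ->
  (forall s t, Q s -> Q t -> Del s t <= 4 * e) ->
  \forall n \near \oo, gmeans (bs n) (lse Q b) x <= gmeans (cs n) (lse Q b) x + kap * (e + eps).
Proof.
move=> Qs0 eps0 cv De.
have near_all : \forall n \near \oo, forall st : S * S,
    sqdist (bs n) st.1 st.2 - sqdist (cs n) st.1 st.2 <= Del st.1 st.2 + 4 * eps.
  apply: filter_forall => -[s t] /=.
  have e4 : 0 < 4 * eps by rewrite mulr_gt0.
  have /cvgrPdist_le/(_ _ e4) := cv s t; apply: filterS => n.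
  by rewrite ler_norml => /andP[]; lra.
apply: filterS near_all => n nh; apply: (gmeans_lse_le b x Qs0) => s t Qs Qt.
by have := nh (s, t); have := De s t Qs Qt; rewrite /=; lra.
Qed.

Lemma cvgn_le_near (u v : nat -> R) (bu bv c k : R) : 0 <= k ->
  u @ \oo --> bu -> v @ \oo --> bv ->
  (forall eps, 0 < eps -> \forall n \near \oo, u n <= v n + c + k * eps) ->
  bu <= bv + c.
Proof.
move=> k0 ubu vbv H; rewrite leNgt; apply/negP => lt.
pose gap := bu - (bv + c); have gap0 : 0 < gap by rewrite subr_gt0.
(* Three errors, each at most [gap / 4], cannot fill the gap. *)
pose eps := gap / (4 * (k + 1)).
have k1 : 0 < k + 1 by rewrite ltr_wpDl.
have eps0 : 0 < eps by rewrite divr_gt0// mulr_gt0.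
have keps : k * eps <= gap / 4.
  have -> : gap / 4 = (k + 1) * eps by rewrite /eps; field; rewrite gt_eqF.
  by rewrite ler_wpM2r ?(ltW eps0)// lerDl.
have g4 : 0 < gap / 4 by rewrite divr_gt0.
have [n [un [vn hn]]] : exists n, `|bu - u n| <= gap / 4 /\ `|bv - v n| <= gap / 4 /\
    u n <= v n + c + k * eps.
  have /cvgrPdist_le/(_ _ g4) h1 := ubu; have /cvgrPdist_le/(_ _ g4) h2 := vbv.
  near \oo => n; exists n; split; first by near: n.
  by split; near: n => //; exact: H.
move: un vn; rewrite !ler_norml => /andP[_ u1] /andP[v1 _].
by rewrite /gap in u1 v1 keps gap0; lra.
Unshelve. all: end_near.
Qed.

End comparison_limits.

Section pair_model.
Context {R : realType}.
Variable a : 'I_2 -> nat -> R.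
Hypothesis summable_a : forall l : 'I_2, cvgn (fun n : nat => \sum_(1 <= p < n) a l p ^+ 2).
Local Notation pair N := {ffun 'I_2 -> config N}.

Definition pair_cov N (r r' : pair N) : R :=
  N%:R * \sum_(l < 2) \sum_(l' < 2) xi a l l' (overlap R (r l) (r' l')).

(** The canonical squared distance of the Gaussian field given by the total energy of a pair, up to
    the factor [normal_moment2 R]. *)
Definition pair_dist N (r r' : pair N) : R :=
  pair_cov r r + pair_cov r' r' - 2 * pair_cov r r'.

Lemma pair_cov_part N n (r r' : pair N) : (0 < N)%N ->
  \sum_(c <- [seq q.2 | q <- pair_blocks a N 1 n]) c r * c r' =
  N%:R * \sum_(l < 2) \sum_(l' < 2) xi_part a l l' n (overlap R (r l) (r' l')).
Proof.
move=> N0; rewrite big_map /pair_blocks sum_tuple_blocks /=.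
have sq : Num.sqrt N%:R * Num.sqrt N%:R = N%:R :> R by rewrite -expr2 sqr_sqrtr.
transitivity (\sum_(1 <= p < n) N%:R * \sum_(l < 2) \sum_(l' < 2)
    (a l p * a l' p * overlap R (r l) (r' l') ^+ p)).
  apply: eq_bigr => p _.
  rewrite (eq_bigr (fun i : p.-tuple 'I_N => N%:R * \sum_(l < 2) \sum_(l' < 2)
      hcoef a l (r l) i * hcoef a l' (r' l') i)); last first.
    by move=> i _; rewrite mulrACA sq big_distrlr.
  rewrite -mulr_sumr exchange_big /=; congr (_ * _); apply: eq_bigr => l _.
  by rewrite exchange_big /=; apply: eq_bigr => l' _; rewrite sum_hcoefM.
rewrite -mulr_sumr exchange_big /=; congr (_ * _); apply: eq_bigr => l _.
by rewrite exchange_big.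
Qed.

Lemma sqdist_cov (S : Type) (cs : seq (S -> R)) s t : sqdist cs s t =
  (\sum_(c <- cs) c s * c s) + (\sum_(c <- cs) c t * c t) - 2 * \sum_(c <- cs) c s * c t.
Proof.
rewrite /sqdist mulr_sumr -big_split -sumrB; apply: eq_bigr => c _ /=; ring.
Qed.

Lemma pair_dist_cvg N (r r' : pair N) : (0 < N)%N ->
  (fun n => sqdist [seq q.2 | q <- pair_blocks a N 1 n] r r') @ \oo --> pair_dist r r'.
Proof.
move=> N0.
have cv (s t : pair N) : (fun n => \sum_(c <- [seq q.2 | q <- pair_blocks a N 1 n]) c s * c t)
    @ \oo --> pair_cov s t.
  have -> : (fun n => \sum_(c <- [seq q.2 | q <- pair_blocks a N 1 n]) c s * c t) =
    (fun n => N%:R * \sum_(l < 2) \sum_(l' < 2) xi_part a l l' n (overlap R (s l) (t l'))).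
    by apply/funext => n; exact: pair_cov_part.
  apply: cvgMr; apply: cvgn_sum => l; apply: cvgn_sum => l'.
  by apply: xi_part_cvg => //; exact: overlap_bound.
have -> : (fun n => sqdist [seq q.2 | q <- pair_blocks a N 1 n] r r') =
   (fun n => (\sum_(c <- [seq q.2 | q <- pair_blocks a N 1 n]) c r * c r) +
     (\sum_(c <- [seq q.2 | q <- pair_blocks a N 1 n]) c r' * c r') -
     2 * \sum_(c <- [seq q.2 | q <- pair_blocks a N 1 n]) c r * c r').
  by apply/funext => n; exact: sqdist_cov.
have cv2 : (fun n => 2 * \sum_(c <- [seq q.2 | q <- pair_blocks a N 1 n]) c r * c r')
    @ \oo --> 2 * pair_cov r r' by apply: cvgMr; exact: cv.
exact: (cvgB (cvgD (cv r r) (cv r' r')) cv2).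
Qed.

End pair_model.

(** * Constrained pairs of configurations *)

Section overlap_combinatorics.
Context {R : realType} {N : nat}.
Implicit Types (s t : config N) (A J : {set 'I_N}).

Definition ndiff s t : nat := #|[set i | s i != t i]%SET|.

Lemma ndiff_le s t : (ndiff s t <= N)%N.
Proof. by rewrite -[leqRHS](card_ord N) max_card. Qed.

Lemma ndiff_sum s t : ndiff s t = (\sum_(i < N) (s i != t i))%N.
Proof.
rewrite /ndiff -sum1_card [LHS]big_mkcond; apply: eq_bigr => i _.
by rewrite inE; case: (s i != t i).
Qed.

Lemma ndiff_self s : ndiff s s = 0%N.
Proof. by rewrite ndiff_sum big1// => i _; rewrite eqxx. Qed.

Lemma spin_dist s t i : `|spin R s i - spin R t i| = 2 * (s i != t i)%:R.
Proof.
rewrite /spin; case: (s i); case: (t i); rewrite /= ?expr1 ?expr0 ?subrr ?normr0 ?mulr0//.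
  by rewrite -opprD normrN mulr1 ger0_norm.
by rewrite opprK mulr1 ger0_norm.
Qed.

Lemma overlap_ndiff s t : (0 < N)%N ->
  overlap R s t = 1 - 2 * (ndiff s t)%:R / N%:R.
Proof.
move=> N0; have Nn : N%:R != 0 :> R by rewrite pnatr_eq0 -lt0n.
rewrite /overlap (eq_bigr (fun i => 1 - 2 * (s i != t i)%:R)); last first.
  move=> i _; rewrite /spin; case: (s i); case: (t i) => /=;
    rewrite ?expr1 ?expr0 ?mulr0 ?mulr1 ?subr0 ?mulrNN ?mulN1r ?mul1r//; lra.
rewrite sumrB sumr_const card_ord -mulr_sumr ndiff_sum natr_sum.
by field.
Qed.

Lemma overlap_dist s t s' t' : (0 < N)%N ->
  `|overlap R s t - overlap R s' t'| <= 2 * ((ndiff s s')%:R + (ndiff t t')%:R) / N%:R.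
Proof.
move=> N0; have Nn : 0 < N%:R :> R by rewrite ltr0n.
rewrite /overlap -mulrBr normrM normfV normr_nat mulrC ler_wpM2r ?invr_ge0//.
rewrite -sumrB; apply: le_trans (ler_norm_sum _ _ _) _.
rewrite !ndiff_sum !natr_sum -big_split mulr_sumr; apply: ler_sum => i _ /=.
have n1 (u : config N) : `|spin R u i| = 1 by rewrite /spin normrX normrN normr1 expr1n.
have -> : spin R s i * spin R t i - spin R s' i * spin R t' i =
  (spin R s i - spin R s' i) * spin R t i + spin R s' i * (spin R t i - spin R t' i) by ring.
rewrite (le_trans (ler_normD _ _))// !normrM !n1 mulr1 mul1r !spin_dist.
by rewrite mulrDr.
Qed.

Definition flip J t : config N := [ffun i => t i (+) (i \in J)].

Lemma flipK J : involutive (flip J).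
Proof. by move=> t; apply/ffunP => i; rewrite !ffunE -addbA addbb addbF. Qed.

Lemma ndiff_flip J t : ndiff t (flip J t) = #|J|.
Proof.
apply: eq_card => i; rewrite inE ffunE -{1}[t i]addbF.
by rewrite (inj_eq (@addbI (t i))) eq_sym; case: (i \in J).
Qed.

Lemma ndiff_flip_sub J s t : J \subset [set i | s i != t i]%SET ->
  ndiff s (flip J t) = (ndiff s t - #|J|)%N.
Proof.
move=> Jd; rewrite /ndiff -cardsDS//; apply: eq_card => i; rewrite !inE ffunE.
have := fintype.subsetP Jd i; rewrite inE.
by case: (i \in J) => [/(_ isT)|_]; case: (s i); case: (t i).
Qed.

Lemma ndiff_flip_add J s t : J \subset ~: [set i | s i != t i]%SET ->
  ndiff s (flip J t) = (ndiff s t + #|J|)%N.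
Proof.
move=> Jd; have JC i : i \in J -> s i = t i.
  by move=> /(fintype.subsetP Jd); rewrite !inE negbK => /eqP.
rewrite /ndiff -(cardsID J [set i | s i != flip J t i]%SET) addnC.
congr (_ + _)%N; apply: eq_card => i; rewrite !inE ffunE.
  have [iJ|iJ] /= := boolP (i \in J); last by rewrite addbF.
  by rewrite (JC i iJ) eqxx.
have [iJ|iJ] := boolP (i \in J); last by rewrite andbF.
by rewrite (JC i iJ) andbT; case: (t i).
Qed.

(** Taking sites in enumeration order makes the flipped set a function of the pair. *)
Definition first_sites (A : {set 'I_N}) (j : nat) : {set 'I_N} :=
  [set i in take j (enum A)]%SET.

Lemma first_sites_sub A j : first_sites A j \subset A.
Proof. by apply/fintype.subsetP => i; rewrite inE => /mem_take; rewrite mem_enum. Qed.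

Lemma card_first_sites A j : (j <= #|A|)%N -> #|first_sites A j| = j.
Proof.
move=> jA; rewrite cardsE (card_uniqP _) ?take_uniq ?enum_uniq//.
by rewrite size_takel// -cardE.
Qed.

End overlap_combinatorics.

Section overlap_split.
Context {R : realType} {N1 N2 : nat}.

Definition left_part (s : config (N1 + N2)) : config N1 := [ffun i => s (lshift N2 i)].
Definition right_part (s : config (N1 + N2)) : config N2 := [ffun i => s (rshift N1 i)].
Definition join_config (s : config N1) (t : config N2) : config (N1 + N2) :=
  [ffun i => match fintype.split i with inl j => s j | inr j => t j end].

Lemma left_part_join s t : left_part (join_config s t) = s.
Proof. by apply/ffunP => i; rewrite !ffunE (fintype.unsplitK (inl i)). Qed.

Lemma right_part_join s t : right_part (join_config s t) = t.
Proof. by apply/ffunP => i; rewrite !ffunE (fintype.unsplitK (inr i)). Qed.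

Lemma join_parts s : join_config (left_part s) (right_part s) = s.
Proof.
apply/ffunP => i; rewrite ffunE -[in RHS](fintype.splitK i).
by case: (fintype.split i) => j; rewrite ffunE.
Qed.

Lemma ndiff_split s t :
  ndiff s t = (ndiff (left_part s) (left_part t) + ndiff (right_part s) (right_part t))%N.
Proof.
rewrite !ndiff_sum big_split_ord; congr (_ + _)%N; apply: eq_bigr => i _;
  by rewrite !ffunE.
Qed.

Lemma overlap_split s t : (0 < N1)%N -> (0 < N2)%N ->
  (N1 + N2)%:R * overlap R s t =
  N1%:R * overlap R (left_part s) (left_part t) + N2%:R * overlap R (right_part s) (right_part t).
Proof.
move=> N10 N20; have nz n : (0 < n)%N -> n%:R != 0 :> R by rewrite pnatr_eq0 -lt0n.
rewrite /overlap !mulVKf ?nz ?addn_gt0 ?N10//.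
by rewrite big_split_ord; congr (_ + _); apply: eq_bigr => i _; rewrite /spin !ffunE.
Qed.

Lemma sum_spin_split s : \sum_(i < N1 + N2) spin R s i =
  \sum_(i < N1) spin R (left_part s) i + \sum_(i < N2) spin R (right_part s) i.
Proof.
by rewrite big_split_ord; congr (_ + _); apply: eq_bigr => i _; rewrite /spin !ffunE.
Qed.

End overlap_split.

(** One term of the binomial formula gives ['C(n, j) * x ^+ j <= (1 + x) ^+ n <= expR (n * x)]. The
    free parameter [x] makes the first term small, and a small [j / n] then controls the second. *)
Lemma ln_bin_le (R : realType) (n j : nat) (x : R) : 0 < x -> (j <= n)%N ->
  ln ('C(n, j)%:R) <= n%:R * x + j%:R * ln x^-1.
Proof.
move=> x0 jn; have b0 : 0 < 'C(n, j)%:R :> R by rewrite ltr0n bin_gt0.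
have xj : 0 < x ^+ j by rewrite exprn_gt0.
have -> : j%:R * ln x^-1 = - ln (x ^+ j).
  by rewrite lnXn// lnV ?posrE// mulrN mulr_natl.
rewrite lerBrDr -lnM ?posrE//.
rewrite -ler_expR lnK ?posrE ?mulr_gt0//.
apply: (@le_trans _ _ ((1 + x) ^+ n)).
  rewrite exprDn (bigD1 (Ordinal (jn : (j < n.+1)%N)))//=.
  rewrite expr1n mul1r mulr_natl lerDl sumr_ge0// => i _.
  by rewrite expr1n mul1r mulrn_wge0// exprn_ge0// ltW.
rewrite expRM_natl lerXn2r ?nnegrE ?expR_ge0//; first by rewrite addr_ge0// ltW.
exact: expR_ge1Dx.
Qed.

Lemma sum_ord2 (V : nmodType) (F : 'I_2 -> V) : \sum_(l < 2) F l = F 0 + F 1.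
Proof. by rewrite big_ord_recl big_ord1; congr (F _ + F _); apply: val_inj. Qed.

Lemma lse_pred_le (R : realType) (S : finType) (Q Q' : pred S) (b x : S -> R) s0 :
  Q s0 -> (forall s, Q s -> Q' s) -> lse Q b x <= lse Q' b x.
Proof.
move=> Qs0 QQ'; rewrite ler_ln ?posrE; try exact: sum_expR_gt0 Qs0.
  rewrite [leRHS](bigID Q)/= [X in X + _](eq_bigl Q); last first.
    by move=> s /=; exact/andb_idl/QQ'.
  by rewrite lerDl; apply: sumr_ge0 => s _; exact: expR_ge0.
exact: sum_expR_gt0 (QQ' _ Qs0).
Qed.

(** Grouping by the value of [f], each fibre contributes at most [M] copies of the term of its
    image, whatever the field [x]; [B] pays for the change of [b]. *)
Lemma lse_fiber_le (R : realType) (S : finType) (Q Q' : pred S) (f : S -> S)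
    (b x : S -> R) s0 (M : nat) (B : R) : Q s0 ->
  (forall s, Q s -> Q' (f s)) -> (forall s, Q s -> b s <= b (f s) + B) ->
  (forall t, (#|[pred s | Q s && (f s == t)]| <= M)%N) ->
  lse Q b (x \o f) <= lse Q' b x + (B + ln M%:R).
Proof.
move=> Qs0 Qf bB fib.
have M0 : 0 < M%:R :> R.
  rewrite ltr0n (leq_trans _ (fib (f s0)))//; apply/card_gt0P; exists s0.
  by rewrite inE Qs0 eqxx.
have Z0 := sum_expR_gt0 (fun t => b t + x t) (Qf _ Qs0).
rewrite /lse addrA -[B]expRK -!lnM ?posrE ?mulr_gt0 ?expR_gt0//.
rewrite ler_ln ?posrE ?mulr_gt0 ?expR_gt0//; last exact: sum_expR_gt0 Qs0.
rewrite (partition_big f Q')//= !mulr_suml; apply: ler_sum => t _.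
apply: (@le_trans _ _ (\sum_(s | Q s && (f s == t)) expR (b t + x t) * expR B)).
  apply: ler_sum => s /andP[Qs /eqP <-].
  by rewrite -expRD ler_expR addrAC lerD2r bB.
rewrite sumr_const -[leLHS]mulr_natr ler_wpM2l ?mulr_ge0 ?expR_ge0// ler_nat.
by rewrite (leq_trans _ (fib t)).
Qed.

Section constrained_pairs.
Context {R : realType}.
Variables (a : 'I_2 -> nat -> R) (h : 'I_2 -> R).
Hypothesis summable_a : forall l : 'I_2, cvgn (fun n : nat => \sum_(1 <= p < n) a l p ^+ 2).
Hypothesis convex_xi : forall l l' : 'I_2,
  convex_function (`[-1, 1]%classic : set R) (xi a l l').
Local Notation pair N := {ffun 'I_2 -> config N}.
Local Notation kap := (normal_moment2 R).

Definition at_diff N (q : nat) : pred (pair N) := fun r => ndiff (r 0) (r 1) == q.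

Definition external_field N (r : pair N) : R := \sum_(l < 2) h l * \sum_(i < N) spin R (r l) i.

Definition truncated_mean N q n : R :=
  gmeans [seq c.2 | c <- pair_blocks a N 1 n] (lse (at_diff q) (@external_field N)) (fun=> 0).

Definition make_pair N (s t : config N) : pair N := [ffun l => if l == 0 then s else t].

Lemma at_diff_ex N q : (q <= N)%N -> exists r : pair N, at_diff q r.
Proof.
move=> qN; exists (make_pair [ffun=> false] (flip (first_sites [set: 'I_N]%SET q) [ffun=> false])).
rewrite /at_diff !ffunE /= ndiff_flip card_first_sites//.
by rewrite cardsT card_ord.
Qed.

(** The overlap of two configurations that differ at [q] of the [N] sites. *)
Definition disagree (N q : nat) : R := 1 - 2 * q%:R / N%:R.

Lemma disagree_bound N q : (0 < N)%N -> (q <= N)%N -> `|disagree N q| <= 1.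
Proof.
move=> N0 qN; have Nr : 0 < N%:R :> R by rewrite ltr0n.
have : 0 <= q%:R / N%:R :> R /\ q%:R / N%:R <= 1 :> R.
  by rewrite divr_ge0// ler_pdivrMr// mul1r ler_nat.
by rewrite /disagree ler_norml -!mulrA => -[h1 h2]; apply/andP; split; lra.
Qed.

Lemma pair_cov_diag N q (r : pair N) : (0 < N)%N -> at_diff q r ->
  pair_cov a r r = N%:R * (xi a 0 0 1 + xi a 1 1 1 + 2 * xi a 0 1 (disagree N q)).
Proof.
move=> N0 /eqP rq; rewrite /pair_cov; congr (_ * _).
rewrite !sum_ord2 !overlap_self// [xi a 1 0 _]xiC.
have -> : overlap R (r 1) (r 0) = overlap R (r 0) (r 1).
  by congr (_ * _); apply: eq_bigr => i _; rewrite mulrC.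
by rewrite overlap_ndiff// rq -/(disagree N q); ring.
Qed.

Lemma pair_cov_bound N (r r' : pair N) :
  `|pair_cov a r r'| <= N%:R * (4 * limn (majorant a)).
Proof.
rewrite /pair_cov normrM ger0_norm// ler_wpM2l//.
rewrite (eq_bigr (fun l => \sum_(l' < 2) xi a l l' (overlap R (r l) (r' l'))))//.
apply: le_trans (ler_norm_sum _ _ _) _.
apply: (@le_trans _ _ (\sum_(l < 2) \sum_(l' < 2) limn (majorant a))).
  apply: ler_sum => l _; apply: le_trans (ler_norm_sum _ _ _) _.
  apply: ler_sum => l' _; apply: xi_bound => //; exact: overlap_bound.
by rewrite !sum_ord2; lra.
Qed.

Variable psi : nat -> nat -> R.
Hypothesis psi_cvg : forall N q, (0 < N)%N -> (q <= N)%N -> truncated_mean N q @ \oo --> psi N q.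

(** Comparison with the system without disorder, the empty list of directions. The squared distances
    are at most four times the covariance bound, and without disorder there remain the [4 ^ N] pairs
    and the external field. *)
Lemma mean_lse_upper : exists K : R, forall N q, (0 < N)%N -> (q <= N)%N -> psi N q <= N%:R * K.
Proof.
pose M := limn (majorant a).
pose K : R := 2 * ln 2 + (`|h 0| + `|h 1|) + kap * (4 * M).
exists K => N q N0 qN; have [r0 Qr0] := at_diff_ex qN.
have Kh : lse (at_diff q) (@external_field N) (fun=> 0) <= N%:R * (2 * ln 2 + (`|h 0| + `|h 1|)).
  have fb (r : pair N) : external_field r <= N%:R * (`|h 0| + `|h 1|).
    have sb (s : config N) : `|\sum_(i < N) spin R s i| <= N%:R.
      apply: le_trans (ler_norm_sum _ _ _) _.
      rewrite (eq_bigr (fun=> 1)) ?sumr_const ?card_ord// => i _.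
      by rewrite /spin normrX normrN normr1 expr1n.
    have hb l s : h l * \sum_(i < N) spin R s i <= N%:R * `|h l|.
      by rewrite (le_trans (ler_norm _))// normrM mulrC ler_wpM2r.
    by rewrite /external_field sum_ord2 mulrDr lerD.
  rewrite -ler_expR lnK ?posrE; last exact: sum_expR_gt0 Qr0.
  rewrite mulrDr expRD.
  have -> : expR (N%:R * (2 * ln 2)) = #|{: pair N}|%:R :> R.
    rewrite !card_ffun !card_ord card_bool mulrA -natrM -expnM mulnC.
    rewrite expRM_natl lnK ?posrE// natrX mulnC.
    by [].
  apply: (@le_trans _ _ (\sum_(r : pair N | at_diff q r) expR (N%:R * (`|h 0| + `|h 1|)))).
    by apply: ler_sum => r _; rewrite ler_expR addr0 fb.
  rewrite sumr_const -[leLHS]mulr_natl ler_wpM2r ?expR_ge0// ler_nat.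
  exact: max_card.
set L := lse _ _ _ in Kh.
suff H : psi N q <= L + kap * (N%:R * (4 * M)).
  apply: le_trans H _; rewrite /K mulrDr lerD//.
  by rewrite mulrCA.
have cL : (fun=> L : R) @ \oo --> L by exact: cvg_cst.
apply: (@cvgn_le_near R (truncated_mean N q) (fun=> L) (psi N q) L _ kap) => //.
- exact: normal_moment2_ge0.
- exact: psi_cvg.
move=> eps eps0.
have := @compare_near R _ (fun n => [seq c.2 | c <- pair_blocks a N 1 n]) (fun=> [::])
   (@pair_dist R a N) (at_diff q) (@external_field N) r0 (N%:R * (4 * M)) eps (fun=> 0) Qr0 eps0.
rewrite /= => H2; apply: filterS (H2 _ _) => [n|s t|s t _ _].
- by rewrite /truncated_mean mulrDr addrA.
- rewrite [X in X @ \oo](_ : _ = (fun n => sqdist [seq c.2 | c <- pair_blocks a N 1 n] s t)).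
    exact: pair_dist_cvg.
  by apply/funext => n; rewrite /sqdist big_nil subr0.
rewrite /pair_dist.
have := pair_cov_bound s s; have := pair_cov_bound t t; have := pair_cov_bound s t.
by rewrite -/M !ler_norml => /andP[? _] /andP[_ ?] /andP[_ ?]; lra.
Qed.

End constrained_pairs.

(** * Superadditivity by splitting into blocks *)

Lemma admissible_pull (R : realType) (S S' : finType) (f : S' -> S) (y : S' -> R)
    (F : (S' -> R) -> R) : admissible F ->
  admissible (fun x : S -> R => F (fun s => x (f s) + y s)).
Proof.
apply: (admissible_pullback (A := fun x s => x (f s) + y s)).
  by move=> s d U X mX; exact: measurable_funD.
exists #|S'|%:R, (\sum_s `|y s|); split => //; split; first by rewrite sumr_ge0.
move=> x; apply: (@le_trans _ _ (\sum_s (`|x (f s)| + `|y s|))).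
  by apply: ler_sum => s _; exact: ler_normD.
rewrite big_split lerD2r /= mulr_natl -sumr_const; apply: ler_sum => s _.
by rewrite (bigD1 (f s))//= lerDl sumr_ge0.
Qed.

Section product_constraint.
Context {R : realType} {S S1 S2 : finType}.
Variables (p1 : S -> S1) (p2 : S -> S2) (j : S1 -> S2 -> S).
Hypotheses (p1j : forall s t, p1 (j s t) = s) (p2j : forall s t, p2 (j s t) = t)
  (jp : forall s, j (p1 s) (p2 s) = s).
Variables (Q1 : pred S1) (Q2 : pred S2) (b1 : S1 -> R) (b2 : S2 -> R) (s1 : S1) (s2 : S2).
Hypotheses (Qs1 : Q1 s1) (Qs2 : Q2 s2).

Let Q : pred S := fun s => Q1 (p1 s) && Q2 (p2 s).
Let b s := b1 (p1 s) + b2 (p2 s).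

Lemma lse_product x y :
  lse Q b (fun s => x (p1 s) + y (p2 s)) = lse Q1 b1 x + lse Q2 b2 y.
Proof.
rewrite /lse -lnM ?posrE; [|exact: sum_expR_gt0 Qs1|exact: sum_expR_gt0 Qs2].
congr ln; rewrite big_distrlr pair_big /=.
rewrite (reindex (fun z : S1 * S2 => j z.1 z.2)); last first.
  exists (fun s => (p1 s, p2 s)) => [[u v] _|s _] /=; first by rewrite p1j p2j.
  by rewrite jp.
apply: eq_big => [[u v]|[u v] _] /=; first by rewrite /Q p1j p2j.
by rewrite /b p1j p2j -expRD addrACA.
Qed.

Lemma gmeans_lse_product (B1 : seq (S1 -> R)) (B2 : seq (S2 -> R)) :
  gmeans ([seq c \o p1 | c <- B1] ++ [seq c \o p2 | c <- B2]) (lse Q b) (fun=> 0) =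
  gmeans B1 (lse Q1 b1) (fun=> 0) + gmeans B2 (lse Q2 b2) (fun=> 0).
Proof.
have a1 : admissible (lse Q1 b1) by exact: admissible_lse Qs1.
have a2 : admissible (lse Q2 b2) by exact: admissible_lse Qs2.
have ac (S' : finType) (k : R) : admissible (fun _ : S' -> R => k) by exact: admissible_cst.
rewrite gmeans_cat.
have := gmeans_pull p2 B2 (gmeans [seq c \o p1 | c <- B1] (lse Q b)) (fun=> 0) (fun=> 0).
rewrite (_ : (fun s : S => _ + _) = (fun=> 0)); last by apply/funext => s /=; rewrite addr0.
move=> ->; rewrite (_ : (fun x : S2 -> R => _) = (fun y => gmeans B1 (lse Q1 b1) (fun=> 0) + lse Q2 b2 y)).
  by rewrite gmeansD// gmeans_cst.
apply/funext => y.
rewrite (_ : (fun s => y (p2 s) + 0) = (fun s => (fun=> 0) (p1 s) + y (p2 s))); last first.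
  by apply/funext => s /=; rewrite addr0 add0r.
rewrite (gmeans_pull p1 B1 (lse Q b) (fun=> 0) (y \o p2)) /=.
rewrite (_ : (fun x : S1 -> R => _) = (fun x => lse Q1 b1 x + lse Q2 b2 y)).
  by rewrite gmeansD// gmeans_cst.
by apply/funext => x; exact: lse_product.
Qed.

End product_constraint.

Section superadditivity_continuity.
Context {R : realType}.
Variables (a : 'I_2 -> nat -> R) (h : 'I_2 -> R).
Hypothesis summable_a : forall l : 'I_2, cvgn (fun n : nat => \sum_(1 <= p < n) a l p ^+ 2).
Hypothesis convex_xi : forall l l' : 'I_2,
  convex_function (`[-1, 1]%classic : set R) (xi a l l').
Local Notation pair N := {ffun 'I_2 -> config N}.
Local Notation kap := (normal_moment2 R).
Variable psi : nat -> nat -> R.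
Hypothesis psi_cvg : forall N q, (0 < N)%N -> (q <= N)%N -> truncated_mean a h N q @ \oo --> psi N q.

Definition pair1 N1 N2 (r : pair (N1 + N2)) : pair N1 := [ffun l => left_part (r l)].
Definition pair2 N1 N2 (r : pair (N1 + N2)) : pair N2 := [ffun l => right_part (r l)].
Definition join_pair N1 N2 (r : pair N1) (r' : pair N2) : pair (N1 + N2) :=
  [ffun l => join_config (r l) (r' l)].

(** The overlap of the large system is the average of the block overlaps with weights [N1 / N] and
    [N2 / N], so each term is the convexity inequality multiplied by [N]. *)
Lemma pair_cov_split N1 N2 (r r' : pair (N1 + N2)) : (0 < N1)%N -> (0 < N2)%N ->
  pair_cov a r r' <= pair_cov a (pair1 r) (pair1 r') + pair_cov a (pair2 r) (pair2 r').
Proof.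
move=> N10 N20; rewrite /pair_cov !mulr_sumr -big_split /=; apply: ler_sum => l _.
rewrite !mulr_sumr -big_split /=; apply: ler_sum => l' _; rewrite !ffunE.
have N1r : 0 < N1%:R :> R by rewrite ltr0n.
have N2r : 0 < N2%:R :> R by rewrite ltr0n.
have NE : (N1 + N2)%:R = N1%:R + N2%:R :> R by rewrite natrD.
have Nr : 0 < (N1 + N2)%:R :> R by rewrite NE addr_gt0.
pose t : R := N1%:R / (N1 + N2)%:R.
have t01 : 0 <= t <= 1.
  by rewrite divr_ge0//= ler_pdivrMr// mul1r NE lerDl.
have tE : (N1 + N2)%:R * t = N1%:R by rewrite mulrC divfK ?gt_eqF.
have tE' : (N1 + N2)%:R * (1 - t) = N2%:R by rewrite mulrBr tE mulr1 NE addrC addKr.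
have -> : overlap R (r l) (r' l') = t * overlap R (left_part (r l)) (left_part (r' l')) +
    (1 - t) * overlap R (right_part (r l)) (right_part (r' l')).
  apply: (mulfI (lt0r_neq0 Nr)); rewrite overlap_split// [RHS]mulrDr.
  by rewrite [X in _ = X + _]mulrA [X in _ = _ + X]mulrA tE tE'.
have := convex_functionP (convex_xi l l') t01
  (overlap_bound (left_part (r l)) (left_part (r' l')))
  (overlap_bound (right_part (r l)) (right_part (r' l'))).
move=> /(ler_wpM2l (ltW Nr)); rewrite [leRHS]mulrDr [X in _ <= X + _]mulrA [X in _ <= _ + X]mulrA tE tE'.
exact.
Qed.

(* The correction is the diagonal contribution of [xi a 0 1] to the covariance,
   constant on the constraint set; [kap] is the Gaussian variance. *)
Definition corrected_mean N q : R := psi N q - kap * (N%:R * xi a 0 1 (disagree N q)).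

Lemma corrected_mean_superadditive N1 N2 q1 q2 : (0 < N1)%N -> (0 < N2)%N ->
  (q1 <= N1)%N -> (q2 <= N2)%N ->
  corrected_mean N1 q1 + corrected_mean N2 q2 <= corrected_mean (N1 + N2) (q1 + q2).
Proof.
move=> N10 N20 q1N q2N; have N0 : (0 < N1 + N2)%N by rewrite addn_gt0 N10.
have qN : (q1 + q2 <= N1 + N2)%N by exact: leq_add.
have [r1 Qr1] := at_diff_ex q1N; have [r2 Qr2] := at_diff_ex q2N.
pose x1 := xi a 0 1 (disagree N1 q1); pose x2 := xi a 0 1 (disagree N2 q2).
pose x := xi a 0 1 (disagree (N1 + N2) (q1 + q2)).
(* Between blocks and large system the variance of a pair changes by [2 * e]; a squared distance
   contains two variances, which gives the [4 * e] of the comparison. The cross covariances have the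
   favourable sign by [pair_cov_split]. *)
pose e := N1%:R * x1 + N2%:R * x2 - (N1 + N2)%:R * x.
suff : psi N1 q1 + psi N2 q2 <= psi (N1 + N2) (q1 + q2) + kap * e.
  by rewrite /corrected_mean -/x1 -/x2 -/x /e; lra.
(* The blockwise constraint is stronger than the constraint on the large system, but it is a
   product, so the block means add up; the total constraint is restored at the end by
   [lse_pred_le]. *)
pose Q := fun r : pair (N1 + N2) => at_diff q1 (pair1 r) && at_diff q2 (pair2 r).
have QQ r : Q r -> at_diff (q1 + q2) r.
  by move=> /andP[/eqP e1 /eqP e2]; rewrite /at_diff ndiff_split -e1 -e2 !ffunE.
have j1 (r : pair N1) (r' : pair N2) : pair1 (join_pair r r') = r.
  by apply/ffunP => l; rewrite !ffunE left_part_join.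
have j2 (r : pair N1) (r' : pair N2) : pair2 (join_pair r r') = r'.
  by apply/ffunP => l; rewrite !ffunE right_part_join.
have jj (r : pair (N1 + N2)) : join_pair (pair1 r) (pair2 r) = r.
  by apply/ffunP => l; rewrite !ffunE join_parts.
pose r0 := join_pair r1 r2.
have Qr0 : Q r0 by rewrite /Q j1 j2 Qr1.
have fieldE : @external_field R h (N1 + N2) =
    (fun r => external_field h (pair1 r) + external_field h (pair2 r)).
  apply/funext => r; rewrite /external_field -big_split; apply: eq_bigr => l _ /=.
  by rewrite sum_spin_split mulrDr !ffunE.
pose B1 n := [seq c.2 | c <- pair_blocks a N1 1 n].
pose B2 n := [seq c.2 | c <- pair_blocks a N2 1 n].
pose bs n := [seq c \o @pair1 N1 N2 | c <- B1 n] ++ [seq c \o @pair2 N1 N2 | c <- B2 n].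
pose cs n := [seq c.2 | c <- pair_blocks a (N1 + N2) 1 n].
have cu : (fun n => truncated_mean a h N1 q1 n + truncated_mean a h N2 q2 n) @ \oo --> psi N1 q1 + psi N2 q2.
  by apply: cvgD; exact: psi_cvg.
apply: (@cvgn_le_near R (fun n => truncated_mean a h N1 q1 n + truncated_mean a h N2 q2 n)
  (truncated_mean a h (N1 + N2) (q1 + q2)) _ _ _ kap) => //.
- exact: normal_moment2_ge0.
- exact: psi_cvg.
move=> eps eps0.
pose Del (r r' : pair (N1 + N2)) := pair_dist a (pair1 r) (pair1 r') + pair_dist a (pair2 r) (pair2 r') -
  pair_dist a r r'.
have sq r r' : (fun n => sqdist (bs n) r r' - sqdist (cs n) r r') @ \oo --> Del r r'.
  have -> : (fun n => sqdist (bs n) r r' - sqdist (cs n) r r') = (fun n =>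
      sqdist (B1 n) (pair1 r) (pair1 r') + sqdist (B2 n) (pair2 r) (pair2 r') -
      sqdist (cs n) r r').
    by apply/funext => n; rewrite /bs /sqdist big_cat !big_map.
  apply: cvgB; last exact: pair_dist_cvg.
  by apply: cvgD; exact: pair_dist_cvg.
have De r r' : Q r -> Q r' -> Del r r' <= 4 * e.
  move=> Qr Qr'; have /andP[e1 e2] := Qr; have /andP[e1' e2'] := Qr'.
  rewrite /Del /pair_dist !(pair_cov_diag a N10 e1, pair_cov_diag a N10 e1',
    pair_cov_diag a N20 e2, pair_cov_diag a N20 e2', pair_cov_diag a N0 (QQ _ Qr),
    pair_cov_diag a N0 (QQ _ Qr')).
  have := pair_cov_split r r' N10 N20.
  rewrite -/x1 -/x2 -/x /e natrD.
  lra.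
have := compare_near (@external_field R h (N1 + N2)) (fun=> 0) Qr0 eps0 sq De; apply: filterS => n.
rewrite /bs fieldE (gmeans_lse_product j1 j2 jj (@external_field R h N1)
  (@external_field R h N2) Qr1 Qr2) => H.
rewrite -addrA -mulrDr; apply: le_trans H _; rewrite lerD2r /truncated_mean -fieldE.
apply: le_gmeans => [||y]; try exact: admissible_lse (QQ _ Qr0).
  exact: admissible_lse Qr0.
exact: lse_pred_le Qr0 QQ.
Qed.

End superadditivity_continuity.

(** * Continuity by flipping spins *)

Section flip_sites.
Context {R : realType} {N : nat}.
Implicit Types (r : {ffun 'I_2 -> config N}) (q j : nat).
Local Notation pair := {ffun 'I_2 -> config N}.

Definition diff_sites r : {set 'I_N} := [set i | r 0 i != r 1 i]%SET.

(** Disagreeing sites are flipped to lower the count, agreeing ones to raise it. One of the two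
    truncated differences is zero, so their sum is the distance between [q] and [q']. *)
Definition flip_sites q q' r : {set 'I_N} :=
  first_sites (if (q' <= q)%N then diff_sites r else ~: diff_sites r) ((q - q') + (q' - q)).

Definition flip_pair q q' r : pair := make_pair (r 0) (flip (flip_sites q q' r) (r 1)).

Lemma flip_pair0 q q' r : flip_pair q q' r 0 = r 0.
Proof. by rewrite ffunE. Qed.

Lemma flip_pair1 q q' r : flip_pair q q' r 1 = flip (flip_sites q q' r) (r 1).
Proof. by rewrite ffunE. Qed.

Lemma card_flip_sites q q' r : (q' <= N)%N -> at_diff q r ->
  #|flip_sites q q' r| = ((q - q') + (q' - q))%N.
Proof.
move=> q'N /eqP qr; have cd : #|diff_sites r| = q by [].
rewrite /flip_sites card_first_sites//; case: ifP => [q'q|/negbT].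
  by rewrite cd (eqP (q'q : (q' - q == 0)%N)) addn0 leq_subr.
rewrite -ltnNge => /ltnW qq'; rewrite (eqP (qq' : (q - q' == 0)%N)) add0n.
by rewrite cardsCs finset.setCK cd card_ord leq_sub2r.
Qed.

Lemma at_diff_flip_pair q q' r : (q' <= N)%N -> at_diff q r -> at_diff q' (flip_pair q q' r).
Proof.
move=> q'N Qr; have cj := card_flip_sites q'N Qr; have /eqP qr := Qr.
rewrite /at_diff flip_pair0 flip_pair1; move: cj; rewrite /flip_sites.
case: ifP => [q'q|/negbT].
  rewrite (eqP (q'q : (q' - q == 0)%N)) addn0 => cj.
  by rewrite ndiff_flip_sub ?first_sites_sub// cj qr subKn.
rewrite -ltnNge => /ltnW qq'; rewrite (eqP (qq' : (q - q' == 0)%N)) add0n => cj.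
by rewrite ndiff_flip_add ?first_sites_sub// cj qr subnKC.
Qed.

(** A flip is an involution for a given set of sites, so a pair is recovered from its image and the
    flipped set; a fibre has at most as many elements as there are such sets. *)
Lemma flip_pair_fiber q q' t : (q' <= N)%N ->
  (#|[pred r | at_diff q r && (flip_pair q q' r == t)]| <= 'C(N, (q - q') + (q' - q)))%N.
Proof.
move=> q'N; set A := [pred r | _]; rewrite -[X in 'C(X, _)](card_ord N) -card_draws.
rewrite -(@card_in_imset _ _ (flip_sites q q') A); last first.
  move=> r r'; rewrite !inE => /andP[_ /eqP rt] /andP[_ /eqP rt'] e.
  have E0 : r 0 = r' 0 by rewrite -(flip_pair0 q q') rt -rt' flip_pair0.
  have E1 : r 1 = r' 1.
    apply: (inv_inj (flipK (flip_sites q q' r))).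
    by rewrite {2}e -!flip_pair1 rt rt'.
  apply/ffunP => l; case: l => -[|[|//]] lp.
    by rewrite (_ : Ordinal lp = 0)//; exact: val_inj.
  by rewrite (_ : Ordinal lp = 1)//; exact: val_inj.
apply: subset_leq_card; apply/fintype.subsetP => J /imsetP[r].
by rewrite !inE => /andP[Qr _] ->; rewrite card_flip_sites.
Qed.

Lemma ndiff_flip_pair q q' r l : (q' <= N)%N -> at_diff q r ->
  (ndiff (r l) (flip_pair q q' r l) <= (q - q') + (q' - q))%N.
Proof.
move=> q'N Qr; rewrite ffunE; case: eqP => [->|l0]; first by rewrite ndiff_self.
have -> : l = 1.
  by case: l l0 => -[|[|//]] lp l0; apply: val_inj => //; case: l0; apply: val_inj.
by rewrite ndiff_flip card_flip_sites.
Qed.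

Lemma external_field_flip_pair (h : 'I_2 -> R) q q' r : (q' <= N)%N -> at_diff q r ->
  external_field h r <= external_field h (flip_pair q q' r) +
    2 * `|h 1| * ((q - q') + (q' - q))%N%:R.
Proof.
move=> q'N Qr; rewrite /external_field !sum_ord2 flip_pair0 -addrA lerD2l -lerBlDl.
rewrite -mulrBr -sumrB (le_trans (ler_norm _))// normrM -mulrA mulrCA ler_wpM2l//.
apply: le_trans (ler_norm_sum _ _ _) _.
under eq_bigr do rewrite spin_dist; rewrite -mulr_sumr ler_wpM2l//.
by rewrite -natr_sum -ndiff_sum ler_nat ndiff_flip_pair.
Qed.

End flip_sites.

Section continuity.
Context {R : realType}.
Variables (a : 'I_2 -> nat -> R) (h : 'I_2 -> R).
Hypothesis summable_a : forall l : 'I_2, cvgn (fun n : nat => \sum_(1 <= p < n) a l p ^+ 2).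
Local Notation pair N := {ffun 'I_2 -> config N}.
Local Notation kap := (normal_moment2 R).
Variable psi : nat -> nat -> R.
Hypothesis psi_cvg : forall N q, (0 < N)%N -> (q <= N)%N -> truncated_mean a h N q @ \oo --> psi N q.

(** Changing at most [j] spins in each of two configurations moves their overlap by at most
    [4 * j / N]; the covariance has four terms. *)
Lemma pair_cov_dist N (r r' s s' : pair N) (del om : R) (j : nat) : (0 < N)%N ->
  (forall l l' x y, `|x| <= 1 -> `|y| <= 1 -> `|x - y| <= del ->
    `|xi a l l' x - xi a l l' y| <= om) ->
  (forall l, (ndiff (r l) (s l) <= j)%N) -> (forall l, (ndiff (r' l) (s' l) <= j)%N) ->
  4 * j%:R / N%:R <= del ->
  `|pair_cov a r r' - pair_cov a s s'| <= 4 * (N%:R * om).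
Proof.
move=> N0 xic rs r's' jdel; have Nr : 0 < N%:R :> R by rewrite ltr0n.
rewrite /pair_cov -mulrBr normrM ger0_norm// mulrCA ler_wpM2l// -sumrB.
have dle l l' : `|xi a l l' (overlap R (r l) (r' l')) - xi a l l' (overlap R (s l) (s' l'))| <= om.
  apply: xic; try exact: overlap_bound.
  apply: le_trans (overlap_dist _ _ _ _ N0) _; apply: le_trans jdel.
  rewrite ler_wpM2r ?invr_ge0//.
  have := rs l; have := r's' l'; rewrite -!(ler_nat R); lra.
apply: le_trans (ler_norm_sum _ _ _) _.
apply: (@le_trans _ _ (\sum_(l < 2) \sum_(l' < 2) om)); last by rewrite !sum_ord2; lra.
apply: ler_sum => l _; rewrite -sumrB; apply: le_trans (ler_norm_sum _ _ _) _.
by apply: ler_sum => l' _; exact: dle.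
Qed.

(** First the Gaussian field at [r] is replaced by the field at the flipped pair, at a cost given by
    the modulus of continuity [om]; then the sum is pushed forward along the flip by [lse_fiber_le],
    at the cost of the field and of the binomial coefficient. *)
Lemma mean_lse_le_flip N q q' (j := ((q - q') + (q' - q))%N) (del om : R) : (0 < N)%N ->
  (q <= N)%N -> (q' <= N)%N ->
  (forall l l' x y, `|x| <= 1 -> `|y| <= 1 -> `|x - y| <= del ->
    `|xi a l l' x - xi a l l' y| <= om) ->
  4 * j%:R / N%:R <= del ->
  psi N q <= psi N q' + (2 * `|h 1| * j%:R + ln 'C(N, j)%:R + kap * (4 * (N%:R * om))).
Proof.
move=> N0 qN q'N xic jdel; have [r0 Qr0] := at_diff_ex qN.
pose f := @flip_pair N q q'.
have Qf r : at_diff q r -> at_diff q' (f r) by exact: at_diff_flip_pair.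
pose bs n := [seq c.2 | c <- pair_blocks a N 1 n].
pose cs n := [seq c \o f | c <- bs n].
apply: (@cvgn_le_near R (truncated_mean a h N q) (truncated_mean a h N q') _ _ _ kap).
- exact: normal_moment2_ge0.
- exact: psi_cvg.
- exact: psi_cvg.
move=> eps eps0.
pose Del (r r' : pair N) := pair_dist a r r' - pair_dist a (f r) (f r').
have sq r r' : (fun n => sqdist (bs n) r r' - sqdist (cs n) r r') @ \oo --> Del r r'.
  have -> : (fun n => sqdist (bs n) r r' - sqdist (cs n) r r') = (fun n =>
      sqdist (bs n) r r' - sqdist (bs n) (f r) (f r')).
    by apply/funext => n; rewrite /cs /sqdist !big_map.
  by apply: cvgB; exact: pair_dist_cvg.
have De r r' : at_diff q r -> at_diff q r' -> Del r r' <= 4 * (4 * (N%:R * om)).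
  move=> Qr Qr'.
  have cd s s' : at_diff q s -> at_diff q s' ->
      `|pair_cov a s s' - pair_cov a (f s) (f s')| <= 4 * (N%:R * om).
    by move=> Qs Qs'; apply: (pair_cov_dist N0 xic _ _ jdel) => l; exact: ndiff_flip_pair.
  rewrite /Del /pair_dist.
  have := cd _ _ Qr Qr; have := cd _ _ Qr' Qr'; have := cd _ _ Qr Qr'.
  set c1 := pair_cov a r r; set c2 := pair_cov a r' r'; set c3 := pair_cov a r r'.
  set c4 := pair_cov a (f r) (f r); set c5 := pair_cov a (f r') (f r').
  set c6 := pair_cov a (f r) (f r').
  move: c1 c2 c3 c4 c5 c6 => c1 c2 c3 c4 c5 c6.
  by rewrite !ler_norml => /andP[h1 _] /andP[_ h2] /andP[_ h3]; lra.
have := compare_near (@external_field R h N) (fun=> 0) Qr0 eps0 sq De; apply: filterS => n H.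
apply: le_trans H _; rewrite mulrDr !addrA lerD2r lerD2r.
have := gmeans_pull f (bs n) (lse (at_diff q) (@external_field R h N)) (fun=> 0) (fun=> 0).
rewrite (_ : (fun s : pair N => _ + _) = (fun=> 0)); last by apply/funext => s /=; rewrite addr0.
rewrite -/(cs n) => ->; rewrite -addrA.
have aq := admissible_lse (@external_field R h N) Qr0.
have aq' := admissible_lse (@external_field R h N) (Qf _ Qr0).
have ac : admissible (fun _ : pair N -> R => 2 * `|h 1| * j%:R + ln 'C(N, j)%:R).
  exact: admissible_cst.
rewrite /truncated_mean -/(bs n) -[X in _ <= _ + X](gmeans_cst (bs n) _ (fun=> 0)) -gmeansD//.
apply: le_gmeans => [||x].
- exact: admissible_pull.
- exact: admissibleD.
rewrite (_ : (fun s => x (f s) + 0) = x \o f); last by apply/funext => s /=; rewrite addr0.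
apply: (lse_fiber_le x Qr0 Qf) => [r Qr|t]; first exact: external_field_flip_pair.
exact: flip_pair_fiber.
Qed.

Lemma mean_lse_continuous (eps : R) : 0 < eps -> exists2 del : R, 0 < del &
  forall N q q', (0 < N)%N -> (q <= N)%N -> (q' <= N)%N ->
    `|q%:R - q'%:R| <= del * N%:R -> psi N q <= psi N q' + eps * N%:R.
Proof.
move=> eps0; have kap0 : 0 <= kap by exact: normal_moment2_ge0.
have k1 : 0 < kap + 1 by rewrite ltr_wpDl.
pose om := eps / (16 * (kap + 1)).
have om0 : 0 < om by rewrite divr_gt0// mulr_gt0.
have [d0 d00 xic] := xi_unif_continuous summable_a om0.
(* Budget: [x * N] for the field, [2 * x * N] for the binomial coefficient ([ln_bin_le] with
   parameter [x]) and [x * N] for the covariance. [A] and [B] are the slopes in [j] of the entropy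
   and field costs, with 1 added for positivity. *)
pose x := eps / 4; have x0 : 0 < x by rewrite divr_gt0.
pose A : R := 1 + `|ln x^-1|; pose B : R := 1 + 2 * `|h 1|.
have A0 : 0 < A by rewrite ltr_wpDr.
have B0 : 0 < B by rewrite ltr_wpDr// mulr_ge0.
pose del := Num.min (Num.min (x / A) (x / B)) (d0 / 4).
have del0 : 0 < del by rewrite !lt_min !divr_gt0.
have [dA dB dd] : [/\ del * A <= x, del * B <= x & 4 * del <= d0].
  split; [rewrite -ler_pdivlMr//|rewrite -ler_pdivlMr//|rewrite mulrC -ler_pdivlMr//];
    by rewrite /del !ge_min lexx ?orbT.
exists del => // N q q' N0 qN q'N qq'; have Nr : 0 < N%:R :> R by rewrite ltr0n.
set j := ((q - q') + (q' - q))%N.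
have jE : j%:R = `|q%:R - q'%:R| :> R.
  rewrite /j natrD; case: (leqP q q') => qq.
    by rewrite (eqP (qq : (q - q' == 0)%N)) add0r natrB// distrC ger0_norm// subr_ge0 ler_nat.
  have qq2 := ltnW qq.
  by rewrite (eqP (qq2 : (q' - q == 0)%N)) addr0 natrB// ger0_norm// subr_ge0 ler_nat.
have jdel : j%:R <= del * N%:R by rewrite jE.
have jN : (j <= N)%N.
  rewrite /j; case: (leqP q q') => qq.
    by rewrite (eqP (qq : (q - q' == 0)%N)) add0n (leq_trans (leq_subr _ _)).
  have qq2 := ltnW qq.
  by rewrite (eqP (qq2 : (q' - q == 0)%N)) addn0 (leq_trans (leq_subr _ _)).
have j4 : 4 * j%:R / N%:R <= d0.
  rewrite ler_pdivrMr// (le_trans _ (ler_wpM2r (ltW Nr) dd))//.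
  by rewrite -mulrA ler_wpM2l.
apply: (le_trans (mean_lse_le_flip N0 qN q'N xic j4)); rewrite lerD2l -/j.
have t1 : 2 * `|h 1| * j%:R <= x * N%:R.
  apply: (@le_trans _ _ (B * (del * N%:R))).
    by rewrite ler_pM// ?mulr_ge0// /B lerDr.
  by rewrite mulrA [B * _]mulrC ler_wpM2r.
have t2 : ln 'C(N, j)%:R <= 2 * x * N%:R.
  apply: (le_trans (ln_bin_le x0 jN)).
  have : j%:R * ln x^-1 <= x * N%:R.
    apply: (@le_trans _ _ (del * N%:R * A)).
      apply: (@le_trans _ _ (j%:R * A)); last by rewrite ler_wpM2r// ltW.
      by rewrite ler_wpM2l// (le_trans (ler_norm _))// /A lerDr.
    by rewrite mulrAC ler_wpM2r.
  lra.
have t3 : kap * (4 * (N%:R * om)) <= x * N%:R.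
  have -> : kap * (4 * (N%:R * om)) = kap * (4 * om) * N%:R by ring.
  rewrite ler_wpM2r//.
  have -> : x = (kap + 1) * (4 * om) by rewrite /x /om; field; rewrite gt_eqF.
  by apply: ler_wpM2r; [rewrite mulr_ge0// ltW|rewrite lerDl].
have -> : eps * N%:R = x * N%:R + 2 * x * N%:R + x * N%:R by rewrite /x; field.
by rewrite !lerD.
Qed.

End continuity.

(** * Superadditive limit *)

Section superadditive_limit.
Context {R : realType}.
Variable b : nat -> nat -> R.
Hypothesis superadditive : forall N1 N2 q1 q2, (0 < N1)%N -> (0 < N2)%N ->
  (q1 <= N1)%N -> (q2 <= N2)%N -> b N1 q1 + b N2 q2 <= b (N1 + N2) (q1 + q2).
Hypothesis equicontinuous : forall eps : R, 0 < eps -> exists2 del : R, 0 < del &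
  forall N q q', (0 < N)%N -> (q <= N)%N -> (q' <= N)%N ->
    `|q%:R - q'%:R| <= del * N%:R -> b N q <= b N q' + eps * N%:R.
Hypothesis upper_bound : exists K : R, forall N q, (0 < N)%N -> (q <= N)%N -> b N q <= N%:R * K.

Lemma superadditive_muln t m q : (0 < t)%N -> (0 < m)%N -> (q <= m)%N ->
  t%:R * b m q <= b (t * m) (t * q).
Proof.
case: t => // t _ m0 qm; elim: t => [|t IH]; first by rewrite mul1r !mul1n.
rewrite -natr1 mulrDl mul1r mulSn [(t.+2 * q)%N]mulSn addnC [(q + _)%N]addnC.
apply: le_trans (superadditive _ _ _ _) => //.
- by rewrite lerD2r.
- by rewrite muln_gt0.
- by rewrite leq_mul2l qm orbT.
Qed.

(** The remaining [N %% m] sites are given no disagreement. Only [m] remainders are possible, so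
    their contribution is bounded uniformly in [N]; remainder 0 is separate because blocks must be
    nonempty. *)
Lemma superadditive_edivn m q N : (0 < m)%N -> (q <= m)%N -> (m <= N)%N ->
  (N %/ m)%:R * b m q - \sum_(r < m) `|b r 0%N| <= b N (N %/ m * q).
Proof.
move=> m0 qm mN; have t0 : (0 < N %/ m)%N by rewrite divn_gt0.
have rm : (N %% m < m)%N by rewrite ltn_mod.
have bnd : `|b (N %% m) 0%N| <= \sum_(r < m) `|b r 0%N|.
  by rewrite (bigD1 (Ordinal rm))//= lerDl sumr_ge0.
have := superadditive_muln t0 m0 qm.
have [r0|r0] := posnP (N %% m).
  have -> : (N %/ m * m)%N = N by rewrite [RHS](divn_eq N m) r0 addn0.
  by move=> h; rewrite (le_trans _ h)// gerBl sumr_ge0.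
move=> h; rewrite [X in b X (_ * q)](divn_eq N m) -[(N %/ m * q)%N]addn0.
apply: le_trans (superadditive _ _ _ _) => //.
- by rewrite lerD// lerNl (le_trans _ bnd)// -normrN ler_norm.
- by rewrite muln_gt0 t0.
- by rewrite leq_mul2l qm orbT.
Qed.

(** Copies of the block [(m, q m)] nearly fill size [N], and equicontinuity corrects the resulting
    count of disagreements to [q' N]. Allowing two different sequences yields both existence of the
    limit and its independence of the sequence. *)
Lemma asymptotic_le (x : R) (q q' : nat -> nat) (eps : R) : 0 <= x <= 1 -> 0 < eps ->
  (forall N, (q N <= N)%N) -> (forall N, (q' N <= N)%N) ->
  (fun N => (q N)%:R / N%:R) @ \oo --> x -> (fun N => (q' N)%:R / N%:R) @ \oo --> x ->
  \forall m \near \oo, \forall N \near \oo, b m (q m) / m%:R <= b N (q' N) / N%:R + eps.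
Proof.
move=> /andP[x0 x1] eps0 qN q'N qx q'x.
have e2 : 0 < eps / 2 by rewrite divr_gt0.
have [del del0 bc] := equicontinuous e2.
have d4 : 0 < del / 4 by rewrite divr_gt0.
have /cvgrPdist_le/(_ _ d4) qx' := qx; have /cvgrPdist_le/(_ _ d4) q'x' := q'x.
near=> m.
have m0 : (0 < m)%N by near: m; exists 1%N.
have mr : 0 < m%:R :> R by rewrite ltr0n.
have qmx : `|x - (q m)%:R / m%:R| <= del / 4 by near: m.
pose beta := b m (q m) / m%:R.
(* Every error that does not grow with [N]: the incomplete last block and its remainder. *)
pose c := m%:R * `|beta| + \sum_(r < m) `|b r 0%N|.
have c0 : 0 <= c by rewrite addr_ge0 ?mulr_ge0 ?sumr_ge0.
near=> N; set t := (N %/ m)%N.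
have q'Nx : `|x - (q' N)%:R / N%:R| <= del / 4 by near: N.
have mN : (m <= N)%N by near: N; exists m.
have N0 : (0 < N)%N by exact: leq_trans mN.
have Nr : 0 < N%:R :> R by rewrite ltr0n.
have big1 : 2 * m%:R / del <= N%:R by near: N; exact: nbhs_infty_ger.
have big2 : 2 * c / eps <= N%:R by near: N; exact: nbhs_infty_ger.
have Nt : N%:R = t%:R * m%:R + (N %% m)%:R :> R by rewrite -natrM -natrD -divn_eq.
have rm : (N %% m)%:R <= m%:R :> R by rewrite ler_nat ltnW// ltn_mod.
have r0 : 0 <= (N %% m)%:R :> R by [].
have tmN : t%:R * m%:R <= N%:R :> R by rewrite Nt lerDl.
have tq : (t * q m <= N)%N.
  by rewrite (leq_trans _ (leq_divM N m))// leq_mul2l qN orbT.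
(* Two approximations of [x] cost [del / 4 * N] each, and the incomplete block costs at most [m],
   which [big1] bounds by half of [del * N]. *)
have close : `|(t * q m)%:R - (q' N)%:R| <= del * N%:R.
  have h1 : `|x * N%:R - (q' N)%:R| <= del / 4 * N%:R.
    rewrite -[X in _ <= _ * X](gtr0_norm Nr) -ler_pdivrMr ?normr_gt0 ?gt_eqF//.
    by rewrite -normf_div mulrBl mulfK ?gt_eqF.
  have h2 : `|t%:R * m%:R * x - (t * q m)%:R| <= t%:R * m%:R * (del / 4).
    have -> : t%:R * m%:R * x - (t * q m)%:R = t%:R * m%:R * (x - (q m)%:R / m%:R).
      by rewrite natrM; field; rewrite gt_eqF.
    by rewrite normrM ger0_norm ?mulr_ge0// ler_wpM2l ?mulr_ge0.
  have h3 : t%:R * m%:R * (del / 4) <= N%:R * (del / 4) by rewrite ler_wpM2r// ltW.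
  have h4 : 2 * m%:R <= del * N%:R.
    by move: big1; rewrite ler_pdivrMr// [del * _]mulrC.
  have h5 : 0 <= x * (N %% m)%:R <= m%:R.
    by apply/andP; split; [exact: mulr_ge0|apply: le_trans rm; exact: ler_piMl].
  have h6 : x * N%:R = t%:R * m%:R * x + x * (N %% m)%:R by rewrite Nt; ring.
  move: h1 h2 h5; rewrite h6 !ler_norml => /andP[? ?] /andP[? ?] /andP[? ?].
  by apply/andP; split; lra.
have := bc _ _ _ N0 tq (q'N N) close.
have := superadditive_edivn m0 (qN m) mN; rewrite -/t.
have bE : b m (q m) = beta * m%:R by rewrite /beta divfK ?gt_eqF.
have tb : N%:R * beta - m%:R * `|beta| <= t%:R * b m (q m).
  have : (N %% m)%:R * beta <= m%:R * `|beta|.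
    apply: (@le_trans _ _ ((N %% m)%:R * `|beta|)); first by rewrite ler_wpM2l// ler_norm.
    by rewrite ler_wpM2r.
  have -> : t%:R * b m (q m) = N%:R * beta - (N %% m)%:R * beta by rewrite bE Nt; ring.
  lra.
have cN : 2 * c <= eps * N%:R by move: big2; rewrite ler_pdivrMr// [eps * _]mulrC.
move=> s1 s2.
rewrite -lerBlDr ler_pdivlMr// -/beta.
by move: s1 s2 tb cN; rewrite /c; lra.
Unshelve. all: end_near.
Qed.

Theorem superadditive_cvg (x : R) : 0 <= x <= 1 ->
  exists L : R, forall q : nat -> nat, (forall N, (q N <= N)%N) ->
    (fun N => (q N)%:R / N%:R) @ \oo --> x ->
    (fun N => b N (q N) / N%:R) @ \oo --> L.
Proof.
(* The truncations of [x * N] serve as reference sequence to define the limit. *)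
move=> /[dup] x01 /andP[x0 x1]; pose q N := Num.truncn (x * N%:R).
have qN N : (q N <= N)%N.
  by rewrite -(ler_nat R) (@le_trans _ _ (x * N%:R)) ?truncn_le ?mulr_ge0// ler_piMl.
have qx : (fun N => (q N)%:R / N%:R) @ \oo --> x.
  apply/cvgrPdist_le => e e0; near=> N.
  have N0 : (0 < N)%N by near: N; exists 1%N.
  have Nr : 0 < N%:R :> R by rewrite ltr0n.
  have eN : e^-1 <= N%:R by near: N; exact: nbhs_infty_ger.
  have eN1 : 1 <= e * N%:R by rewrite -ler_pdivrMl// mulr1.
  have -> : x - (q N)%:R / N%:R = (x * N%:R - (q N)%:R) / N%:R by field; rewrite gt_eqF.
  rewrite normrM [`|_^-1|]gtr0_norm ?invr_gt0// ler_pdivrMr//.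
  have : (q N)%:R <= x * N%:R < (q N).+1%:R by rewrite truncn_itv// mulr_ge0.
  rewrite -natr1 => /andP[? ?].
  by rewrite ger0_norm; lra.
pose beta N := b N (q N) / N%:R.
have [K bK] := upper_bound.
have betaK : \forall N \near \oo, beta N <= K.
  exists 1%N => // N /= N0; rewrite /beta ler_pdivrMr ?ltr0n// mulrC.
  exact: bK.
(* The eventual lower bounds of [beta]; their supremum is its lower limit, and [Ei] shows that it is
   also the upper limit. *)
pose E : set R := [set y | \forall N \near \oo, y <= beta N].
have Ei (eps : R) : 0 < eps -> \forall m \near \oo, E (beta m - eps).
  move=> eps0; have := asymptotic_le x01 eps0 qN qN qx qx.
  by apply: filterS => m; apply: filterS => N; rewrite lerBlDr.
have hE : has_sup E.
  split.
    have [m _ mh] := Ei 1 ltr01; exists (beta m - 1); exact: mh (leqnn m).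
  exists K => y yE; have [N [h1 h2]] : exists N, y <= beta N /\ beta N <= K.
    by near \oo => N; exists N; split; near: N.
  exact: le_trans h1 h2.
pose L := sup E.
have lowL (eps : R) : 0 < eps -> \forall N \near \oo, L - eps <= beta N.
  move=> eps0; have [y yE /ltW yL] := sup_adherent eps0 hE.
  by apply: filterS yE => N; exact: le_trans.
have upL (eps : R) : 0 < eps -> \forall N \near \oo, beta N <= L + eps.
  move=> eps0; apply: filterS (Ei _ eps0) => N EN.
  by rewrite -lerBlDr; apply: sup_upper_bound hE _ EN.
exists L => q' q'N q'x; apply/cvgrPdist_le => e e0.
have e2 : 0 < e / 2 by rewrite divr_gt0.
(* For the lower bound the reference sequence is taken at the fixed size [m] and the given one at
   [N]; for the upper bound the roles are exchanged. *)
have low' : \forall N \near \oo, L - e <= b N (q' N) / N%:R.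
  have [m [h1 h2]] : exists m, L - e / 2 <= beta m /\
      \forall N \near \oo, beta m <= b N (q' N) / N%:R + e / 2.
    near \oo => m; exists m; split; first by near: m; exact: lowL.
    by near: m; exact: asymptotic_le x01 e2 qN q'N qx q'x.
  by apply: filterS h2 => N; lra.
have up' : \forall N \near \oo, b N (q' N) / N%:R <= L + e.
  have := asymptotic_le x01 e2 q'N qN q'x qx; apply: filterS => m mh.
  have [N [h1 h2]] : exists N, b m (q' m) / m%:R <= beta N + e / 2 /\ beta N <= L + e / 2.
    by near \oo => N; exists N; split; near: N => //; exact: upL.
  lra.
apply: filterS2 low' up' => N h1 h2.
by rewrite ler_norml; apply/andP; split; lra.
Unshelve. all: end_near.
Qed.

End superadditive_limit.

(** * Limit of the free energy *)

Section corrected_mean.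
Context {R : realType}.
Variables (a : 'I_2 -> nat -> R) (h : 'I_2 -> R).
Hypothesis summable_a : forall l : 'I_2, cvgn (fun n : nat => \sum_(1 <= p < n) a l p ^+ 2).
Local Notation kap := (normal_moment2 R).
Variable psi : nat -> nat -> R.
Hypothesis psi_cvg : forall N q, (0 < N)%N -> (q <= N)%N -> truncated_mean a h N q @ \oo --> psi N q.

Lemma corrected_mean_upper : exists K : R, forall N q, (0 < N)%N -> (q <= N)%N ->
  corrected_mean a psi N q <= N%:R * K.
Proof.
have [K Kh] := mean_lse_upper summable_a psi_cvg.
exists (K + kap * limn (majorant a)) => N q N0 qN; rewrite /corrected_mean mulrDr.
apply: lerD; first exact: Kh.
rewrite -!mulrN mulrCA; do 2![apply: ler_wpM2l; rewrite ?normal_moment2_ge0//].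
have := xi_bound summable_a 0 1 (disagree_bound N0 qN).
by rewrite ler_norml => /andP[]; lra.
Qed.

Lemma corrected_mean_continuous (eps : R) : 0 < eps -> exists2 del : R, 0 < del &
  forall N q q', (0 < N)%N -> (q <= N)%N -> (q' <= N)%N ->
    `|q%:R - q'%:R| <= del * N%:R ->
    corrected_mean a psi N q <= corrected_mean a psi N q' + eps * N%:R.
Proof.
move=> eps0; have kap0 : 0 <= kap by exact: normal_moment2_ge0.
have k1 : 0 < kap + 1 by rewrite ltr_wpDl.
have e2 : 0 < eps / 2 by rewrite divr_gt0.
have om0 : 0 < eps / 2 / (kap + 1) by rewrite divr_gt0.
have [d1 d10 h1] := mean_lse_continuous summable_a psi_cvg e2.
have [d2 d20 h2] := xi_unif_continuous summable_a om0.
exists (Num.min d1 (d2 / 2)); first by rewrite lt_min d10 divr_gt0.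
move=> N q q' N0 qN q'N qq'; have Nr : 0 < N%:R :> R by rewrite ltr0n.
have qq1 : `|q%:R - q'%:R| <= d1 * N%:R.
  by apply: le_trans qq' _; rewrite ler_wpM2r// ge_min lexx.
have qq2 : `|q%:R - q'%:R| <= d2 / 2 * N%:R.
  by apply: le_trans qq' _; rewrite ler_wpM2r// ge_min lexx orbT.
have := h1 _ _ _ N0 qN q'N qq1.
have dd : `|disagree N q - disagree N q'| <= d2.
  have -> : disagree N q - disagree N q' = - (2 / N%:R) * (q%:R - q'%:R) :> R.
    by rewrite /disagree; field; rewrite gt_eqF.
  rewrite mulNr normrN normrM [`|2 / _|]ger0_norm; last by rewrite divr_ge0.
  rewrite mulrAC ler_pdivrMr//; lra.
have := h2 0 1 _ _ (disagree_bound N0 qN) (disagree_bound N0 q'N) dd.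
set X := xi a 0 1 _; set Y := xi a 0 1 _; rewrite ler_norml => /andP[h3 _] h4.
have h5 : kap * (N%:R * (Y - X)) <= eps / 2 * N%:R.
  rewrite mulrCA mulrC ler_wpM2r//.
  apply: (@le_trans _ _ ((kap + 1) * (eps / 2 / (kap + 1)))).
    apply: (@le_trans _ _ (kap * (eps / 2 / (kap + 1)))).
      by rewrite ler_wpM2l//; lra.
    by rewrite ler_wpM2r ?(ltW om0)// lerDl.
  by rewrite mulrC divfK// gt_eqF.
rewrite /corrected_mean -/X -/Y.
by move: h4 h5; rewrite !mulrBr; lra.
Qed.

End corrected_mean.

Lemma overlap_at_diff (R : realType) N q (r : {ffun 'I_2 -> config N}) : (0 < N)%N ->
  (overlap R (r 0) (r 1) == disagree N q) = at_diff q r.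
Proof.
move=> N0; have Nn : N%:R != 0 :> R by rewrite pnatr_eq0 -lt0n.
rewrite overlap_ndiff// /disagree /at_diff (inj_eq (addrI 1)) eqr_opp.
rewrite -!mulrA (inj_eq (mulfI _))// (inj_eq (mulIf _)) ?invr_eq0//.
by rewrite eqr_nat.
Qed.

Theorem theorem1 (R : realType) (d : measure_display) (T : measurableType d)
    (P : probability T R) (g : seq nat -> {RV P >-> R})
    (a : 'I_2 -> nat -> R) (h : 'I_2 -> R)
    (gauss_g : gaussian_disorder g)
    (summable_a : forall l : 'I_2, cvgn (fun n : nat => \sum_(1 <= p < n) a l p ^+ 2))
    (convex_xi : forall l l' : 'I_2,
        convex_function (`[-1, 1]%classic : set R) (xi a l l')) :
  exists Pcal : R -> R,
    forall u : R, -1 <= u <= 1 ->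
    forall uN : nat -> R,
      (forall N : nat, (1 <= N)%N ->
         (exists k : int, - (N%:Z) <= k <= N%:Z /\ uN N = k%:~R / N%:R) /\
         (exists s t : config N, overlap R s t = uN N)) ->
      uN N @[N --> \oo] --> u ->
      free_energy g a h N (uN N) @[N --> \oo] --> (Pcal u)%:E.
Proof.
(* The limit is constructed for each [u] separately, uniformly in the sequence, and choice assembles
   the function; outside [[-1, 1]] any value will do. *)
suff /choice[Pcal Pcalh] : forall u : R, exists p : R, -1 <= u <= 1 ->
    forall uN : nat -> R,
      (forall N : nat, (1 <= N)%N ->
         (exists k : int, - (N%:Z) <= k <= N%:Z /\ uN N = k%:~R / N%:R) /\
         (exists s t : config N, overlap R s t = uN N)) ->
      uN N @[N --> \oo] --> u ->
      free_energy g a h N (uN N) @[N --> \oo] --> p%:E by exists Pcal.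
move=> u; have [u11|u11] := boolP (-1 <= u <= 1); last by exists 0.
pose psi N q : R := fine (\int[P]_w (lse (at_diff q) (@external_field R h N)
  (fun r => \sum_(l < 2) hamiltonian g a l (r l) w))%:E).
have psiP N q : (0 < N)%N -> (q <= N)%N ->
    (\int[P]_w (lse (at_diff q) (@external_field R h N)
      (fun r => \sum_(l < 2) hamiltonian g a l (r l) w))%:E = (psi N q)%:E)%E /\
    truncated_mean a h N q @ \oo --> psi N q.
  move=> N0 qN; have [r0 Qr0] := at_diff_ex qN.
  have [p [pE pcvg]] := mean_lse_hamiltonian gauss_g summable_a (@external_field R h N) N0 Qr0.
  by rewrite /psi pE.
have psi_cvg N q : (0 < N)%N -> (q <= N)%N -> truncated_mean a h N q @ \oo --> psi N q.
  by move=> N0 qN; case: (psiP N q N0 qN).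
have [L Lh] := @superadditive_cvg R (corrected_mean a psi)
  (corrected_mean_superadditive summable_a convex_xi psi_cvg)
  (corrected_mean_continuous summable_a psi_cvg) (corrected_mean_upper summable_a psi_cvg)
  ((1 - u) / 2) ltac:(lra).
(* [L] is the limit of the corrected means per site; the subtracted diagonal term is added back, and
   its limit follows from continuity of [xi a 0 1]. *)
exists (L + normal_moment2 R * xi a 0 1 u) => _ uN uNh uNu.
(* The overlap of an actual pair makes this quantity a natural number, so truncation only changes
   its type. *)
pose q N := Num.truncn ((1 - uN N) / 2 * N%:R).
have qP N : (0 < N)%N -> (q N <= N)%N /\ uN N = disagree N (q N).
  move=> N0; have [_ [s [t st]]] := uNh N N0.
  suff -> : q N = ndiff s t by rewrite ndiff_le -st overlap_ndiff.
  rewrite /q -st overlap_ndiff// -[RHS](@natrK R); congr Num.truncn.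
  by field; rewrite pnatr_eq0 -lt0n.
have qN N : (q N <= N)%N.
  (* Nothing is known about [uN 0], but the factor [N = 0] makes the count vanish. *)
  by have [->|/qP[]//] := posnP N; rewrite /q mulr0 truncn0.
have qx : (fun N => (q N)%:R / N%:R) @ \oo --> (1 - u) / 2.
  apply: (@cvg_trans _ ((fun N => (1 - uN N) / 2) @ \oo)).
    apply: near_eq_cvg; exists 1%N => // N /= N0; rewrite (qP N N0).2 /disagree.
    by field; rewrite pnatr_eq0 -lt0n.
  by apply: cvgMl; apply: cvgB => //; exact: cvg_cst.
have u1 : `|u| <= 1 by rewrite ler_norml.
have xicvg : (fun N => xi a 0 1 (uN N)) @ \oo --> xi a 0 1 u.
  apply/cvgrPdist_le => e e0; have [del del0 xic] := xi_unif_continuous summable_a e0.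
  have /cvgrPdist_le/(_ _ del0) H := uNu.
  near=> N; have N0 : (0 < N)%N by near: N; exists 1%N.
  apply: xic => //; last by near: N.
  by have [qNN ->] := qP N N0; exact: disagree_bound.
have fe N : (0 < N)%N -> free_energy g a h N (uN N) =
    (corrected_mean a psi N (q N) / N%:R + normal_moment2 R * xi a 0 1 (uN N))%:E.
  move=> N0; have [qNN uNE] := qP N N0; rewrite /free_energy unlock.
  have -> : (\int[P]_w (ln (partition_function g a h N (uN N) w))%:E = (psi N (q N))%:E)%E.
    rewrite -(psiP N (q N) N0 qNN).1; apply: eq_integral => w _; congr (_%:E).
    rewrite /partition_function /lse uNE; congr ln.
    apply: eq_big => [r|r _]; first exact: overlap_at_diff.
    by rewrite addrC.
  rewrite -EFinM /corrected_mean -uNE; congr (_%:E).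
  by field; rewrite pnatr_eq0 -lt0n.
apply/cvg_EFin.
  by exists 1%N => // N /= N0; rewrite fe.
apply: (@cvg_trans _ ((fun N => corrected_mean a psi N (q N) / N%:R +
    normal_moment2 R * xi a 0 1 (uN N)) @ \oo)).
  by apply: near_eq_cvg; exists 1%N => // N /= N0; rewrite /= fe.
apply: cvgD; first exact: Lh.
exact: cvgMr.
Unshelve. all: end_near.
Qed.
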